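(* $p_{\mathrm{giant}}\le 0.5847$, where $$p_{\mathrm{giant}}=\inf\Big\{p : \exists\, C>0 \text{ such that } \lim_{n\to\infty}\ \inf_{\mu\in\mathcal{D}_{\ge p}(Q_n)}\mathbb{P}_\mu\big(Q_n\text{ has a component of size at least } C\cdot 2^n\big)=1\Big\}.$$
   Context: $Q_n$ is the $n$-dimensional hypercube graph with vertex set $\{0,1\}^n$, two vertices being adjacent iff they differ in exactly one coordinate. A bond percolation model on a graph $G$ is a probability distribution on the spanning subgraphs of $G$; an edge is open if it is present in the random subgraph and closed otherwise. The model is 1-independent if, for any two disjoint sets of edges $S_1$, $S_2$ of $G$ such that no edge in $S_1$ shares a vertex with an edge in $S_2$, the states (open or closed) of the edges in $S_1$ are independent of the states of the edges in $S_2$. $\mathcal{D}_{\ge p}(G)$ is the class of 1-independent bond percolation models on $G$ in which each edge is open with probability at least $p$. In the definition of $p_{\mathrm{giant}}$, ''component'' means a connected component of the random spanning subgraph of $Q_n$ distributed according to $\mu$, and its size is its number of vertices. *)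

(* Defs.v *)
From HB Require Import structures.
From mathcomp Require Import all_boot all_order all_algebra.

Set Implicit Arguments.
Unset Strict Implicit.
Unset Printing Implicit Defensive.

Import Order.TTheory GRing.Theory Num.Theory.

Local Open Scope ring_scope.

Record sgraph := SGraph {
  vertex :> finType;
  adj : rel vertex;
  adj_sym : symmetric adj;
  adj_irr : irreflexive adj }.

Definition edges (G : sgraph) : {set {set G}} :=
  [set e : {set G} | [exists x : G, exists y : G,
     adj x y && (e == [set x; y])]].

Definition hypercube_adj (n : nat) : rel {ffun 'I_n -> bool} :=
  fun x y => #|[set i : 'I_n | x i != y i]| == 1%N.

Lemma hypercube_adj_sym n : symmetric (@hypercube_adj n).
Proof.
move=> x y; rewrite /hypercube_adj.
have -> // : [set i : 'I_n | x i != y i] = [set i : 'I_n | y i != x i].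
by apply/setP => i; rewrite !inE eq_sym.
Qed.

Lemma hypercube_adj_irr n : irreflexive (@hypercube_adj n).
Proof.
move=> x; rewrite /hypercube_adj.
have -> : [set i : 'I_n | x i != x i] = set0.
  by apply/setP => i; rewrite !inE eqxx.
by rewrite cards0.
Qed.

Definition hypercube (n : nat) : sgraph :=
  SGraph (@hypercube_adj_sym n) (@hypercube_adj_irr n).

(* A spanning subgraph of G is identified with its set of open edges. *)
Record bond_model (R : numDomainType) (G : sgraph) := BondModel {
  mass :> {set {set G}} -> R;
  mass_ge0 : forall w : {set {set G}}, 0 <= mass w;
  mass_supp : forall w : {set {set G}}, ~~ (w \subset edges G) -> mass w = 0;
  mass_sum1 : \sum_(w : {set {set G}}) mass w = 1 }.

Definition prob (R : numDomainType) (G : sgraph) (mu : bond_model R G)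
  (A : pred {set {set G}}) : R := \sum_(w : {set {set G}} | A w) mu w.

(* The states of the edges in S under w are encoded by the random set w :&: S,
   and independence is that of two random variables with finitely many values:
   the product rule for every pair of events {w :&: S1 \in A1} and
   {w :&: S2 \in A2}. *)
Definition one_independent (R : numDomainType) (G : sgraph)
    (mu : bond_model R G) : Prop :=
  forall S1 S2 : {set {set G}},
    S1 \subset edges G -> S2 \subset edges G -> [disjoint S1 & S2] ->
    (forall e f : {set G}, e \in S1 -> f \in S2 -> [disjoint e & f]) ->
  forall A1 A2 : {set {set {set G}}},
    prob mu (fun w => (w :&: S1 \in A1) && (w :&: S2 \in A2)) =
    prob mu (fun w => w :&: S1 \in A1) * prob mu (fun w => w :&: S2 \in A2).

Definition open_with_prob_ge (R : numDomainType) (G : sgraph) (p : R)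
    (mu : bond_model R G) : Prop :=
  forall e : {set G}, e \in edges G -> p <= prob mu (fun w => e \in w).

Definition component (G : sgraph) (w : {set {set G}}) (x : G) : {set G} :=
  [set y | connect (fun u v : G => [set u; v] \in w) x y].

Definition has_component_ge (R : numDomainType) (G : sgraph) (s : R) :
    pred {set {set G}} :=
  fun w => [exists x : G, s <= #|component w x|%:R].

From mathcomp Require Import all_classical all_reals all_analysis.
Import numFieldNormedType.Exports.
Local Open Scope classical_set_scope.

Definition one_indep_class (R : realType) (p : R) (G : sgraph) :
    set (bond_model R G) :=
  [set mu | one_independent mu /\ open_with_prob_ge p mu].

(* Infima are taken in the extended reals, where the empty set has infimum +oo.
   In particular a real p > 1, for which the class is empty as soon as n > 0,
   does not belong to the set defining p_giant. *)
Definition inf_prob_giant (R : realType) (p C : R) (n : nat) : \bar R :=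
  ereal_inf [set (prob mu (has_component_ge (C * 2 ^+ n)))%:E |
             mu in @one_indep_class R p (hypercube n)].

Definition p_giant (R : realType) : \bar R :=
  ereal_inf [set p%:E | p in [set p : R | exists2 C : R, 0 < C &
    inf_prob_giant p C n @[n --> \oo] --> 1%:E]].

(* Main.v *)
Require Import Defs.
From mathcomp Require Import all_boot all_order all_algebra.
From mathcomp Require Import ring lra zify.

(** Split the coordinates of [Q_n] into a bounded number [K] of resource
    coordinates and [m = n - K] cell coordinates.  Gray codes embed a grid of
    [2^m] cells into [Q_m], and a cell stands for a copy of [Q_K].

    Inside a cell, choose ports [a_i], [b_k] among the resource coordinates:
    the base vertex [z] gets the branches [z + a_i], [z + b_k] and the leaves
    [z + a_i + b_k], so that two branches are connected when both edges to
    their common leaf are open.  By Ramsey's theorem the ports can be chosen so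
    that the edges of every star are almost exchangeable.  Then the
    deviations of the edges from the empirical degrees of the stars are
    uncorrelated up to a small error, and a cut-norm estimate gives a
    deterministic picture: one main component contains a fraction [A] of the
    left branches and [B] of the right ones with
    [A (t + s - 1) >= p + s - 1] and [B (t + s - 1) >= p + t - 1], [t] and [s]
    being the top degrees of the two families.  If the main components at two
    adjacent bases were different, the edges between the leaves would force
    [t s' <= 1 - p] and [t' s <= 1 - p], the edges between the branches
    [A + A' <= 2 - p] and [B + B' <= 2 - p], and this is impossible for
    [p >= 0.5847].  Two families of ports at the same base are compared through
    the vertices [z + i + j], which are branches of both of them.

    Hence adjacent cells are linked with probability close to 1, and this is a
    1-independent model on a grid.  A renormalisation, in which a block edge
    fails only if two vertex-disjoint edges of the two blocks fail, so that
    failure probabilities are squared at each level, links a positive fraction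
    of the cells. *)

Set Implicit Arguments.
Unset Strict Implicit.
Unset Printing Implicit Defensive.

Import Order.TTheory GRing.Theory Num.Theory.

Local Open Scope ring_scope.

(** * Expectation and independence *)

(** 1-independence is silent about edges that share a vertex, so the edges of one star may be
    correlated arbitrarily. A second-moment estimate sees only pairs of them, hence it is enough
    that Ramsey makes the pair probabilities of each star nearly constant. Deviations are taken from
    the random degree of the star and not from an expectation; the degrees remain arbitrary, and the
    deterministic argument works for all degrees of mean about [p]. Between adjacent bases the
    product [t * s'] replaces [t + s' - 1], because the two bases lie on opposite sides of a
    direction.

    Ports must be homogeneous at vertices reached through other ports, a circular demand. It is
    broken by choosing one family against a whole reserve of coordinates and the other one inside
    that reserve; this is done inside a cell, and again between the two colours of a chessboard
    colouring of the cells. Only a fixed failure probability is needed before the renormalisation,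
    so [K] does not depend on [n]. Links are computed inside the union of two cells, so that they
    form a 1-independent model. *)

Section Expectation.
Context (R : realFieldType) (G : sgraph) (mu : bond_model R G).
Implicit Types (f g : {set {set G}} -> R) (A B : pred {set {set G}}).

Definition expect f : R := \sum_w mu w * f w.
Local Notation E := expect.

Lemma probE A : prob mu A = E (fun w => (A w)%:R).
Proof.
rewrite /prob /E big_mkcond; apply: eq_bigr => w _.
by case: (A w); rewrite ?mulr1 ?mulr0.
Qed.

Lemma eq_expect f g : f =1 g -> E f = E g.
Proof. by move=> fg; apply: eq_bigr => w _; rewrite fg. Qed.

Lemma expectD f g : E (fun w => f w + g w) = E f + E g.
Proof. by rewrite /E -big_split; apply: eq_bigr => w _; rewrite mulrDr. Qed.

Lemma expectZ c f : E (fun w => c * f w) = c * E f.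
Proof. by rewrite /E mulr_sumr; apply: eq_bigr => w _; rewrite mulrCA. Qed.

Lemma expectB f g : E (fun w => f w - g w) = E f - E g.
Proof.
rewrite -[- E g]mulN1r -expectZ -expectD.
by apply: eq_expect => w; rewrite mulN1r.
Qed.

Lemma expect_cst c : E (fun=> c) = c.
Proof. by rewrite /E -mulr_suml mass_sum1 mul1r. Qed.

Lemma expect_sum (I : Type) (r : seq I) (P : pred I) (F : I -> {set {set G}} -> R) :
  E (fun w => \sum_(i <- r | P i) F i w) = \sum_(i <- r | P i) E (F i).
Proof.
rewrite /E exchange_big; apply: eq_bigr => w _; rewrite mulr_sumr.
by [].
Qed.

Lemma ler_expect f g : (forall w, f w <= g w) -> E f <= E g.
Proof. by move=> fg; apply: ler_sum => w _; rewrite ler_wpM2l ?mass_ge0. Qed.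

Lemma ler_norm_expect f : `|E f| <= E (fun w => `|f w|).
Proof.
apply: le_trans (ler_norm_sum _ _ _) _; apply: ler_sum => w _.
by rewrite normrM ger0_norm ?mass_ge0.
Qed.

Lemma expect_norm_le c f : (forall w, `|f w| <= c) -> `|E f| <= c.
Proof.
move=> fc; apply: le_trans (ler_norm_expect _) _.
by rewrite -[leRHS]expect_cst; apply: ler_expect.
Qed.

Lemma prob_ge0 A : 0 <= prob mu A.
Proof. by apply: sumr_ge0 => w _; apply: mass_ge0. Qed.

Lemma prob_le1 A : prob mu A <= 1.
Proof.
rewrite probE -[leRHS](expect_cst 1); apply: ler_expect => w.
by case: (A w); rewrite ?ler01.
Qed.

Lemma le_prob A B : (forall w, A w -> B w) -> prob mu A <= prob mu B.
Proof.
move=> AB; rewrite !probE; apply: ler_expect => w.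
by rewrite ler_nat; case: (A w) (AB w) => // ->.
Qed.

Lemma eq_prob A B : A =1 B -> prob mu A = prob mu B.
Proof. by move=> AB; apply: eq_bigl => w; apply: AB. Qed.

Lemma prob_setC A : prob mu (fun w => ~~ A w) = 1 - prob mu A.
Proof.
rewrite !probE -[X in X - _](expect_cst 1) -expectB; apply: eq_expect => w.
by case: (A w); rewrite ?subrr ?subr0.
Qed.

Lemma prob_or A B : prob mu (fun w => A w || B w) <= prob mu A + prob mu B.
Proof.
rewrite !probE -expectD; apply: ler_expect => w.
by case: (A w); case: (B w); rewrite ?addr0 ?add0r ?lexx // lerDl ler01.
Qed.

Lemma prob_has (I : eqType) (r : seq I) (P : I -> pred {set {set G}}) :
  prob mu (fun w => has (fun i => P i w) r) <= \sum_(i <- r) prob mu (P i).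
Proof.
elim: r => [|i r IH].
  by rewrite big_nil /prob big_pred0.
by rewrite big_cons; apply: le_trans (prob_or _ _) _; rewrite lerD2l.
Qed.

Lemma markov f c : (forall w, 0 <= f w) -> 0 < c ->
  prob mu (fun w => c <= f w) <= E f / c.
Proof.
move=> f0 c0; rewrite ler_pdivlMr // probE mulrC -expectZ.
apply: ler_expect => w; case: (leP c (f w)) => [cf|_]; first by rewrite mulr1.
by rewrite mulr0.
Qed.

Definition inner (V : {set G}) : {set {set G}} :=
  [set e in edges G | e \subset V].

Lemma in_inner V e : (e \in inner V) = (e \in edges G) && (e \subset V).
Proof. by rewrite in_set. Qed.

(** The function is determined by the edges inside [V]. Vertex sets are the convenient index:
    disjoint ones carry edge sets without a common vertex, as 1-independence demands. *)
Definition dep (V : {set G}) (T : Type) (f : {set {set G}} -> T) :=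
  forall w, f w = f (w :&: inner V).

Lemma inner_mono (V V' : {set G}) : V \subset V' -> inner V \subset inner V'.
Proof.
move=> VV'; apply/subsetP => e; rewrite !in_inner => /andP[-> eV].
exact: subset_trans eV VV'.
Qed.

Lemma dep_mono (V V' : {set G}) T (f : {set {set G}} -> T) :
  V \subset V' -> dep V f -> dep V' f.
Proof.
move=> VV' df w; rewrite [LHS]df [RHS]df -setIA.
by rewrite (setIidPr (inner_mono VV')).
Qed.

Lemma dep2 (V : {set G}) T T1 T2 (h : T1 -> T2 -> T)
    (f1 : {set {set G}} -> T1) (f2 : {set {set G}} -> T2) :
  dep V f1 -> dep V f2 -> dep V (fun w => h (f1 w) (f2 w)).
Proof. by move=> d1 d2 w; rewrite d1 d2. Qed.

Lemma dep1 (V : {set G}) T T1 (h : T1 -> T) (f1 : {set {set G}} -> T1) :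
  dep V f1 -> dep V (fun w => h (f1 w)).
Proof. by move=> d1 w; rewrite d1. Qed.

Lemma dep_sum (V : {set G}) (I : Type) (r : seq I) (P : pred I)
    (F : I -> {set {set G}} -> R) :
  (forall i, dep V (F i)) -> dep V (fun w => \sum_(i <- r | P i) F i w).
Proof. by move=> dF w; apply: eq_bigr => i _; apply: dF. Qed.

Lemma dep_mem (V : {set G}) (e : {set G}) :
  e \in edges G -> e \subset V -> dep V (fun w => e \in w).
Proof. by move=> eE eV w; rewrite in_setI in_inner eE eV !andbT. Qed.

Hypothesis ind : one_independent mu.

(** The definition factors only events on the restrictions [w :&: S]; these take finitely many
    values, so both functions are sums of indicators of such events. *)
Lemma expect_indep (V1 V2 : {set G}) f g : [disjoint V1 & V2] ->
  dep V1 f -> dep V2 g -> E (fun w => f w * g w) = E f * E g.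
Proof.
move=> dV d1 d2.
pose S1 := inner V1; pose S2 := inner V2.
have s1 : S1 \subset edges G by apply/subsetP => e; rewrite in_inner => /andP[].
have s2 : S2 \subset edges G by apply/subsetP => e; rewrite in_inner => /andP[].
have dS : [disjoint S1 & S2].
  rewrite -setI_eq0; apply/eqP/setP => e; rewrite in_setI !in_inner in_set0.
  apply/negbTE/negP => /andP[/andP[eE eV1] /andP[_ eV2]].
  move: (eE); rewrite inE => /existsP[x /existsP[y /andP[_ /eqP ee]]].
  have xe : x \in e by rewrite ee !inE eqxx.
  have := disjointFr dV (subsetP eV1 _ xe).
  by rewrite (subsetP eV2 _ xe).
have dS' (e e' : {set G}) : e \in S1 -> e' \in S2 -> [disjoint e & e'].
  rewrite !in_inner => /andP[_ eV] /andP[_ eV'].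
  exact: disjointWl eV (disjointWr eV' dV).
have indS v u := ind s1 s2 dS dS' [set v] [set u].
have decomp (h : {set {set G}} -> R) (S : {set {set G}}) w : 
    h (w :&: S) = \sum_v h v * (w :&: S \in [set v])%:R.
  rewrite (bigD1 (w :&: S)) //= !inE eqxx mulr1 big1 ?addr0 // => v.
  by rewrite !inE eq_sym => /negbTE->; rewrite mulr0.
have e1 : E f = \sum_v f v * prob mu (fun w => w :&: S1 \in [set v]).
  transitivity (E (fun w => \sum_v f v * (w :&: S1 \in [set v])%:R)).
    by apply: eq_expect => w; rewrite d1 decomp.
  rewrite expect_sum; apply: eq_bigr => v _.
  by rewrite expectZ probE.
have e2 : E g = \sum_v g v * prob mu (fun w => w :&: S2 \in [set v]).
  transitivity (E (fun w => \sum_v g v * (w :&: S2 \in [set v])%:R)).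
    by apply: eq_expect => w; rewrite d2 decomp.
  rewrite expect_sum; apply: eq_bigr => v _.
  by rewrite expectZ probE.
rewrite e1 e2 mulr_suml.
transitivity (E (fun w => \sum_v \sum_u f v * g u *
    ((w :&: S1 \in [set v]) && (w :&: S2 \in [set u]))%:R)).
  apply: eq_expect => w; rewrite d1 d2 !decomp mulr_suml.
  apply: eq_bigr => v _; rewrite mulr_sumr; apply: eq_bigr => u _.
  rewrite mulrACA; congr (_ * _).
  by case: (_ \in _); rewrite ?mul1r ?mul0r.
rewrite expect_sum; apply: eq_bigr => v _.
rewrite expect_sum mulr_sumr; apply: eq_bigr => u _.
rewrite expectZ.
rewrite -(probE (fun w => (w :&: S1 \in [set v]) && (w :&: S2 \in [set u]))).
by rewrite indS mulrACA.
Qed.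

Lemma prob_indep (V1 V2 : {set G}) A B : [disjoint V1 & V2] ->
  dep V1 A -> dep V2 B ->
  prob mu (fun w => A w && B w) = prob mu A * prob mu B.
Proof.
move=> dV d1 d2; rewrite !probE.
rewrite -(@expect_indep V1 V2) //; last 2 first.
- exact: (dep1 (fun b : bool => b%:R) d1).
- exact: (dep1 (fun b : bool => b%:R) d2).
by apply: eq_expect => w; case: (A w); case: (B w); rewrite ?mulr1 ?mulr0.
Qed.

End Expectation.

Lemma prob_nand (R : realFieldType) (G : sgraph) (mu : bond_model R G)
    (A B : pred {set {set G}}) (a b : R) :
  prob mu (fun w => ~~ A w) <= a -> prob mu (fun w => ~~ B w) <= b ->
  prob mu (fun w => ~~ (A w && B w)) <= a + b.
Proof.
move=> ha hb; rewrite (eq_prob mu (B := fun w => ~~ A w || ~~ B w)).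
  exact: le_trans (prob_or _ _ _) (lerD ha hb).
by move=> w; rewrite negb_and.
Qed.

(** * The cut lemma *)

Section Cut.
Context (R : realFieldType).

Lemma sqr_sum_le (I : finType) (x : I -> R) :
  (\sum_i x i) ^+ 2 <= #|I|%:R * \sum_i x i ^+ 2.
Proof.
have h : 0 <= \sum_i \sum_j (x i - x j) ^+ 2.
  by apply: sumr_ge0 => i _; apply: sumr_ge0 => j _; apply: sqr_ge0.
have e : \sum_i \sum_j (x i - x j) ^+ 2 =
    2 * (#|I|%:R * \sum_i x i ^+ 2 - (\sum_i x i) ^+ 2).
  transitivity (\sum_i \sum_j (x i ^+ 2 + x j ^+ 2 - 2 * (x i * x j))).
    by apply: eq_bigr => i _; apply: eq_bigr => j _; ring.
  transitivity (\sum_i (#|I|%:R * x i ^+ 2 + \sum_j x j ^+ 2 -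
                        2 * (x i * \sum_j x j))).
    apply: eq_bigr => i _; rewrite sumrB big_split /= sumr_const.
    by rewrite -mulr_sumr -mulr_sumr -[x i ^+ 2 *+ _]mulr_natl.
  rewrite sumrB big_split /= -mulr_sumr sumr_const -mulr_sumr -mulr_suml.
  by rewrite -[_ *+ _]mulr_natl; ring.
by move: h; rewrite e pmulr_rge0 ?ltr0n // subr_ge0.
Qed.

(** A weighted count of closed 4-cycles [k, i, k', l]; in matrix terms, the trace of the square of
    [z z^T]. It controls the cut norm and is a polynomial whose expectation can be computed. *)
Definition cut_energy N (z : 'I_N -> 'I_N -> R) : R :=
  \sum_k \sum_k' (\sum_i z k i * z k' i) ^+ 2.

Lemma sqr_le1 (x : R) : `|x| <= 1 -> x ^+ 2 <= 1.
Proof. by move=> x1; rewrite -(real_normK (num_real x)) expr_le1. Qed.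

(** Cauchy-Schwarz twice: over [i] to remove [d], then over the pairs [k, k'] to remove [c]. *)
Lemma cut_energy_bound N (z : 'I_N -> 'I_N -> R) (c d : 'I_N -> R) :
  (forall k, `|c k| <= 1) -> (forall i, `|d i| <= 1) ->
  (\sum_i d i * \sum_k c k * z k i) ^+ 4 <= N%:R ^+ 4 * cut_energy z.
Proof.
move=> c1 d1.
set S := \sum_i _.
pose t i := \sum_k c k * z k i.
have S2 : S ^+ 2 <= N%:R * \sum_i t i ^+ 2.
  apply: le_trans (sqr_sum_le _) _.
  rewrite card_ord ler_wpM2l ?ler0n //; apply: ler_sum => i _.
  by rewrite exprMn ler_piMl ?sqr_ge0 ?sqr_le1.
have tE : \sum_i t i ^+ 2 =
    \sum_(u : 'I_N * 'I_N) c u.1 * c u.2 * \sum_i z u.1 i * z u.2 i.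
  rewrite -(pair_bigA _ (fun k k' => c k * c k' * \sum_i z k i * z k' i)) /=.
  transitivity (\sum_i \sum_k \sum_k' c k * c k' * (z k i * z k' i)).
    apply: eq_bigr => i _; rewrite expr2 /t mulr_suml; apply: eq_bigr => k _.
    by rewrite mulr_sumr; apply: eq_bigr => k' _; ring.
  rewrite exchange_big; apply: eq_bigr => k _.
  rewrite exchange_big; apply: eq_bigr => k' _.
  by rewrite mulr_sumr.
have t4 : (\sum_i t i ^+ 2) ^+ 2 <= N%:R ^+ 2 * cut_energy z.
  rewrite tE; apply: le_trans (sqr_sum_le _) _.
  rewrite card_prod card_ord natrM -expr2 ler_wpM2l ?exprn_ge0 ?ler0n //.
  rewrite /cut_energy (pair_bigA _ (fun k k' => (\sum_i z k i * z k' i) ^+ 2)) /=.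
  apply: ler_sum => -[k k'] _ /=.
  rewrite exprMn ler_piMl ?sqr_ge0 // sqr_le1 // normrM.
  by rewrite mulr_ile1.
have -> : S ^+ 4 = (S ^+ 2) ^+ 2 by rewrite -exprM.
have t0 : 0 <= \sum_i t i ^+ 2 by apply: sumr_ge0 => i _; apply: sqr_ge0.
apply: le_trans (_ : (N%:R * \sum_i t i ^+ 2) ^+ 2 <= _).
  by rewrite lerXn2r // ?nnegrE ?sqr_ge0 ?mulr_ge0 ?ler0n.
rewrite exprMn; apply: le_trans (_ : N%:R ^+ 2 * (N%:R ^+ 2 * cut_energy z) <= _).
  by rewrite ler_wpM2l ?exprn_ge0 ?ler0n.
by rewrite mulrA -exprD.
Qed.

Lemma cut_bound N (z : 'I_N -> 'I_N -> R) (eta : R) (c d : 'I_N -> R) :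
  0 <= eta -> cut_energy z < eta ^+ 4 * N%:R ^+ 4 ->
  (forall k, `|c k| <= 1) -> (forall i, `|d i| <= 1) ->
  `|\sum_i d i * \sum_k c k * z k i| <= eta * N%:R ^+ 2.
Proof.
move=> eta0 zE c1 d1.
have h := cut_energy_bound z c1 d1.
rewrite -(@ler_pXn2r _ 4%N) ?nnegrE ?mulr_ge0 ?exprn_ge0 ?ler0n //.
have -> : `|\sum_i d i * \sum_k c k * z k i| ^+ 4 = 
    (\sum_i d i * \sum_k c k * z k i) ^+ 4.
  by rewrite -normrX ger0_norm // (exprM _ 2 2) sqr_ge0.
apply: le_trans h _.
have -> : (eta * N%:R ^+ 2) ^+ 4 = N%:R ^+ 4 * (eta ^+ 4 * N%:R ^+ 4) :> R.
  by rewrite exprMn -exprM; ring.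
by rewrite ler_wpM2l ?exprn_ge0 ?ler0n // ltW.
Qed.

Context (G : sgraph) (mu : bond_model R G).
Local Notation E := (expect mu).

(** The expected energy is a sum over 4-cycles [k, i, k', l]. Those with [k = k'] or [i = l] number
    at most [2 N^3] and cost the term [2 / N]; Markov does the rest. *)
Lemma cut_prob N (z : 'I_N -> 'I_N -> {set {set G}} -> R) (eps eta : R) :
  (0 < N)%N -> 0 <= eps -> 0 < eta ->
  (forall k i w, `|z k i w| <= 1) ->
  (forall k k' i l, k != k' -> i != l ->
     E (fun w => (z k i w * z k l w) * (z k' i w * z k' l w)) <= eps) ->
  prob mu (fun w => eta ^+ 4 * N%:R ^+ 4 <= cut_energy (fun k i => z k i w))
    <= (2 / N%:R + eps) / eta ^+ 4.
Proof.
move=> N0 eps0 eta0 z1 zE.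
have N0' : 0 < N%:R :> R by rewrite ltr0n.
apply: le_trans (markov _ _ _) _.
- by move=> w; apply: sumr_ge0 => k _; apply: sumr_ge0 => k' _; apply: sqr_ge0.
- by rewrite mulr_gt0 ?exprn_gt0.
suff h : E (fun w => cut_energy (fun k i => z k i w)) <=
    2 * N%:R ^+ 3 + eps * N%:R ^+ 4.
  apply: le_trans (_ : (2 * N%:R ^+ 3 + eps * N%:R ^+ 4) / (eta ^+ 4 * N%:R ^+ 4) <= _).
    by rewrite ler_pM2r // invr_gt0 mulr_gt0 ?exprn_gt0.
  rewrite le_eqVlt; apply/orP; left; apply/eqP; field.
  by rewrite !lt0r_neq0.
have termE k k' : E (fun w => (\sum_i z k i w * z k' i w) ^+ 2) =
    \sum_i \sum_l E (fun w => (z k i w * z k l w) * (z k' i w * z k' l w)).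
  transitivity (E (fun w => \sum_i \sum_l (z k i w * z k l w) * (z k' i w * z k' l w))).
    apply: eq_expect => w; rewrite expr2 mulr_suml; apply: eq_bigr => i _.
    by rewrite mulr_sumr; apply: eq_bigr => l _; ring.
  by rewrite expect_sum; apply: eq_bigr => i _; rewrite expect_sum.
have four k k' i l : E (fun w => (z k i w * z k l w) * (z k' i w * z k' l w)) <= 1.
  apply: le_trans (ler_norm _) _; apply: expect_norm_le => w.
  by rewrite !normrM !mulr_ile1 // ?mulr_ge0.
have termd k : E (fun w => (\sum_i z k i w * z k i w) ^+ 2) <= N%:R ^+ 2.
  rewrite termE; apply: le_trans (_ : \sum_(i < N) \sum_(l < N) (1 : R) <= _).
    by apply: ler_sum => i _; apply: ler_sum => l _.
  by rewrite !sumr_const card_ord -mulrnA natrM expr2.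
have termo k k' : k != k' ->
    E (fun w => (\sum_i z k i w * z k' i w) ^+ 2) <= N%:R + eps * N%:R ^+ 2.
  move=> kk'; rewrite termE.
  apply: le_trans (_ : \sum_(i < N) \sum_(l < N) ((i == l)%:R + eps) <= _).
    apply: ler_sum => i _; apply: ler_sum => l _.
    have [<-|il] := eqVneq i l; last by rewrite add0r zE.
    by apply: le_trans (four _ _ _ _) _; rewrite lerDl.
  rewrite le_eqVlt; apply/orP; left; apply/eqP.
  transitivity (\sum_(i < N) (1 + eps * N%:R) : R).
    apply: eq_bigr => i _; rewrite big_split /= sumr_const card_ord mulr_natr.
    congr (_ + _); rewrite (bigD1 i) //= eqxx big1 ?addr0 // => l.
    by rewrite eq_sym => /negbTE->.
  by rewrite sumr_const card_ord -mulr_natr; ring.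
rewrite /cut_energy expect_sum.
apply: le_trans (_ : \sum_(k < N) (N%:R ^+ 2 + N%:R * (N%:R + eps * N%:R ^+ 2)) <= _).
  apply: ler_sum => k _; rewrite expect_sum (bigD1 k) //= lerD ?termd //.
  apply: le_trans (_ : \sum_(k' < N | k' != k) (N%:R + eps * N%:R ^+ 2) <= _).
    by apply: ler_sum => k' kk'; rewrite termo // eq_sym.
  rewrite sumr_const -[leLHS]mulr_natl ler_wpM2r ?ler_nat //.
    by rewrite addr_ge0 ?mulr_ge0 ?exprn_ge0 ?ler0n.
  by rewrite -[leqRHS]card_ord max_card.
by rewrite sumr_const card_ord -mulr_natr; lra.
Qed.

Lemma chebyshev_sum N (f : 'I_N -> {set {set G}} -> R) (eta : R) :
  (0 < N)%N -> 0 < eta -> (forall i w, `|f i w| <= 1) ->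
  (forall i j, i != j -> E (fun w => f i w * f j w) <= 0) ->
  prob mu (fun w => eta * N%:R <= `|\sum_i f i w|) <= 1 / (eta ^+ 2 * N%:R).
Proof.
move=> N0 eta0 f1 fE.
have N0' : 0 < N%:R :> R by rewrite ltr0n.
apply: le_trans (_ : prob mu (fun w => (eta * N%:R) ^+ 2 <= (\sum_i f i w) ^+ 2) <= _).
  apply: le_prob => w h; rewrite -[leRHS]real_normK ?num_real //.
  by rewrite lerXn2r // ?nnegrE ?normr_ge0 // mulr_ge0 ?ler0n // ltW.
apply: le_trans (markov _ _ _) _.
- by move=> w; apply: sqr_ge0.
- by rewrite exprn_gt0 ?mulr_gt0.
suff h : E (fun w => (\sum_i f i w) ^+ 2) <= N%:R.
  apply: le_trans (_ : N%:R / (eta * N%:R) ^+ 2 <= _).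
    by rewrite ler_pM2r // invr_gt0 exprn_gt0 ?mulr_gt0.
  rewrite le_eqVlt; apply/orP; left; apply/eqP; field.
  by rewrite !lt0r_neq0.
have -> : E (fun w => (\sum_i f i w) ^+ 2) =
    \sum_i \sum_j E (fun w => f i w * f j w).
  transitivity (E (fun w => \sum_i \sum_j f i w * f j w)).
    by apply: eq_expect => w; rewrite expr2 mulr_suml; apply: eq_bigr => i _; rewrite mulr_sumr.
  by rewrite expect_sum; apply: eq_bigr => i _; rewrite expect_sum.
apply: le_trans (_ : \sum_(i < N) (1 : R) <= _); last by rewrite sumr_const card_ord.
apply: ler_sum => i _; rewrite (bigD1 i) //= -[leRHS]addr0 lerD //.
  apply: le_trans (ler_norm _) _; apply: expect_norm_le => w.
  by rewrite normrM mulr_ile1.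
by apply: sumr_le0 => j ji; apply: fE; rewrite eq_sym.
Qed.

End Cut.

(** * Degrees of stars and quasirandom counting *)

Section Deterministic.
Context (R : realFieldType).

(** [t] is the greatest value with at least [kap * N] indices at or above it. If more than that many
    lay strictly above, the least value among them would be a greater candidate. Applied to degrees
    it gives the top degree. *)
Lemma quantile N (f : 'I_N -> R) (kap : R) : (0 < N)%N -> 0 <= kap <= 1 ->
  exists2 t, (exists i, t = f i) &
    kap * N%:R <= #|[set i | t <= f i]|%:R /\
    #|[set i | t < f i]|%:R <= kap * N%:R.
Proof.
move=> N0 /andP[k0 k1].
pose P (i : 'I_N) := kap * N%:R <= #|[set j | f i <= f j]|%:R.
have i0 : 'I_N by exact: Ordinal N0.
case: (@Order.TotalTheory.arg_minP _ _ _ i0 predT f isT) => im _ imP.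
have Pim : P im.
  have -> : P im = (kap * N%:R <= N%:R).
    rewrite /P; have -> : [set j | f im <= f j] = setT.
      by apply/setP => j; rewrite !inE imP.
    by rewrite cardsT card_ord.
  by rewrite ger_pMl // ltr0n.
case: (@Order.TotalTheory.arg_maxP _ _ _ im P f Pim) => i Pi iP.
exists (f i); first by exists i.
split=> //; rewrite leNgt; apply/negP => lt.
have [j jA] : exists j, j \in [set j | f i < f j].
  apply/set0Pn; rewrite -card_gt0 lt0n; apply/negP => /eqP c0.
  by move: lt; rewrite c0 ltNge mulr_ge0.
case: (@Order.TotalTheory.arg_minP _ _ _ j (fun j => j \in [set j | f i < f j]) f jA) => l.
rewrite inE => il lP.
have Pl : P l.
  apply: le_trans (ltW lt) _; rewrite ler_nat; apply: subset_leq_card.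
  by apply/subsetP => u uA; rewrite inE lP.
by have := lt_le_trans il (iP l Pl); rewrite ltxx.
Qed.

Definition star_deg N (X : 'I_N -> 'I_N -> bool) (i : 'I_N) : R :=
  (\sum_k (X i k)%:R) / N%:R.

Definition star_dev N (X : 'I_N -> 'I_N -> bool) (i k : 'I_N) : R :=
  (X i k)%:R - star_deg X i.

Definition cut_small N (eta : R) (z : 'I_N -> 'I_N -> R) :=
  forall c d : 'I_N -> R,
  (forall k, `|c k| <= 1) -> (forall i, `|d i| <= 1) ->
  `|\sum_i d i * \sum_k c k * z k i| <= eta * N%:R ^+ 2.

Lemma star_deg_ge0 N (X : 'I_N -> 'I_N -> bool) i : 0 <= star_deg X i.
Proof. by rewrite divr_ge0 ?ler0n ?sumr_ge0. Qed.

Lemma star_deg_le1 N (X : 'I_N -> 'I_N -> bool) i : star_deg X i <= 1.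
Proof.
have N0 : 0 < N%:R :> R by rewrite ltr0n; case: i => i; case: N {X}.
rewrite /star_deg ler_pdivrMr // mul1r.
apply: le_trans (_ : \sum_(k < N) 1 <= _).
  by apply: ler_sum => k _; case: (X i k).
by rewrite sumr_const card_ord.
Qed.

Lemma cut_small_sets N (eta : R) (z : 'I_N -> 'I_N -> R) (C D : {set 'I_N}) :
  cut_small eta z -> `|\sum_(k in C) \sum_(i in D) z k i| <= eta * N%:R ^+ 2.
Proof.
move=> h.
have ind1 (A : {set 'I_N}) k : `|(k \in A)%:R : R| <= 1.
  by case: (k \in A); rewrite ?normr1 ?normr0.
have := h _ _ (ind1 C) (ind1 D).
congr (`| _ | <= _).
rewrite [RHS]exchange_big [RHS]big_mkcond /=; apply: eq_bigr => i _.
case: (i \in D); last by rewrite mul0r.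
rewrite mul1r [RHS]big_mkcond /=; apply: eq_bigr => k _.
by case: (k \in C); rewrite ?mul1r ?mul0r.
Qed.

Lemma star_count N (eta t : R) (X : 'I_N -> 'I_N -> bool) (C D : {set 'I_N}) :
  cut_small eta (star_dev X) -> (forall i, i \in C -> t <= star_deg X i) ->
  #|C|%:R * #|D|%:R * t - eta * N%:R ^+ 2 <=
    \sum_(i in C) \sum_(k in D) (X i k)%:R.
Proof.
move=> h tC.
have := cut_small_sets C D h; rewrite ler_norml => /andP[+ _].
have -> : \sum_(k in C) \sum_(i in D) star_dev X k i =
  \sum_(k in C) \sum_(i in D) (X k i)%:R - \sum_(k in C) \sum_(i in D) star_deg X k.
  by rewrite -sumrB; apply: eq_bigr => k _; rewrite -sumrB.
have : #|C|%:R * #|D|%:R * t <= \sum_(k in C) \sum_(i in D) star_deg X k.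
  apply: le_trans (_ : \sum_(k in C) (#|D|%:R * t) <= _).
    by rewrite sumr_const -[leRHS]mulr_natl mulrA.
  by apply: ler_sum => k kC; rewrite sumr_const -[leRHS]mulr_natl ler_wpM2l ?ler0n ?tC.
by lra.
Qed.

(** A fraction at least [t] of the pairs has [X] and at least [s] has [Y], up to the cut error;
    without a common pair the fractions add up to at most 1. *)
Lemma star_nolink N (eta t s : R) (X Y : 'I_N -> 'I_N -> bool) (C D : {set 'I_N}) :
  cut_small eta (star_dev X) -> cut_small eta (star_dev Y) ->
  (forall i, i \in C -> t <= star_deg X i) ->
  (forall k, k \in D -> s <= star_deg Y k) ->
  (forall i k, i \in C -> k \in D -> ~~ (X i k && Y k i)) ->
  #|C|%:R * #|D|%:R * (t + s - 1) <= 2 * eta * N%:R ^+ 2.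
Proof.
move=> qX qY tC sD nl.
have h1 := star_count D qX tC.
have := star_count C qY sD; rewrite exchange_big /= => h2.
have h3 : \sum_(i in C) \sum_(k in D) (X i k)%:R + \sum_(i in C) \sum_(k in D) (Y k i)%:R
    <= #|C|%:R * #|D|%:R :> R.
  rewrite -big_split; apply: le_trans (_ : \sum_(i in C) #|D|%:R <= _).
    apply: ler_sum => i iC; rewrite -big_split.
    apply: le_trans (_ : \sum_(k in D) 1 <= _); last by rewrite sumr_const.
    apply: ler_sum => k kD; have := nl i k iC kD.
    by case: (X i k); case: (Y k i) => //=; rewrite ?addr0 ?add0r ?lexx ?ler01.
  by rewrite sumr_const -[leLHS]mulr_natl.
by move: h1 h2 h3; rewrite [#|D|%:R * _]mulrC; lra.
Qed.

End Deterministic.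

(** * The main component of a pair of stars *)

Lemma contrapT_ex (T : Type) (P : T -> Prop) : (~ (exists x, P x) -> False) -> exists x, P x.
Proof. by move=> h; apply: boolp.contrapT. Qed.

Lemma card_sumr (R : pzSemiRingType) (T : finType) (A : {set T}) :
  #|A|%:R = \sum_i (i \in A)%:R :> R.
Proof.
rewrite -sum1_card natr_sum big_mkcond /=; apply: eq_bigr => i _.
by case: (i \in A).
Qed.

Section Main.
Context (R : realFieldType) (kap p : R) (N : nat) (L : eqType).
Hypothesis kap0 : 0 < kap.
Hypothesis kap1 : kap <= 1 / 400.
Hypothesis p0 : 5847 / 10000 <= p.
Hypothesis N0 : (0 < N)%N.
(** Cubic in [kap]: a violation is a product of two sets of size about [kap * N] with an excess
    density about [kap]. The factor 1/4 accounts for sets of size [kap / 2 * N]. *)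
Let eta := kap ^+ 3 / 4.

Let eta0 : 0 < eta. Proof. by rewrite /eta divr_gt0 ?exprn_gt0 // ltr0n. Qed.
Let etak : eta <= kap.
Proof.
rewrite /eta; have : kap ^+ 3 <= kap.
  by rewrite exprSr ger_pMl // exprn_ile1 ?ltW //; move: kap0 kap1; lra.
by move: kap0; lra.
Qed.
Let N0' : 0 < N%:R :> R. Proof. by rewrite ltr0n. Qed.

Definition labelled (lab : 'I_N -> L) M := [set i | lab i == M].

Definition tops (X : 'I_N -> 'I_N -> bool) (lab : 'I_N -> L) M t :=
  [set i | (t <= star_deg R X i) && (lab i == M)].

(** [M] is the main component, [t] and [s] are the top degrees. The sets of top branches are kept
    because the routes to the next base are counted on them; the last two bounds concern all
    branches in [M]. *)
Definition main_stats (X Y : 'I_N -> 'I_N -> bool) (lL lR : 'I_N -> L) M t s :=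
  [/\ p - 4 * kap <= t <= 1, p - 4 * kap <= s <= 1,
      kap / 2 * N%:R <= #|tops X lL M t|%:R,
      kap / 2 * N%:R <= #|tops Y lR M s|%:R &
      (p + s - 1 - 4 * kap) * N%:R <= #|labelled lL M|%:R * (t + s - 1) /\
      (p + t - 1 - 4 * kap) * N%:R <= #|labelled lR M|%:R * (t + s - 1)].

(** Branches of degree above [1 - s] would meet the top branches of [M] on the other side, so almost
    all of them lie in [M]; let [A] be their fraction. The degrees are at most [t] up to [kap * N]
    exceptions and average [p], so [p <= A * t + (1 - A) * (1 - s)] up to multiples of [kap]. *)
Lemma main_side (X Y : 'I_N -> 'I_N -> bool) (lL lR : 'I_N -> L) M (t s : R) :
  cut_small eta (star_dev R X) -> cut_small eta (star_dev R Y) ->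
  (forall i k, X i k -> Y k i -> lL i = lR k) ->
  0 <= t <= 1 -> 0 <= s <= 1 -> 0 <= t + s - 1 ->
  #|[set i | t < star_deg R X i]|%:R <= kap * N%:R ->
  kap / 2 * N%:R <= #|tops Y lR M s|%:R ->
  (p - eta) * N%:R <= \sum_i star_deg R X i ->
  (p + s - 1 - 4 * kap) * N%:R <= #|labelled lL M|%:R * (t + s - 1).
Proof.
move=> qX qY lXY /andP[t0 t1] /andP[s0 s1] ts tq CM mX.
pose A := [set i | 1 - s + kap < star_deg R X i].
pose B := A :\: labelled lL M.
have hB : #|B|%:R <= kap * N%:R.
  have h : #|B|%:R * #|tops Y lR M s|%:R * (1 - s + kap + s - 1) <= 2 * eta * N%:R ^+ 2.
    apply: (star_nolink qX qY).
    - by move=> i; rewrite !inE => /andP[_ /ltW].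
    - by move=> k; rewrite !inE => /andP[].
    - move=> i k; rewrite !inE => /andP[iM _] /andP[_ kM].
      apply/negP => /andP[Xik Yki]; move: iM.
      by rewrite (lXY _ _ Xik Yki) kM.
  have h2 : #|B|%:R * (kap / 2 * N%:R) * kap <= 2 * eta * N%:R ^+ 2.
    apply: le_trans h; have -> : 1 - s + kap + s - 1 = kap by ring.
    by rewrite ler_pM2r // ler_wpM2l ?ler0n.
  have c0 : 0 < kap ^+ 2 / 2 * N%:R by rewrite mulr_gt0 ?divr_gt0 ?exprn_gt0.
  rewrite -(ler_pM2r c0); move: h2; rewrite /eta; lra.
have AM : #|A|%:R <= #|labelled lL M|%:R + kap * N%:R.
  apply: le_trans (_ : #|labelled lL M|%:R + #|B|%:R <= _); last by rewrite lerD2l.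
  rewrite -natrD ler_nat -(cardsID (labelled lL M) A) leq_add2r.
  by apply: subset_leq_card; apply: subsetIr.
have sumX : \sum_i star_deg R X i <=
    kap * N%:R + #|A|%:R * t + (N%:R - #|A|%:R) * (1 - s + kap).
  have -> : (N%:R - #|A|%:R) * (1 - s + kap) = \sum_i (i \notin A)%:R * (1 - s + kap).
    rewrite -mulr_suml; congr (_ * _).
    have -> : \sum_i (i \notin A)%:R = #|~: A|%:R :> R.
      by rewrite card_sumr; apply: eq_bigr => i _; rewrite in_setC.
    have -> : N%:R = (#|A| + #|~: A|)%:R :> R by rewrite cardsC card_ord.
    by rewrite natrD; ring.
  have -> : #|A|%:R * t = \sum_i (i \in A)%:R * t.
    rewrite -mulr_suml; congr (_ * _).
    exact: card_sumr.
  have hh : \sum_i star_deg R X i <= \sum_(i < N) ((t < star_deg R X i)%R%:R +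
     (i \in A)%:R * t + (i \notin A)%:R * (1 - s + kap)).
    apply: ler_sum => i _.
    have := star_deg_le1 R X i; set dd := star_deg R X i => dd1.
    rewrite inE -/dd; case: (ltP t dd) => h1; case: (ltP (1 - s + kap) dd) => h2 /=;
      move: kap0; lra.
  apply: le_trans hh _.
  rewrite !big_split /= !lerD2r; apply: le_trans tq.
  rewrite card_sumr; apply: ler_sum => i _.
  by rewrite inE.
have cN : 0 <= kap * N%:R by rewrite mulr_ge0 ?ltW.
have h3 : (p + s - 1 - 3 * kap) * N%:R <= #|A|%:R * (t + s - 1).
  have h4 : (p - kap) * N%:R <= (p - eta) * N%:R by rewrite ler_pM2r //; move: etak; lra.
  have h5 : 0 <= kap * #|A|%:R by rewrite mulr_ge0 ?ler0n ?ltW.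
  move: sumX mX h4 h5; lra.
have h6 : #|A|%:R * (t + s - 1) <= (#|labelled lL M|%:R + kap * N%:R) * (t + s - 1).
  by rewrite ler_wpM2r.
have h7 : kap * N%:R * (t + s - 1) <= kap * N%:R.
  by rewrite ler_piMr //; move: t1 s1; lra.
move: h3 h6 h7; lra.
Qed.

Lemma quantile_ge (X : 'I_N -> 'I_N -> bool) (t : R) : 0 <= t ->
  #|[set i | t < star_deg R X i]|%:R <= kap * N%:R ->
  (p - eta) * N%:R <= \sum_i star_deg R X i -> p - 4 * kap <= t.
Proof.
move=> t0 tq mX.
have h : \sum_i star_deg R X i <= kap * N%:R + N%:R * t.
  have -> : N%:R * t = \sum_(i < N) t by rewrite sumr_const card_ord -[RHS]mulr_natl.
  have hh : \sum_i star_deg R X i <= \sum_(i < N) ((t < star_deg R X i)%R%:R + t).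
    apply: ler_sum => i _.
    have := star_deg_le1 R X i; set dd := star_deg R X i => dd1.
    by case: (ltP t dd) => h1 /=; lra.
  apply: le_trans hh _; rewrite big_split /= lerD2r; apply: le_trans tq.
  rewrite card_sumr; apply: ler_sum => i _.
  by rewrite inE.
rewrite -(ler_pM2r N0').
have h4 : (p - kap) * N%:R <= (p - eta) * N%:R by rewrite ler_pM2r //; move: etak; lra.
have cN : 0 <= kap * N%:R by rewrite mulr_ge0 ?ltW.
by move: h mX h4 cN; lra.
Qed.

(* Unions of classes are either negligible or almost everything among the
   vertices of top degree, because no open path links two different classes. *)
Lemma main_exists (X Y : 'I_N -> 'I_N -> bool) (lL lR : 'I_N -> L) :
  cut_small eta (star_dev R X) -> cut_small eta (star_dev R Y) ->
  (forall i k, X i k -> Y k i -> lL i = lR k) ->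
  (p - eta) * N%:R <= \sum_i star_deg R X i ->
  (p - eta) * N%:R <= \sum_i star_deg R Y i ->
  exists M t s, main_stats X Y lL lR M t s.
Proof.
move=> qX qY lXY mX mY.
have kk : 0 <= kap <= 1 by move: kap0 kap1; lra.
have [t [it tE] [tq1 tq2]] := @quantile R N (star_deg R X) kap N0 kk.
have [s [js sE] [sq1 sq2]] := @quantile R N (star_deg R Y) kap N0 kk.
have t0 : 0 <= t by rewrite tE star_deg_ge0.
have t1 : t <= 1 by rewrite tE star_deg_le1.
have s0 : 0 <= s by rewrite sE star_deg_ge0.
have s1 : s <= 1 by rewrite sE star_deg_le1.
have tp := quantile_ge t0 tq2 mX.
have sp := quantile_ge s0 sq2 mY.
have ts : 1 / 10 <= t + s - 1 by move: tp sp p0 kap1; lra.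
pose D (P : pred L) := [set i | (t <= star_deg R X i) && P (lL i)].
pose C (P : pred L) := [set k | (s <= star_deg R Y k) && P (lR k)].
(* A quarter of the number of top branches: a set of labels and its complement cannot both carry at
   most [nu] of them. *)
pose nu := kap / 4 * N%:R.
have nu0 : 0 < nu by rewrite /nu mulr_gt0 ?divr_gt0.
have split (f : 'I_N -> R) lab (P : pred L) (u : R) :
    kap * N%:R <= #|[set i | u <= f i]|%:R ->
    4 * nu <= #|[set i | (u <= f i) && P (lab i)]|%:R +
              #|[set i | (u <= f i) && predC P (lab i)]|%:R.
  move=> h; apply: le_trans (_ : #|[set i | u <= f i]|%:R <= _).
    by apply: le_trans h; rewrite /nu; lra.
  rewrite -natrD ler_nat -(cardsID [set i | P (lab i)] [set i | u <= f i]).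
  by rewrite leq_add //; apply: subset_leq_card; apply/subsetP => i; rewrite !inE // andbC.
have dich (P Q : pred L) : (forall l, P l -> Q l -> False) ->
    #|D P|%:R <= nu \/ #|C Q|%:R <= nu.
  move=> PQ.
  have h : #|D P|%:R * #|C Q|%:R * (t + s - 1) <= 2 * eta * N%:R ^+ 2.
    apply: (star_nolink qX qY).
    - by move=> i; rewrite !inE => /andP[].
    - by move=> i; rewrite !inE => /andP[].
    - move=> i k; rewrite !inE => /andP[_ Pi] /andP[_ Qk].
      apply/negP => /andP[Xik Yki]; apply: (PQ (lR k)) => //.
      by rewrite -(lXY _ _ Xik Yki).
  have [|h1] := leP #|D P|%:R nu; first by left.
  have [|h2] := leP #|C Q|%:R nu; first by right.
  exfalso.
  have h3 : nu * nu < #|D P|%:R * #|C Q|%:R by rewrite ltr_pM // ltW.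
  have h4 : nu * nu * (1 / 10) < 2 * eta * N%:R ^+ 2.
    apply: lt_le_trans h; apply: lt_le_trans (_ : #|D P|%:R * #|C Q|%:R * (1 / 10) <= _).
      by rewrite ltr_pM2r ?divr_gt0 ?ltr0n.
    by rewrite ler_wpM2l // mulr_ge0.
  have h5 : 0 < kap ^+ 2 * N%:R ^+ 2 by rewrite mulr_gt0 ?exprn_gt0.
  have h6 : kap * (kap ^+ 2 * N%:R ^+ 2) <= 1 / 400 * (kap ^+ 2 * N%:R ^+ 2).
    by rewrite ler_pM2r.
  by move: h4 h5 h6; rewrite /nu /eta; lra.
pose small (P : pred L) := #|D P|%:R <= nu /\ #|C P|%:R <= nu.
pose big (P : pred L) := #|D (predC P)|%:R <= nu /\ #|C (predC P)|%:R <= nu.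
(* [dich] is applied to [P] against its complement, both ways round; two of the four outcomes leave
   one side with too few top branches in total. *)
have sb (P : pred L) : small P \/ big P.
  have PC l : P l -> predC P l -> False by move=> /= ->.
  have CP l : predC P l -> P l -> False by move=> /= /negbTE ->.
  have hD := split (star_deg R X) lL P t tq1.
  have hC := split (star_deg R Y) lR P s sq1.
  rewrite -/(D P) -/(D (predC P)) in hD; rewrite -/(C P) -/(C (predC P)) in hC.
  rewrite /small /big.
  have [d1|d1] := dich _ _ PC; have [d2|d2] := dich _ _ CP.
  - by exfalso; move: hD d1 d2 nu0; lra.
  - by left.
  - by right.
  - by exfalso; move: hC d1 d2 nu0; lra.
(* If every single label were small, adding a label to a small set would keep it small, since the
   sum is too little to be big. Then the set of all labels in use would be small, although it
   carries every top branch. *)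
have [M bM] : exists M, big (pred1 M).
  apply: contrapT_ex => nbig.
  have allsmall (r : seq L) : small (fun l => l \in r).
    elim: r => [|M r [IH1 IH2]].
      by split; rewrite /D /C (_ : [set _ | _] = set0) ?cards0 ?ltW //;
        apply/setP => i; rewrite !inE andbF.
    have [sM1 sM2] : small (pred1 M) by case: (sb (pred1 M)) => // bb; case: nbig; exists M.
    case: (sb (fun l => l \in M :: r)) => // -[b1 _].
    exfalso.
    have hD := split (star_deg R X) lL (fun l => l \in M :: r) t tq1.
    rewrite -/(D _) -/(D (predC _)) in hD.
    have : #|D (fun l => l \in M :: r)|%:R <= #|D (pred1 M)|%:R + #|D (fun l => l \in r)|%:R :> R.
      rewrite -natrD ler_nat; apply: leq_trans (leq_card_setU _ _).
      apply: subset_leq_card; apply/subsetP => i; rewrite !inE.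
      by case: (t <= _).
    by move: hD b1 sM1 IH1 nu0; lra.
  have [a1 _] := allsmall [seq lL i | i <- enum 'I_N].
  have : kap * N%:R <= #|D (fun l => l \in [seq lL i | i <- enum 'I_N])|%:R.
    apply: le_trans tq1 _; rewrite ler_nat; apply: subset_leq_card.
    apply/subsetP => i; rewrite !inE => -> /=.
    by apply: map_f; rewrite mem_enum.
  by move: a1 nu0; rewrite /nu; lra.
have hD := split (star_deg R X) lL (pred1 M) t tq1.
have hC := split (star_deg R Y) lR (pred1 M) s sq1.
rewrite -/(D _) -/(D (predC _)) in hD; rewrite -/(C _) -/(C (predC _)) in hC.
case: bM => b1 b2.
have cD : kap / 2 * N%:R <= #|tops X lL M t|%:R.
  by move: hD b1; rewrite /tops /nu -/(D (pred1 M)); move: nu0; rewrite /nu; lra.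
have cC : kap / 2 * N%:R <= #|tops Y lR M s|%:R.
  by move: hC b2; rewrite /tops /nu -/(C (pred1 M)); move: nu0; rewrite /nu; lra.
have lYX i k : Y i k -> X k i -> lR i = lL k by move=> y x; rewrite (lXY _ _ x y).
have ts0 : 0 <= t + s - 1 by move: ts; lra.
exists M, t, s; split=> //; try by apply/andP.
split.
  by apply: (main_side qX qY lXY _ _ _ tq2 cC mX) => //; apply/andP.
rewrite (addrC t s); apply: (main_side qY qX lYX _ _ _ sq2 cD mY); try by apply/andP.
by move: ts0; lra.
Qed.

End Main.

(** * Linking the main components of adjacent bases *)

(** [t] and [s'] are at least 0.57 and have a small product, so [t + s' <= 1.33], likewise [t' + s];
    hence [u = t + s - 1] and [u'] add up to at most 0.66. The bounds on [a] and [b] give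
    [a + b >= 1 + (2 * p - 1 - 8 * kap) / u], and convexity of the inverse yields
    [a + b + a' + b' >= 2 + 0.14 * 6 = 2.84]. The upper bounds allow at most
    [4 - 2 * p + 2 * kap <= 2.8356]. *)
Lemma link_arith (R : realFieldType) (kap p t s t' s' a b a' b' : R) :
  0 < kap -> kap <= 1 / 400 -> 5847 / 10000 <= p -> p <= 1 ->
  p - 4 * kap <= t <= 1 -> p - 4 * kap <= s <= 1 ->
  p - 4 * kap <= t' <= 1 -> p - 4 * kap <= s' <= 1 ->
  p + s - 1 - 4 * kap <= a * (t + s - 1) ->
  p + t - 1 - 4 * kap <= b * (t + s - 1) ->
  p + s' - 1 - 4 * kap <= a' * (t' + s' - 1) ->
  p + t' - 1 - 4 * kap <= b' * (t' + s' - 1) ->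
  t * s' <= 1 - p + 3 * kap -> t' * s <= 1 - p + 3 * kap ->
  a + a' <= 2 - p + kap -> b + b' <= 2 - p + kap -> False.
Proof.
move=> kap0 kap1 p0 p1 /andP[t0 t1] /andP[s0 s1] /andP[t0' t1'] /andP[s0' s1'] ha hb ha' hb' h1 h2 h3 h4.
have P1 : 57 / 100 <= t by move: t0 p0 kap1; clear; lra.
have P2 : 57 / 100 <= s by move: s0 p0 kap1; clear; lra.
have P3 : 57 / 100 <= t' by move: t0' p0 kap1; clear; lra.
have P4 : 57 / 100 <= s' by move: s0' p0 kap1; clear; lra.
have bnd (x y : R) : 57 / 100 <= x -> 57 / 100 <= y -> x * y <= 1 - p + 3 * kap ->
    x + y <= 133 / 100.
  move=> hx hy hxy.
  have := mulr_ge0 (_ : 0 <= x - 57 / 100) (_ : 0 <= y - 57 / 100).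
  move=> h; have {h} : 0 <= (x - 57 / 100) * (y - 57 / 100).
    by apply: h; rewrite subr_ge0.
  by move: hxy p0 kap1; clear; lra.
have S1 := bnd t s' P1 P4 h1.
have S2 := bnd t' s P3 P2 h2.
pose u := t + s - 1; pose u' := t' + s' - 1.
have u0 : 0 < u by move: P1 P2; rewrite /u; clear; lra.
have u0' : 0 < u' by move: P3 P4; rewrite /u'; clear; lra.
have uu : u + u' <= 66 / 100 by move: S1 S2; rewrite /u /u'; clear; lra.
have k1 : 14 / 100 / u <= a + b - 1.
  by rewrite ler_pdivrMr //; move: ha hb p0 kap1; rewrite /u; clear; lra.
have k2 : 14 / 100 / u' <= a' + b' - 1.
  by rewrite ler_pdivrMr //; move: ha' hb' p0 kap1; rewrite /u'; clear; lra.
have uv0 : 0 < u + u' by exact: addr_gt0 u0 u0'.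
have k3 : 4 / (u + u') <= u^-1 + u'^-1.
  rewrite ler_pdivrMr; last exact: uv0.
  have -> : (u^-1 + u'^-1) * (u + u') = 4 + (u - u') ^+ 2 / (u * u').
    by field; rewrite !gt_eqF.
  by rewrite lerDl divr_ge0 ?sqr_ge0 ?mulr_ge0 ?(ltW u0) ?(ltW u0').
have k4 : 6 <= 4 / (u + u').
  rewrite ler_pdivlMr; last exact: uv0.
  by move: uu; set v := u + u'; clearbody v; clear; lra.
by move: k1 k2 k3 k4 h3 h4 p0 kap1; clear; lra.
Qed.

Section Link.
Context (R : realFieldType) (kap p : R) (N : nat) (L : eqType).
Hypothesis kap0 : 0 < kap.
Hypothesis kap1 : kap <= 1 / 400.
Hypothesis p0 : 5847 / 10000 <= p.
Hypothesis N0 : (0 < N)%N.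
Let eta := kap ^+ 3 / 4.
Let eta0 : 0 < eta. Proof. by rewrite /eta divr_gt0 ?exprn_gt0 // ltr0n. Qed.
Let N0' : 0 < N%:R :> R. Proof. by rewrite ltr0n. Qed.

(* The deviation of [X i k && Y k i] from [X i k] times the degree of the
   star [k] of [Y]. *)
Definition prod_dev (X Y : 'I_N -> 'I_N -> bool) (k i : 'I_N) : R :=
  (X i k)%:R * star_dev R Y k i.

(** The route from branch [i] at one base to branch [k] at the next passes two adjacent leaves:
    spoke [X i k], leaf edge [Q i k], spoke [Y k i]. Both spokes are open for a fraction [t * s] of
    the pairs, a product thanks to [prod_dev]; the leaf edges have density [p], so without a route
    [t * s + p <= 1] up to errors. *)
Lemma leaf_nolink (X Y Q : 'I_N -> 'I_N -> bool) (q : 'I_N -> 'I_N -> R)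
    (C D : {set 'I_N}) (t s : R) :
  cut_small eta (star_dev R X) -> cut_small eta (prod_dev X Y) ->
  cut_small eta (fun i k => (Q i k)%:R - q i k) ->
  (forall i k, p <= q i k) -> 0 <= s <= 1 ->
  (forall i, i \in C -> t <= star_deg R X i) ->
  (forall k, k \in D -> s <= star_deg R Y k) ->
  kap / 2 * N%:R <= #|C|%:R -> kap / 2 * N%:R <= #|D|%:R ->
  (forall i k, i \in C -> k \in D -> ~~ [&& X i k, Y k i & Q i k]) ->
  t * s <= 1 - p + 3 * kap.
Proof.
move=> qX qXY qQ pq /andP[s0 s1] tC sD cC cD nl.
set m := #|C|%:R * #|D|%:R : R.
have h1 : m * t - eta * N%:R ^+ 2 <= \sum_(i in C) \sum_(k in D) (X i k)%:R.
  exact: star_count.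
have h2 : s * (\sum_(i in C) \sum_(k in D) (X i k)%:R) - eta * N%:R ^+ 2 <=
    \sum_(i in C) \sum_(k in D) (X i k && Y k i)%:R.
  have := cut_small_sets D C qXY; rewrite ler_norml => /andP[+ _].
  have -> : \sum_(k in D) \sum_(i in C) prod_dev X Y k i =
      \sum_(i in C) \sum_(k in D) (X i k && Y k i)%:R -
      \sum_(i in C) \sum_(k in D) (X i k)%:R * star_deg R Y k.
    rewrite exchange_big -sumrB; apply: eq_bigr => i _; rewrite -sumrB.
    apply: eq_bigr => k _; rewrite /prod_dev /star_dev.
    by case: (X i k); rewrite ?mul0r ?mul1r ?subr0.
  have : s * (\sum_(i in C) \sum_(k in D) (X i k)%:R) <=
      \sum_(i in C) \sum_(k in D) (X i k)%:R * star_deg R Y k.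
    rewrite mulr_sumr; apply: ler_sum => i _; rewrite mulr_sumr.
    apply: ler_sum => k kD; rewrite mulrC.
    by case: (X i k); rewrite ?mul1r ?mul0r // sD.
  by lra.
have h3 : p * m - eta * N%:R ^+ 2 <= \sum_(i in C) \sum_(k in D) (Q i k)%:R.
  have := cut_small_sets C D qQ; rewrite ler_norml => /andP[+ _].
  have -> : \sum_(k in C) \sum_(i in D) ((Q k i)%:R - q k i) =
      \sum_(i in C) \sum_(k in D) (Q i k)%:R - \sum_(i in C) \sum_(k in D) q i k.
    by rewrite -sumrB; apply: eq_bigr => i _; rewrite -sumrB.
  have : p * m <= \sum_(i in C) \sum_(k in D) q i k.
    apply: (@le_trans _ _ (\sum_(i in C) \sum_(k in D) p)).
      rewrite !sumr_const -mulrnA -[leRHS]mulr_natr natrM /m.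
      by rewrite [_ * #|C|%:R]mulrC.
    by apply: ler_sum => i _; apply: ler_sum => k _; apply: pq.
  by lra.
have h4 : \sum_(i in C) \sum_(k in D) (X i k && Y k i)%:R +
    \sum_(i in C) \sum_(k in D) (Q i k)%:R <= m.
  rewrite -big_split; apply: (@le_trans _ _ (\sum_(i in C) #|D|%:R)).
    apply: ler_sum => i iC; rewrite -big_split.
    apply: (@le_trans _ _ (\sum_(k in D) 1)); last by rewrite sumr_const.
    apply: ler_sum => k kD; have := nl i k iC kD.
    by case: (X i k); case: (Y k i); case: (Q i k) => //=;
      rewrite ?addr0 ?add0r ?lexx ?ler01.
  by rewrite sumr_const -[leLHS]mulr_natl.
have h5 : s * (m * t - eta * N%:R ^+ 2) <=
    s * (\sum_(i in C) \sum_(k in D) (X i k)%:R) by rewrite ler_wpM2l.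
have e0 : 0 <= eta * N%:R ^+ 2 by rewrite mulr_ge0 ?exprn_ge0 ?ler0n ?ltW.
have h6 : s * (eta * N%:R ^+ 2) <= eta * N%:R ^+ 2 by rewrite ler_piMl.
have h7 : m * (t * s + p - 1) <= 3 * eta * N%:R ^+ 2.
  by move: h2 h3 h4 h5 h6; lra.
rewrite leNgt; apply/negP => h8.
(* Three errors of size [eta * N^2], divided by this bound on [m], make exactly [3 * kap]. *)
have m0 : kap ^+ 2 / 4 * N%:R ^+ 2 <= m.
  have -> : kap ^+ 2 / 4 * N%:R ^+ 2 = (kap / 2 * N%:R) * (kap / 2 * N%:R) :> R by field.
  by rewrite ler_pM // mulr_ge0 ?ler0n // divr_ge0 ?ltW.
have m1 : 0 < kap ^+ 2 / 4 * N%:R ^+ 2.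
  by rewrite mulr_gt0 ?divr_gt0 ?exprn_gt0.
have h9 : m * (3 * kap) < m * (t * s + p - 1).
  rewrite ltr_pM2l; last exact: lt_le_trans m1 m0.
  by move: h8; lra.
have h10 : kap ^+ 2 / 4 * N%:R ^+ 2 * (3 * kap) <= m * (3 * kap).
  by rewrite ler_wpM2r // mulr_ge0 // ltW.
by move: h7 h9 h10; rewrite /eta; lra.
Qed.

Lemma branch_nolink (A B Q : {set 'I_N}) :
  (forall i, i \in A -> i \in B -> i \in Q -> False) ->
  #|A|%:R + #|B|%:R + #|Q|%:R <= 2 * N%:R :> R.
Proof.
move=> h.
have -> : 2 * N%:R = \sum_(i < N) 2 :> R by rewrite sumr_const card_ord -[RHS]mulr_natr.
rewrite !card_sumr -!big_split; apply: ler_sum => i _ /=.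
move: (h i); case: (i \in A); case: (i \in B); case: (i \in Q) => hh;
  rewrite /= ?addr0 ?add0r ?ler01 ?ler0n //; lra.
Qed.

(** Unprimed data belong to a base and primed data to its neighbour along a direction [d]; [Q], [QL]
    and [QR] stand for the open edges along [d] at leaves, left branches and right branches. If [M]
    and [M'] differed, the two crossed leaf routes and the two families of branch edges would supply
    the four upper bounds that [link_arith] refutes. *)
Lemma direction_link (X Y X' Y' Q : 'I_N -> 'I_N -> bool) (q : 'I_N -> 'I_N -> R)
    (QL QR : {set 'I_N}) (lL lR lL' lR' : 'I_N -> L) (M M' : L) (t s t' s' : R) :
  p <= 1 ->
  main_stats kap p X Y lL lR M t s -> main_stats kap p X' Y' lL' lR' M' t' s' ->
  cut_small eta (star_dev R X) -> cut_small eta (star_dev R X') ->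
  cut_small eta (prod_dev X Y') -> cut_small eta (prod_dev X' Y) ->
  cut_small eta (fun i k => (Q i k)%:R - q i k) -> (forall i k, p <= q i k) ->
  (p - eta) * N%:R <= #|QL|%:R -> (p - eta) * N%:R <= #|QR|%:R ->
  (forall i, i \in QL -> lL i = lL' i) -> (forall k, k \in QR -> lR k = lR' k) ->
  (forall i k, X i k -> Y' k i -> Q i k -> lL i = lR' k) ->
  (forall i k, X' i k -> Y k i -> Q i k -> lL' i = lR k) ->
  M = M'.
Proof.
move=> p1 [t0 s0 cD cC [hL hR]] [t0' s0' cD' cC' [hL' hR']] qX qX' qXY qXY' qQ pq.
move=> cQL cQR lQL lQR l1 l2.
apply/eqP; apply: contraT => MM'; exfalso.
have etak : eta <= kap.
  rewrite /eta; have : kap ^+ 3 <= kap.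
    by rewrite exprSr ger_pMl // exprn_ile1 ?ltW //; move: kap0 kap1; lra.
  by move: kap0; lra.
have unit_s : 0 <= s <= 1 by case/andP: s0 => s0 ->; move: s0 p0 kap1; lra.
have unit_s' : 0 <= s' <= 1 by case/andP: s0' => s0' ->; move: s0' p0 kap1; lra.
have h1 : t * s' <= 1 - p + 3 * kap.
  apply: (leaf_nolink qX qXY qQ pq unit_s' _ _ cD cC').
  - by move=> i; rewrite inE => /andP[].
  - by move=> i; rewrite inE => /andP[].
  - move=> i k; rewrite !inE => /andP[_ /eqP iM] /andP[_ /eqP kM].
    apply/negP => /and3P[x y z]; move/negP: MM'; apply.
    by rewrite -iM -kM (l1 _ _ x y z).
have h2 : t' * s <= 1 - p + 3 * kap.
  apply: (leaf_nolink qX' qXY' qQ pq unit_s _ _ cD' cC).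
  - by move=> i; rewrite inE => /andP[].
  - by move=> i; rewrite inE => /andP[].
  - move=> i k; rewrite !inE => /andP[_ /eqP iM] /andP[_ /eqP kM].
    apply/negP => /and3P[x y z]; move/negP: MM'; apply.
    by rewrite -iM -kM (l2 _ _ x y z).
have side (lab lab' : 'I_N -> L) (QQ : {set 'I_N}) : (p - eta) * N%:R <= #|QQ|%:R ->
    (forall i, i \in QQ -> lab i = lab' i) ->
    #|labelled lab M|%:R / N%:R + #|labelled lab' M'|%:R / N%:R <= 2 - p + kap.
  move=> cQ lQ; rewrite -mulrDl ler_pdivrMr //.
  have := @branch_nolink (labelled lab M) (labelled lab' M') QQ.
  have c : 0 <= (kap - eta) * N%:R by rewrite mulr_ge0 ?ler0n // subr_ge0.
  move=> h; have {h} := h _.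
  suff : forall i, i \in labelled lab M -> i \in labelled lab' M' -> i \in QQ -> False.
    by move=> H /(_ H); move: cQ c; lra.
  move=> i; rewrite !inE => /eqP iM /eqP iM' /lQ ll.
  by move/negP: MM'; apply; rewrite -iM -iM' ll.
apply: (@link_arith R kap p t s t' s' (#|labelled lL M|%:R / N%:R) (#|labelled lR M|%:R / N%:R)
  (#|labelled lL' M'|%:R / N%:R) (#|labelled lR' M'|%:R / N%:R)) => //;
  try (by rewrite mulrAC ler_pdivlMr).
- exact: side cQL lQL.
- exact: side cQR lQR.
Qed.

End Link.

(** * Stars in the hypercube *)

Section Flip.
Context (n : nat).
Local Notation V := {ffun 'I_n -> bool}.

Definition flip (x : V) (i : 'I_n) : V := [ffun j => x j (+) (j == i)].

Lemma flipE x i j : flip x i j = x j (+) (j == i).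
Proof. by rewrite ffunE. Qed.

Lemma flipC x i j : flip (flip x i) j = flip (flip x j) i.
Proof. by apply/ffunP => k; rewrite !flipE addbAC. Qed.

Lemma flipK x d : flip (flip x d) d = x.
Proof. by apply/ffunP => j; rewrite !flipE -addbA addbb addbF. Qed.

Definition flip_edge (x : V) (i : 'I_n) : {set hypercube n} := [set x; flip x i].

Lemma flip_edge_in x i : flip_edge x i \in edges (hypercube n).
Proof.
rewrite inE; apply/existsP; exists x; apply/existsP; exists (flip x i).
rewrite eqxx andbT /= /hypercube_adj.
rewrite (_ : [set j | x j != flip x i j] = [set i]) ?cards1 //.
by apply/setP => j; rewrite in_set in_set1 flipE; case: (x j); case: (j == i).
Qed.

Lemma flip_edge_sub x i (U : {set hypercube n}) :
  x \in U -> flip x i \in U -> flip_edge x i \subset U.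
Proof. by move=> xU fU; apply/subsetP => y; rewrite !inE => /orP[] /eqP ->. Qed.

(** On the ports, [x] differs from [z] at [a i] alone; all other coordinates are free. Such a set
    contains the whole star of the branch [z + a_i], and the sets are disjoint for different [i],
    which makes the branches independent. *)
Definition only_at N (z : V) (a : 'I_N -> 'I_n) (i : 'I_N) : {set hypercube n} :=
  [set x : V | [forall j, (x (a j) (+) z (a j)) == (j == i)]].

Lemma only_at_disj N z (a : 'I_N -> 'I_n) i i' : i != i' ->
  [disjoint only_at z a i & only_at z a i'].
Proof.
move=> ii'; rewrite -setI_eq0; apply/eqP/setP => x; rewrite !inE.
apply/negbTE/negP => /andP[/forallP/(_ i)/eqP h /forallP/(_ i)/eqP].
by rewrite h eqxx (negbTE ii').
Qed.

Lemma only_at_flip N z (a : 'I_N -> 'I_n) i : injective a -> flip z (a i) \in only_at z a i.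
Proof.
move=> ainj; rewrite inE; apply/forallP => j; rewrite flipE (inj_eq ainj).
by case: (z (a j)); case: (j == i).
Qed.

Lemma only_at_flips N z (a : 'I_N -> 'I_n) i x d : (forall j, a j != d) ->
  x \in only_at z a i -> flip x d \in only_at z a i.
Proof.
move=> ad; rewrite !inE => /forallP h; apply/forallP => j.
by rewrite flipE (negbTE (ad j)) addbF h.
Qed.

Definition side (d : 'I_n) (c : bool) : {set hypercube n} := [set x : V | x d == c].

Lemma side_disj d c c' : c != c' -> [disjoint side d c & side d c'].
Proof.
move=> cc'; rewrite -setI_eq0; apply/eqP/setP => x; rewrite !inE.
by apply/negbTE/negP => /andP[/eqP -> ]; apply/negP.
Qed.

(** The edge from the branch [z + a_i] to the leaf [z + a_i + b_k]; [spoke z b a k i] is the other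
    edge at the same leaf. *)
Definition spoke N (z : V) (a b : 'I_N -> 'I_n) (i k : 'I_N) (w : {set {set hypercube n}}) : bool :=
  flip_edge (flip z (a i)) (b k) \in w.

End Flip.

(** * Quasirandom stars with high probability *)

Section Prob.
Context (R : realFieldType) (n : nat) (mu : bond_model R (hypercube n)) (p : R).
Hypothesis ind : one_independent mu.
Hypothesis hp : open_with_prob_ge p mu.
Local Notation V := {ffun 'I_n -> bool}.
Local Notation W := {set {set hypercube n}}.
Local Notation E := (expect mu).
Implicit Types (z : V).

Lemma flip_edge_prob x i : p <= prob mu (fun w => flip_edge x i \in w).
Proof. exact/hp/flip_edge_in. Qed.

Lemma p_le1 (x : V) (i : 'I_n) : p <= 1.
Proof. exact: le_trans (flip_edge_prob x i) (prob_le1 _ _). Qed.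

Lemma spoke_dep (U : {set hypercube n}) N z (a b : 'I_N -> 'I_n) i k :
  flip z (a i) \in U -> flip (flip z (a i)) (b k) \in U ->
  dep U (spoke z a b i k).
Proof.
move=> u1 u2; apply: dep_mem; first exact: flip_edge_in.
exact: flip_edge_sub.
Qed.

Lemma star_dev_dep (U : {set hypercube n}) N z (a b : 'I_N -> 'I_n) i k :
  flip z (a i) \in U -> (forall k', flip (flip z (a i)) (b k') \in U) ->
  dep U (fun w => star_dev R (fun i k => spoke z a b i k w) i k).
Proof.
move=> u1 u2; rewrite /star_dev.
apply: (dep2 (fun x y => x - y)).
  by apply: (dep1 (fun c : bool => c%:R)); apply: spoke_dep.
apply: (dep1 (fun c => c / N%:R)); apply: dep_sum => j.
by apply: (dep1 (fun c : bool => c%:R)); apply: spoke_dep.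
Qed.

(** Only pairs of different edges of a star are constrained, and the constant may vary with the
    star. *)
Definition homogeneous N z (a b : 'I_N -> 'I_n) (eps : R) :=
  forall i, exists2 c, 0 <= c <= 1 & forall k k', k != k' ->
    `|prob mu (fun w => spoke z a b i k w && spoke z a b i k' w) - c| <= eps.

(** Off the diagonal the second moments are close to [c], hence so are their row averages and total
    average, up to [1 / N] for the diagonal; the covariance combines them as [c - c - c + c]. The
    expectations of single edges do not enter, as the deviation is from the empirical mean. *)
Lemma dev_cov N (x : 'I_N -> W -> bool) (c eps : R) (k l : 'I_N) :
  (0 < N)%N -> 0 <= eps -> 0 <= c <= 1 ->
  (forall k k', k != k' -> `|prob mu (fun w => x k w && x k' w) - c| <= eps) ->
  k != l ->
  `|E (fun w => ((x k w)%:R - (\sum_j (x j w)%:R) / N%:R) *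
                ((x l w)%:R - (\sum_j (x j w)%:R) / N%:R))| <= 4 * eps + 3 / N%:R.
Proof.
move=> N0 eps0 /andP[c0 c1] hx kl.
have N0' : 0 < N%:R :> R by rewrite ltr0n.
have hE k1 k2 : prob mu (fun w => x k1 w && x k2 w) = E (fun w => (x k1 w)%:R * (x k2 w)%:R).
  by rewrite probE; apply: eq_expect => w; rewrite -natrM mulnb.
pose e k1 k2 := E (fun w => (x k1 w)%:R * (x k2 w)%:R).
have eb k1 k2 : `|e k1 k2 - c| <= eps + (k1 == k2)%:R.
  have [<-|k12] := eqVneq k1 k2; last by rewrite addr0 /e -hE hx.
  apply: (@le_trans _ _ 1); last by rewrite lerDr.
  have e0 : 0 <= e k1 k1 by rewrite /e -hE prob_ge0.
  have e1 : e k1 k1 <= 1 by rewrite /e -hE prob_le1.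
  by rewrite ler_norml; apply/andP; split; lra.
have rowb k1 : `|(\sum_j e k1 j) / N%:R - c| <= eps + 1 / N%:R.
  have -> : (\sum_j e k1 j) / N%:R - c = (\sum_j (e k1 j - c)) / N%:R.
    by rewrite sumrB sumr_const card_ord -mulr_natr; field; rewrite gt_eqF.
  rewrite normrM [`|_^-1|]ger0_norm ?invr_ge0 ?ler0n //.
  rewrite ler_pdivrMr // mulrDl mul1r mulVf ?gt_eqF //.
  apply: le_trans (ler_norm_sum _ _ _) _.
  apply: (@le_trans _ _ (\sum_j (eps + (k1 == j)%:R))); first exact: ler_sum.
  rewrite big_split /= sumr_const card_ord -[eps *+ _]mulr_natr lerD2l.
  rewrite (bigD1 k1) //= eqxx big1 ?addr0 // => j.
  by rewrite eq_sym => /negbTE ->.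
have rowE k1 : E (fun w => (x k1 w)%:R * ((\sum_j (x j w)%:R) / N%:R)) =
    (\sum_j e k1 j) / N%:R.
  rewrite mulrC -expect_sum -expectZ; apply: eq_expect => w.
  by rewrite -mulr_sumr; ring.
have allE : E (fun w => ((\sum_j (x j w)%:R) / N%:R) * ((\sum_j (x j w)%:R) / N%:R)) =
    (\sum_k1 ((\sum_j e k1 j) / N%:R)) / N%:R.
  rewrite mulrC.
  under eq_bigr => k1 _ do rewrite -rowE.
  rewrite -expect_sum -expectZ; apply: eq_expect => w.
  by rewrite -mulr_suml; ring.
have allb : `|(\sum_k1 ((\sum_j e k1 j) / N%:R)) / N%:R - c| <= eps + 1 / N%:R.
  have -> : (\sum_k1 ((\sum_j e k1 j) / N%:R)) / N%:R - c =
     (\sum_k1 ((\sum_j e k1 j) / N%:R - c)) / N%:R.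
    by rewrite sumrB [\sum_(i < N) c]sumr_const card_ord -mulr_natr; field; rewrite gt_eqF.
  rewrite normrM [`|_^-1|]ger0_norm ?invr_ge0 ?ler0n //.
  rewrite ler_pdivrMr //.
  apply: le_trans (ler_norm_sum _ _ _) _.
  apply: (@le_trans _ _ (\sum_(k1 < N) (eps + 1 / N%:R))); first exact: ler_sum.
  by rewrite sumr_const card_ord -[leLHS]mulr_natr.
have -> : E (fun w => ((x k w)%:R - (\sum_j (x j w)%:R) / N%:R) *
                ((x l w)%:R - (\sum_j (x j w)%:R) / N%:R)) =
   e k l - (\sum_j e k j) / N%:R - (\sum_j e l j) / N%:R +
   (\sum_k1 ((\sum_j e k1 j) / N%:R)) / N%:R.
  rewrite -allE -!rowE -!expectB -expectD; apply: eq_expect => w; ring.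
have := eb k l; rewrite (negbTE kl) addr0.
move: (rowb k) (rowb l) allb.
rewrite !ler_norml => /andP[? ?] /andP[? ?] /andP[? ?] /andP[? ?].
by apply/andP; split; lra.
Qed.

Lemma star_dev_le1 N (X : 'I_N -> 'I_N -> bool) i k : `|star_dev R X i k| <= 1.
Proof.
rewrite /star_dev; have := star_deg_le1 R X i; have := star_deg_ge0 R X i.
set d := star_deg _ _ _ => d0 d1.
by rewrite ler_norml; case: (X i k) => /=; apply/andP; split; lra.
Qed.

Section Ports.
Context (N : nat) (a b : 'I_N -> 'I_n) (eps eta : R).
Hypothesis N0 : (0 < N)%N.
Hypothesis ainj : injective a.
Hypothesis binj : injective b.
Hypothesis ab : forall i k, a i != b k.
Hypothesis eps0 : 0 <= eps.
Hypothesis eta0 : 0 < eta.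

Let del := 4 * eps + 3 / N%:R.
Let del0 : 0 <= del.
Proof. by apply: addr_ge0; [apply: mulr_ge0; rewrite ?ler0n | rewrite divr_ge0 ?ler0n]. Qed.

Definition cut_fail (z : 'I_N -> 'I_N -> W -> R) (w : W) : bool :=
  eta ^+ 4 * N%:R ^+ 4 <= cut_energy (fun k i => z k i w).

Definition fail_bound : R := (2 / N%:R + del) / eta ^+ 4.

Lemma star_in z i : flip z (a i) \in only_at z a i.
Proof. exact: only_at_flip. Qed.

Lemma leaf_in z i k : flip (flip z (a i)) (b k) \in only_at z a i.
Proof. by apply: only_at_flips => //; apply: only_at_flip. Qed.

Lemma expect_prod_le (f g : W -> R) : (forall w, `|f w| <= 1) ->
  E f * E g <= `|E g|.
Proof.
move=> f1; apply: le_trans (ler_norm _) _; rewrite normrM ler_piMl //.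
exact: expect_norm_le.
Qed.

Lemma star_cov_abs z i k l : homogeneous z a b eps -> k != l ->
  `|E (fun w => star_dev R (fun i k => spoke z a b i k w) i k *
              star_dev R (fun i k => spoke z a b i k w) i l)| <= del.
Proof.
move=> /(_ i)[c c01 hc] kl.
exact: (@dev_cov N (fun k w => spoke z a b i k w) c).
Qed.

(** Different branches are independent, so the expectation of a 4-cycle is a product of two
    covariances, each inside one star. *)
Lemma star_cut z : homogeneous z a b eps ->
  prob mu (cut_fail (fun k i w => star_dev R (fun i k => spoke z a b i k w) k i))
    <= fail_bound.
Proof.
move=> hom; apply: cut_prob => //.
  by move=> k i w; apply: star_dev_le1.
move=> k k' i l kk' il.
have dv j j' : dep (only_at z a j)
    (fun w => star_dev R (fun i k => spoke z a b i k w) j j').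
  by apply: star_dev_dep; [apply: star_in | move=> ?; apply: leaf_in].
rewrite (@expect_indep _ _ mu ind (only_at z a k) (only_at z a k')) //.
- apply: le_trans (expect_prod_le _ _) (star_cov_abs _ hom il) => w.
  by rewrite normrM mulr_ile1 ?star_dev_le1.
- exact: only_at_disj.
- by apply: (dep2 (fun x y => x * y)).
- by apply: (dep2 (fun x y => x * y)).
Qed.

Lemma star_deg_dep z i :
  dep (only_at z a i) (fun w => star_deg R (fun i k => spoke z a b i k w) i).
Proof.
apply: (dep1 (fun c => c / N%:R)); apply: dep_sum => j.
by apply: (dep1 (fun c : bool => c%:R)); apply: spoke_dep;
  [apply: star_in | apply: leaf_in].
Qed.

Lemma mean_fail (f : 'I_N -> W -> R) (U : 'I_N -> {set hypercube n}) :
  (forall i w, 0 <= f i w <= 1) -> (forall i, dep (U i) (f i)) ->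
  (forall i j, i != j -> [disjoint U i & U j]) ->
  (forall i, p <= E (f i)) ->
  prob mu (fun w => ~~ ((p - eta) * N%:R <= \sum_i f i w)) <= 1 / (eta ^+ 2 * N%:R).
Proof.
move=> f01 fU Ud fp.
have := @chebyshev_sum _ _ mu N (fun i w => f i w - E (f i)) eta N0 eta0.
have Ef01 i : 0 <= E (f i) <= 1.
  rewrite -(expect_cst mu 0) -[X in _ <= _ <= X](expect_cst mu 1).
  by apply/andP; split; apply: ler_expect => w; have /andP[] := f01 i w.
move=> h; apply: le_trans (h _ _); first last.
- move=> i j ij.
  rewrite (@expect_indep _ _ mu ind (U i) (U j)).
  + by rewrite !expectB !expect_cst subrr mul0r.
  + exact: Ud.
  + by apply: (dep1 (fun x => x - E (f i))).
  + by apply: (dep1 (fun x => x - E (f j))).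
- move=> i w; have /andP[? ?] := f01 i w; have /andP[? ?] := Ef01 i.
  by rewrite ler_norml; apply/andP; split; lra.
apply: le_prob => w; rewrite -ltNge => h1.
have h2 : p * N%:R <= \sum_i E (f i).
  apply: (@le_trans _ _ (\sum_(i < N) p)); last exact: ler_sum.
  by rewrite sumr_const card_ord -[leRHS]mulr_natr.
rewrite sumrB distrC ger0_norm; first by move: h1 h2; lra.
have h3 : 0 < eta * N%:R by rewrite mulr_gt0 ?ltr0n.
by move: h1 h2 h3; lra.
Qed.

Lemma star_mean z :
  prob mu (fun w => ~~ ((p - eta) * N%:R <=
     \sum_i star_deg R (fun i k => spoke z a b i k w) i)) <= 1 / (eta ^+ 2 * N%:R).
Proof.
apply: (mean_fail (U := only_at z a)).
- by move=> i w; rewrite star_deg_ge0 star_deg_le1.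
- by move=> i; apply: star_deg_dep.
- by move=> i j; apply: only_at_disj.
- move=> i.
  have -> : E (fun w => star_deg R (fun i k => spoke z a b i k w) i) =
     N%:R^-1 * \sum_k prob mu (spoke z a b i k).
    under eq_bigr => k _ do rewrite probE.
    by rewrite -expect_sum -expectZ; apply: eq_expect => w; rewrite mulrC.
  rewrite mulrC ler_pdivlMr ?ltr0n //.
  apply: (@le_trans _ _ (\sum_(i < N) p)).
    by rewrite sumr_const card_ord -[leRHS]mulr_natr.
  by apply: ler_sum => k _; apply: flip_edge_prob.
Qed.

Lemma branch_mean z d : (forall i, a i != d) ->
  prob mu (fun w => ~~ ((p - eta) * N%:R <=
     #|[set i | flip_edge (flip z (a i)) d \in w]|%:R)) <= 1 / (eta ^+ 2 * N%:R).
Proof.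
move=> ad.
have h := @mean_fail (fun i w => (flip_edge (flip z (a i)) d \in w)%:R) (only_at z a).
apply: le_trans (h _ _ _ _).
- apply: le_prob => w; rewrite card_sumr.
  by under eq_bigr => i _ do rewrite inE.
- by move=> i w; case: (_ \in w); rewrite /= ?ler01 ?lexx.
- move=> i; apply: (dep1 (fun c : bool => c%:R)); apply: dep_mem.
    exact: flip_edge_in.
  apply: flip_edge_sub; first exact: star_in.
  by apply: only_at_flips => //; apply: star_in.
- by move=> i j; apply: only_at_disj.
- by move=> i; rewrite -probE; apply: flip_edge_prob.
Qed.

End Ports.
End Prob.

(** * Quasirandomness across a direction *)

Section Cross.
Context (R : realFieldType) (n : nat) (mu : bond_model R (hypercube n)) (p : R).
Hypothesis ind : one_independent mu.
Hypothesis hp : open_with_prob_ge p mu.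
Local Notation V := {ffun 'I_n -> bool}.
Local Notation W := {set {set hypercube n}}.
Local Notation E := (expect mu).
Context (N : nat) (eps eta : R).
Hypothesis N0 : (0 < N)%N.
Hypothesis eps0 : 0 <= eps.
Hypothesis eta0 : 0 < eta.
Implicit Types (z : V) (a b : 'I_N -> 'I_n).

Let del := 4 * eps + 3 / N%:R.
Let del0 : 0 <= del.
Proof. by apply: addr_ge0; [apply: mulr_ge0; rewrite ?ler0n | rewrite divr_ge0 ?ler0n]. Qed.

Lemma spoke_side z a b d i k : (forall i, a i != d) -> (forall k, b k != d) ->
  dep (side d (z d)) (spoke z a b i k).
Proof.
move=> ad bd; apply: spoke_dep; rewrite in_set !flipE ![d == _]eq_sym.
  by rewrite (negbTE (ad i)) addbF.
by rewrite (negbTE (ad i)) (negbTE (bd k)) !addbF.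
Qed.

Lemma star_dev_side z a b d i k : (forall i, a i != d) -> (forall k, b k != d) ->
  dep (side d (z d)) (fun w => star_dev R (fun i k => spoke z a b i k w) i k).
Proof.
move=> ad bd; rewrite /star_dev.
apply: (dep2 (fun x y => x - y)).
  by apply: (dep1 (fun c : bool => c%:R)); apply: spoke_side.
apply: (dep1 (fun c => c / N%:R)); apply: dep_sum => j.
by apply: (dep1 (fun c : bool => c%:R)); apply: spoke_side.
Qed.

(* The stars at [z] and those at [flip z d] lie on opposite sides of the
   direction [d], hence are independent. *)
Lemma prod_cut z a b d : injective b ->
  (forall i k, a i != b k) ->
  (forall i, a i != d) -> (forall k, b k != d) ->
  homogeneous mu (flip z d) b a eps ->
  prob mu (cut_fail eta (fun k i w =>
     prod_dev R (fun i k => spoke z a b i k w) (fun k i => spoke (flip z d) b a k i w) k i))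
  <= fail_bound N eps eta.
Proof.
move=> binj ab ad bd hom; apply: cut_prob => //.
  move=> k i w; rewrite /prod_dev normrM mulr_ile1 ?star_dev_le1 //.
  by case: spoke; rewrite ?normr1 ?normr0.
move=> k k' i l kk' il.
set z' := flip z d in hom *.
pose D k i w := star_dev R (fun k i => spoke z' b a k i w) k i.
pose X i k w := (spoke z a b i k w)%:R : R.
rewrite (_ : E _ = E (fun w => ((X i k w * X l k w) * (X i k' w * X l k' w)) *
   ((D k i w * D k l w) * (D k' i w * D k' l w)))); last first.
  by apply: eq_expect => w; rewrite /prod_dev /X /D; ring.
have Xs i0 k0 : dep (side d (z d)) (X i0 k0).
  by apply: (dep1 (fun c : bool => c%:R)); apply: spoke_side.
have Ds i0 k0 : dep (side d (z' d)) (D i0 k0) by apply: star_dev_side.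
have mm U (f g : W -> R) : dep U f -> dep U g -> dep U (fun w => f w * g w).
  by apply: (dep2 (fun x y => x * y)).
rewrite (@expect_indep _ _ mu ind (side d (z d)) (side d (z' d))); last first.
- by apply: (mm); apply: (mm).
- by apply: (mm); apply: (mm).
- by apply: side_disj; rewrite flipE eqxx addbT; case: (z d).
have dv j j' : dep (only_at z' b j) (D j j').
  by apply: star_dev_dep; [apply: only_at_flip | move=> ?; apply: only_at_flips; [move=> ?; rewrite eq_sym | apply: only_at_flip]].
have X1 i0 k0 w : `|X i0 k0 w| <= 1 by rewrite /X; case: spoke; rewrite ?normr1 ?normr0.
have D1 i0 k0 w : `|D i0 k0 w| <= 1 by apply: star_dev_le1.
have DE : `|E (fun w => D k i w * D k l w * (D k' i w * D k' l w))| <= del.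
  rewrite (@expect_indep _ _ mu ind (only_at z' b k) (only_at z' b k')).
  - rewrite normrM; apply: (@le_trans _ _ `|E (fun w => D k i w * D k l w)|).
      rewrite ler_piMr //; apply: expect_norm_le => w.
      by rewrite normrM mulr_ile1.
    exact: (star_cov_abs N0 eps0 k hom il).
  - exact: only_at_disj.
  - exact: mm.
  - exact: mm.
apply: le_trans (ler_norm _) _; rewrite normrM; apply: le_trans DE.
rewrite ler_piMl //; apply: expect_norm_le => w.
by rewrite !normrM !mulr_ile1 // ?mulr_ge0.
Qed.

Definition leaf_dev z a b d (i k : 'I_N) (w : W) : R :=
  (flip_edge (flip (flip z (a i)) (b k)) d \in w)%:R -
  prob mu (fun w => flip_edge (flip (flip z (a i)) (b k)) d \in w).

(** A leaf is located by both port families at once, so in a 4-cycle the edge at one leaf is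
    independent of the edges at the other three, and its centred factor has mean 0. *)
Lemma leaf_cut z a b d : injective a -> injective b ->
  (forall i k, a i != b k) ->
  (forall i, a i != d) -> (forall k, b k != d) ->
  prob mu (cut_fail eta (leaf_dev z a b d)) <= fail_bound N eps eta.
Proof.
move=> ainj binj ab ad bd; apply: cut_prob => //.
  move=> k i w; rewrite /leaf_dev.
  have := prob_ge0 mu (fun w => flip_edge (flip (flip z (a k)) (b i)) d \in w).
  have := prob_le1 mu (fun w => flip_edge (flip (flip z (a k)) (b i)) d \in w).
  by case: (_ \in w) => /= h1 h2; rewrite ler_norml; apply/andP; split; lra.
move=> k k' i l kk' il.
pose D := leaf_dev z a b d.
pose U := only_at z a k :&: only_at z b i.
have Din k0 i0 (U' : {set hypercube n}) : only_at z a k0 :&: only_at z b i0 \subset U' -> dep U' (D k0 i0).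
  move=> sU; apply: (dep1 (fun c : bool => c%:R - _)); apply: dep_mem; first exact: flip_edge_in.
  apply: subset_trans sU.
  have lf : flip (flip z (a k0)) (b i0) \in only_at z a k0 :&: only_at z b i0.
    rewrite in_setI; apply/andP; split.
      by apply: only_at_flips => //; apply: only_at_flip.
    by rewrite flipC; apply: only_at_flips;
      [move=> j; rewrite eq_sym | apply: only_at_flip].
  apply: flip_edge_sub => //; move: lf; rewrite !in_setI => /andP[l1 l2].
  by apply/andP; split; apply: only_at_flips.
have mm U' (f g : W -> R) : dep U' f -> dep U' g -> dep U' (fun w => f w * g w).
  by apply: (dep2 (fun x y => x * y)).
have e0 : E (D k i) = 0 by rewrite expectB expect_cst probE subrr.
rewrite (_ : E _ = E (fun w => D k i w * (D k l w * (D k' i w * D k' l w)))); last first.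
  by apply: eq_expect => w; rewrite /D; ring.
rewrite (@expect_indep _ _ mu ind U (~: U)) ?e0 ?mul0r //.
- by rewrite -setI_eq0 setICr.
- exact: Din.
have sub (k0 i0 : 'I_N) : (k0 != k) || (i0 != i) ->
    only_at z a k0 :&: only_at z b i0 \subset ~: U.
  move=> h; rewrite -disjoints_subset; case/orP: h => h.
    exact: disjointWl (subsetIl _ _) (disjointWr (subsetIl _ _) (only_at_disj _ _ h)).
  exact: disjointWl (subsetIr _ _) (disjointWr (subsetIr _ _) (only_at_disj _ _ h)).
apply: (mm); first by apply: Din; apply: sub; rewrite [l == i]eq_sym il orbT.
by apply: (mm); apply: Din; apply: sub; rewrite [k' == k]eq_sym kk'.
Qed.

Definition good z a b (w : W) : bool :=
  [&& ~~ cut_fail eta (fun k i w => star_dev R (fun i k => spoke z a b i k w) k i) w,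
      ~~ cut_fail eta (fun k i w => star_dev R (fun i k => spoke z b a i k w) k i) w,
      (p - eta) * N%:R <= \sum_i star_deg R (fun i k => spoke z a b i k w) i &
      (p - eta) * N%:R <= \sum_i star_deg R (fun i k => spoke z b a i k w) i].

Definition cross z a b d (w : W) : bool :=
  [&& ~~ cut_fail eta (fun k i w =>
        prod_dev R (fun i k => spoke z a b i k w) (fun k i => spoke (flip z d) b a k i w) k i) w,
      ~~ cut_fail eta (fun k i w =>
        prod_dev R (fun i k => spoke (flip z d) a b i k w) (fun k i => spoke z b a k i w) k i) w,
      ~~ cut_fail eta (leaf_dev z a b d) w,
      (p - eta) * N%:R <= #|[set i | flip_edge (flip z (a i)) d \in w]|%:R &
      (p - eta) * N%:R <= #|[set i | flip_edge (flip z (b i)) d \in w]|%:R].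

Definition dir_ok z a b d w := [&& good z a b w, good (flip z d) a b w & cross z a b d w].

(** A step involves two bases with two cut events and two means each, and three cut events and two
    means between them. *)
Definition step_bound : R := 7 * fail_bound N eps eta + 6 * (1 / (eta ^+ 2 * N%:R)).

Definition homog2 z a b := homogeneous mu z a b eps /\ homogeneous mu z b a eps.

Lemma dir_fail z a b d : injective a -> injective b ->
  (forall i k, a i != b k) ->
  (forall i, a i != d) -> (forall k, b k != d) ->
  homog2 z a b -> homog2 (flip z d) a b ->
  prob mu (fun w => ~~ dir_ok z a b d w) <= step_bound.
Proof.
move=> ainj binj ab ad bd [h1 h2] [h3 h4].
have ba i k : b i != a k by rewrite eq_sym.
have s1 := star_cut ind N0 ainj ab eps0 eta0.
have s2 := star_cut ind N0 binj ba eps0 eta0.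
have m1 := star_mean ind hp N0 ainj ab eta0.
have m2 := star_mean ind hp N0 binj ba eta0.
have pc1 := @prod_cut z a b d binj ab ad bd h4.
have pc2 := @prod_cut (flip z d) a b d binj ab ad bd.
rewrite flipK in pc2; have {}pc2 := pc2 h2.
have lc := @leaf_cut z a b d ainj binj ab ad bd.
have bm1 := branch_mean ind hp N0 ainj eta0 z ad.
have bm2 := branch_mean ind hp N0 binj eta0 z bd.
have gf z' : homogeneous mu z' a b eps -> homogeneous mu z' b a eps ->
   prob mu (fun w => ~~ good z' a b w) <= 2 * fail_bound N eps eta + 2 * (1 / (eta ^+ 2 * N%:R)).
  move=> k1 k2; set f := fail_bound N eps eta; set c := 1 / _.
  rewrite (_ : 2 * f + 2 * c = f + (f + (c + c))); last by ring.
  rewrite /good; (apply: prob_nand; [|apply: prob_nand; [|apply: prob_nand]]) => //.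
  - rewrite (eq_prob mu (B := cut_fail eta (fun k i w => star_dev R (fun i k => spoke z' a b i k w) k i))).
      exact: s1.
    by move=> w; rewrite negbK.
  - rewrite (eq_prob mu (B := cut_fail eta (fun k i w => star_dev R (fun i k => spoke z' b a i k w) k i))).
      exact: s2.
    by move=> w; rewrite negbK.
have cf : prob mu (fun w => ~~ cross z a b d w) <= 3 * fail_bound N eps eta + 2 * (1 / (eta ^+ 2 * N%:R)).
  set f := fail_bound N eps eta; set c := 1 / _.
  rewrite (_ : 3 * f + 2 * c = f + (f + (f + (c + c)))); last by ring.
  rewrite /cross; (apply: prob_nand; [|apply: prob_nand; [|apply: prob_nand; [|apply: prob_nand]]]) => //;
    match goal with |- is_true (prob _ (fun w => ~~ ~~ @?A w) <= _) =>
      rewrite (eq_prob mu (B := A)) => // w; exact: negbK end.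
rewrite (_ : step_bound = (2 * fail_bound N eps eta + 2 * (1 / (eta ^+ 2 * N%:R))) +
  ((2 * fail_bound N eps eta + 2 * (1 / (eta ^+ 2 * N%:R))) +
   (3 * fail_bound N eps eta + 2 * (1 / (eta ^+ 2 * N%:R))))); last by rewrite /step_bound; ring.
rewrite /dir_ok; (apply: prob_nand; [|apply: prob_nand]) => //; exact: gf.
Qed.

End Cross.

(** * Labels and links between bases *)

Section Labels.
Context (n : nat).
Local Notation V := {ffun 'I_n -> bool}.
Local Notation W := {set {set hypercube n}}.
Implicit Types (U : {set hypercube n}) (w : W) (x y z : V).

(** Keeping only edges inside [U] makes labels functions of the states inside [U], so that events
    about the labels of two cells can be independent of other cells. *)
Definition link_rel U w : rel (hypercube n) := fun u v => [set u; v] \in w :&: inner U.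

Definition lab U w x : {set hypercube n} := [set y | connect (link_rel U w) x y].

Lemma link_rel_sym U w : connect_sym (link_rel U w).
Proof.
apply: sym_connect_sym => u v; rewrite /link_rel.
by rewrite (_ : [set u; v] = [set v; u]) // setUC.
Qed.

Lemma labP U w x y : reflect (lab U w x = lab U w y) (connect (link_rel U w) x y).
Proof.
apply: (iffP idP) => [h|h].
  apply/setP => v; rewrite !in_set; exact: (same_connect (@link_rel_sym U w) h).
have : y \in lab U w y by rewrite in_set connect0.
by rewrite -h in_set.
Qed.

Lemma lab_edge U w x d : flip_edge x d \in w -> (x : hypercube n) \in U ->
  (flip x d : hypercube n) \in U -> lab U w x = lab U w (flip x d).
Proof.
move=> xw xU fU; apply/labP/connect1; rewrite /link_rel in_setI in_inner.
by rewrite xw flip_edge_in flip_edge_sub.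
Qed.

Lemma dep_lab U x : dep U (fun w => lab U w x).
Proof. by move=> w; rewrite /lab /link_rel -setIA setIid. Qed.

Lemma lab_mono U U' w x y : U \subset U' -> lab U w x = lab U w y ->
  lab U' w x = lab U' w y.
Proof.
move=> UU' /labP h; apply/labP; apply: connect_sub h => u v uv.
apply: connect1; move: uv; rewrite /link_rel !in_setI => /andP[-> uv] /=.
exact: (subsetP (inner_mono UU')).
Qed.

Definition fibre (K : {set 'I_n}) x : {set hypercube n} :=
  [set v : V | [forall c, (c \in K) || (v c == x c)]].

Lemma fibre_self K x : (x : hypercube n) \in fibre K x.
Proof. by rewrite in_set; apply/forallP => c; rewrite eqxx orbT. Qed.

Lemma fibre_flip K x v c : (v : hypercube n) \in fibre K x -> c \in K ->
  (flip v c : hypercube n) \in fibre K x.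
Proof.
rewrite !in_set => /forallP h cK; apply/forallP => c'; rewrite flipE.
have [->|cc'] := eqVneq c' c; first by rewrite cK.
by rewrite addbF h.
Qed.

Context (N : nat).
Local Notation I := ('I_N + 'I_N)%type.
Implicit Types (t : I -> 'I_n).

Definition arms U w z t m := [set s : I | lab U w (flip z (t s)) == m].

(* The threshold 114/100 comes from [main_stats], which gives a number of arms
   at least [(2 * p - 8 * kap) * N], larger than [1.14 * N]; only
   [> N] is needed for uniqueness. *)
Definition main U w z t m := (114 * N < 100 * #|arms U w z t m|)%N.

Lemma card_armT : #|{: I}| = (2 * N)%N.
Proof. by rewrite card_sum card_ord; lia. Qed.

Lemma main_unique U w z t m m' : main U w z t m -> main U w z t m' -> m = m'.
Proof.
rewrite /main => h h'; apply/eqP; apply: contraT => mm'.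
have : [disjoint arms U w z t m & arms U w z t m'].
  rewrite -setI_eq0; apply/eqP/setP => s; rewrite !in_set.
  by apply/negbTE/negP => /andP[/eqP-> ]; apply/negP.
rewrite -leq_card_setU => /eqP h2.
have := max_card (mem (arms U w z t m :|: arms U w z t m')).
by rewrite card_armT h2; lia.
Qed.

Definition joined U w z t z' t' := [exists m, main U w z t m && main U w z' t' m].

Lemma dep_joined U z t z' t' : dep U (fun w => joined U w z t z' t').
Proof.
have d1 z1 t1 w m : main U w z1 t1 m = main U (w :&: inner U) z1 t1 m.
  rewrite /main (_ : arms U w z1 t1 m = arms U (w :&: inner U) z1 t1 m) //.
  by apply/setP => s; rewrite !in_set (dep_lab U _ w).
by move=> w; apply: eq_existsb => m; rewrite (d1 z) (d1 z').
Qed.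

End Labels.

(** The two bounds add up to [A + B >= N * (1 + (2 * p - 1 - 8 * kap) / (t + s - 1))], where the
    numerator exceeds 0.14 and the denominator is at most 1. *)
Lemma count_arith (R : realFieldType) (kap p t s N A B : R) :
  0 < kap -> kap <= 1 / 400 -> 5847 / 10000 <= p -> 0 < N -> 0 <= A -> 0 <= B ->
  p - 4 * kap <= t -> t <= 1 -> p - 4 * kap <= s -> s <= 1 ->
  (p + s - 1 - 4 * kap) * N <= A * (t + s - 1) ->
  (p + t - 1 - 4 * kap) * N <= B * (t + s - 1) -> 114 * N < 100 * (A + B).
Proof.
move=> k0 k1 p0 N0 A0 B0 t0 t1 s0 s1 hA hB.
rewrite ltNge; apply/negP => h.
have u0 : 0 <= t + s - 1 by move: t0 s0 p0 k1; clear; lra.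
have h1 : 100 * ((A + B) * (t + s - 1)) <= 114 * N * (t + s - 1).
  by rewrite mulrA; apply: ler_wpM2r.
have h2 : N * (t + s - 1) <= N by rewrite ler_piMr ?(ltW N0) //; move: t1 s1; clear; lra.
have h3 : 14 * N < 100 * (2 * p - 1 - 8 * kap) * N.
  by rewrite ltr_pM2r //; move: p0 k1; clear; lra.
by move: hA hB h1 h2 h3; clear; lra.
Qed.

(** Nine tenths of the [2 N] directions, each with more than [1.14 N] arms, give more than
    [1.8 * 1.14 * N^2 > 2 N^2] pairs, that is, more than half of all pairs. *)
Lemma port_arith (N c X S : nat) : (S <= X)%N -> (c * (114 * N).+1 <= 100 * S)%N ->
  (18 * N * (114 * N).+1 <= 10 * c * (114 * N).+1)%N -> (0 < N)%N -> (200 * (N * N) < 100 * X)%N.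
Proof.
move=> h1; rewrite -!mulnA; set Q := (c * _)%N.
have -> : (N * (114 * N).+1 = 114 * (N * N) + N)%N by rewrite mulnS mulnCA addnC.
set P := (N * N)%N; clearbody P Q. 
by move: h1; clear; lia.
Qed.

Lemma good_arith (N a : nat) : (10 * a <= 2 * N -> 18 * N <= 10 * (2 * N - a))%N.
Proof. by lia. Qed.

Lemma left_arith (N a : nat) : (10 * a <= 2 * N -> 0 < N -> 0 < 2 * N - a)%N.
Proof. by lia. Qed.

Lemma pair_arith (N X Y : nat) : (200 * (N * N) < 100 * X)%N ->
  (200 * (N * N) < 100 * Y)%N -> (X + Y <= 2 * N * (2 * N))%N -> False.
Proof.
rewrite mulnACA; set P := (N * N)%N; clearbody P; clear; lia.
Qed.

(** * Main components along a step and under a change of ports *)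

Section DirLink.
Context (R : realFieldType) (n : nat) (mu : bond_model R (hypercube n)) (p kap eps : R).
Hypothesis ind : one_independent mu.
Hypothesis hp : open_with_prob_ge p mu.
Local Notation V := {ffun 'I_n -> bool}.
Local Notation W := {set {set hypercube n}}.
Context (N : nat).
Hypothesis N0 : (0 < N)%N.
Hypothesis kap0 : 0 < kap.
Hypothesis kap1 : kap <= 1 / 400.
Hypothesis p0 : 5847 / 10000 <= p.
Hypothesis eps0 : 0 <= eps.
Local Notation I := ('I_N + 'I_N)%type.
Implicit Types (t : I -> 'I_n) (U : {set hypercube n}) (w : W) (x y z : V).
Local Notation eta := (kap ^+ 3 / 4).
Let eta0 : 0 < eta. Proof. by rewrite divr_gt0 ?exprn_gt0 // ltr0n. Qed.

Definition arm_ok z t d w := dir_ok mu p eta z (fun i => t (inl i)) (fun k => t (inr k)) d w.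

Lemma card_arms U w z t m :
  #|arms U w z t m| = (#|labelled (fun i => lab U w (flip z (t (inl i)))) m| +
     #|labelled (fun i => lab U w (flip z (t (inr i)))) m|)%N.
Proof.
have cE (T : finType) (A : {set T}) : #|A| = (\sum_x (x \in A))%N.
  by rewrite -sum1_card big_mkcond; apply: eq_bigr => x _; case: (x \in A).
rewrite !cE big_sumType /=; congr (_ + _)%N;
  by apply: eq_bigr => i _; rewrite !in_set.
Qed.

(** Labels of branches are components inside the fibre. Two open spokes at a leaf, an open branch
    edge along [d], or an open route through adjacent leaves equate two labels, which is the input
    of [main_exists] and [direction_link]. *)
Lemma dir_link K x0 z t d w : injective t ->
  (z : hypercube n) \in fibre K x0 -> (forall s, t s \in K) -> d \in K ->
  arm_ok z t d w ->
  exists m, main (fibre K x0) w z t m /\ main (fibre K x0) w (flip z d) t m.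
Proof.
move=> tinj zU tK dK /and3P[g g' c].
set U := fibre K x0 in zU *.
set a := fun i => t (inl i) in g g' c.
set b := fun i => t (inr i) in g g' c.
have z'U : (flip z d : hypercube n) \in U by apply: fibre_flip.
have fU := @fibre_flip n K x0.
have cs (f : 'I_N -> 'I_N -> W -> R) : ~~ cut_fail eta f w -> cut_small eta (fun k i => f k i w).
  rewrite /cut_fail -ltNge => h c' d' c1 d1.
  by apply: cut_bound => //; apply: ltW.
pose lL z1 i := lab U w (flip z1 (a i)).
pose lR z1 i := lab U w (flip z1 (b i)).
have ex z1 : (z1 : hypercube n) \in U -> good p eta z1 a b w ->
    exists M (t1 s1 : R), main_stats kap p (fun i k => spoke z1 a b i k w)
       (fun i k => spoke z1 b a i k w) (lL z1) (lR z1) M t1 s1.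
  move=> z1U /and4P[h1 h2 h3 h4].
  apply: main_exists => //; [exact: cs h1 | exact: cs h2 |].
  move=> i k e1 e2; rewrite /lL /lR.
  rewrite (lab_edge e1) ?fU ?tK // (lab_edge e2) ?fU ?tK //.
  by rewrite flipC.
have [M [t1 [s1 st]]] := ex _ zU g.
have [M' [t1' [s1' st']]] := ex _ z'U g'.
have [g1 g2 _ _] := and4P g; have [g1' g2' _ _] := and4P g'.
have [c1 c2 c3 c4 c5] := and5P c.
have p1 : p <= 1 := p_le1 hp z d.
have MM' : M = M'.
  apply: (direction_link kap0 kap1 p0 N0 p1 st st' (cs _ g1) (cs _ g1') (cs _ c1) (cs _ c2)
     (Q := fun i k => flip_edge (flip (flip z (a i)) (b k)) d \in w) (cs _ c3) _ c4 c5).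
  - by move=> i k; apply: (flip_edge_prob hp).
  - move=> i; rewrite in_set => e; rewrite /lL (lab_edge e) ?fU ?tK //.
    by rewrite flipC.
  - move=> i; rewrite in_set => e; rewrite /lR (lab_edge e) ?fU ?tK //.
    by rewrite flipC.
  - move=> i k e1 e2 e3; rewrite /lL /lR.
    rewrite (lab_edge e1) ?fU ?tK // (lab_edge e3) ?fU ?tK //.
    rewrite (lab_edge e2) ?fU ?tK //.
    by congr (lab U w); rewrite (flipC _ (b k) (a i)) !(flipC _ _ d).
  - move=> i k e1 e2 e3; rewrite /lL /lR.
    rewrite (lab_edge e1) ?fU ?tK // (lab_edge e2) ?fU ?tK //.
    rewrite [flip (flip z (b k)) (a i)]flipC (lab_edge e3) ?fU ?tK //.
    by congr (lab U w); rewrite !(flipC _ _ d).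
have cnt z1 m (t2 s2 : R) : main_stats kap p (fun i k => spoke z1 a b i k w)
       (fun i k => spoke z1 b a i k w) (lL z1) (lR z1) m t2 s2 -> main U w z1 t m.
  move=> [/andP[u1 u2] /andP[v1 v2] _ _ [h1 h2]].
  rewrite /main card_arms -(ltr_nat R) !natrM natrD.
  by apply: (count_arith kap0 kap1 p0 _ _ _ u1 u2 v1 v2 h1 h2); rewrite ?ltr0n ?ler0n.
exists M; split; last rewrite MM'.
  by apply: cnt st.
by apply: cnt st'.
Qed.

Definition port_ok y t t' w :=
  (10 * #|[set s | ~~ arm_ok y t (t' s) w]| <= 2 * N)%N.

(** Each good step carries the main component of [t] from [y] to [y + t'_s'], whose arms are the
    vertices [y + t'_s' + t_s]; these are counted over all pairs. *)
Lemma port_link K x0 y t t' w m : injective t ->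
  (y : hypercube n) \in fibre K x0 -> (forall s, t s \in K) -> (forall s, t' s \in K) ->
  port_ok y t t' w -> main (fibre K x0) w y t m ->
  (200 * (N * N) < 100 * #|[set ss : I * I | lab (fibre K x0) w
     (flip (flip y (t' ss.2)) (t ss.1)) == m]|)%N.
Proof.
move=> tinj yU tK t'K ok my; set U := fibre K x0 in yU my *.
set A := [set s | ~~ arm_ok y t (t' s) w] in ok.
have cA : (#|~: A| = 2 * N - #|A|)%N by rewrite cardsCs finset.setCK card_armT.
have h : (\sum_(s' in ~: A) #|arms U w (flip y (t' s')) t m| <=
    #|[set ss : I * I | lab U w (flip (flip y (t' ss.2)) (t ss.1)) == m]|)%N.
  rewrite -[leqRHS]sum1_card; under eq_bigr => s' _ do rewrite -sum1_card.
  rewrite pair_big_dep /= (reindex_inj (h := fun ss : I * I => (ss.2, ss.1))) /=; last first.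
    by move=> [? ?] [? ?] [-> ->].
  rewrite [leqLHS]big_mkcond [leqRHS]big_mkcond /=; apply: leq_sum => -[s s'] _ /=.
  by rewrite !in_set /=; case: (~~ _) => //=.
have h2 : (#|~: A| * (114 * N).+1 <= 100 * \sum_(s' in ~: A) #|arms U w (flip y (t' s')) t m|)%N.
  rewrite big_distrr /= -sum_nat_const; apply: leq_sum => s'.
  rewrite !in_set negbK => ok'.
  have [m1 [m2 m3]] := dir_link tinj yU tK (t'K s') ok'.
  by move: m3; rewrite (main_unique m2 my).
have h3 : (18 * N * (114 * N).+1 <= 10 * #|~: A| * (114 * N).+1)%N.
  by apply: leq_mul => //; rewrite cA; apply: good_arith.
exact: port_arith h h2 h3 N0.
Qed.

Definition tt_ok y t t' w := port_ok y t t' w && port_ok y t' t w.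

(** The order of two flips does not matter, so the main components of both families are counted on
    the same vertices [y + t_s + t'_s']. Each takes more than half of the pairs, hence they
    coincide. *)
Lemma tt_link K x0 y t t' w : injective t -> injective t' ->
  (y : hypercube n) \in fibre K x0 -> (forall s, t s \in K) -> (forall s, t' s \in K) ->
  tt_ok y t t' w ->
  exists m, main (fibre K x0) w y t m /\ main (fibre K x0) w y t' m.
Proof.
move=> tinj tinj' yU tK t'K /andP[ok ok'].
have ex t1 t2 : injective t1 -> (forall s, t1 s \in K) -> (forall s, t2 s \in K) ->
    port_ok y t1 t2 w -> exists m, main (fibre K x0) w y t1 m.
  move=> i1 k1 k2; rewrite /port_ok => o.
  have [s sA] : exists s, s \in ~: [set s | ~~ arm_ok y t1 (t2 s) w].
    apply/set0Pn; rewrite -card_gt0 cardsCs finset.setCK card_armT.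
    exact: left_arith o N0.
  move: sA; rewrite !in_set negbK => o1.
  by have [m [m1 _]] := dir_link i1 yU k1 (k2 s) o1; exists m.
have [m mP] := ex _ _ tinj tK t'K ok; have [m' mP'] := ex _ _ tinj' t'K tK ok'.
have c := port_link tinj yU tK t'K ok mP.
have := port_link tinj' yU t'K tK ok' mP'.
rewrite (_ : #|_| = #|[set ss : I * I | lab (fibre K x0) w
     (flip (flip y (t' ss.2)) (t ss.1)) == m']|); last first.
  rewrite -!sum1_card (reindex_inj (h := fun ss : I * I => (ss.2, ss.1))) /=; last first.
    by move=> [? ?] [? ?] [-> ->].
  by apply: eq_bigl => -[s s']; rewrite !in_set /= flipC.
move=> c'; exists m; split=> //; suff -> : m = m' by [].
apply/eqP; apply: contraT => mm'.
move: c c'; set A := [set _ | _ ] => c; set B := [set _ | _ ] => c'.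
have : [disjoint A & B].
  rewrite -setI_eq0; apply/eqP/setP => s; rewrite !in_set.
  by apply/negbTE/negP => /andP[/eqP-> ]; apply/negP.
rewrite -leq_card_setU => /eqP h2.
have := max_card (mem (A :|: B)).
rewrite card_prod card_armT h2 => h3; exfalso; exact: pair_arith c c' h3.
Qed.

(** The step along [d] is made with the ports [t]; the change to [t'] takes place at the new
    base. *)
Definition link_ok x t t' d w := arm_ok x t d w && tt_ok (flip x d) t t' w.

Lemma link_ok_joined K x0 x t t' d w : injective t -> injective t' ->
  (x : hypercube n) \in fibre K x0 -> (forall s, t s \in K) -> (forall s, t' s \in K) ->
  d \in K -> link_ok x t t' d w -> joined (fibre K x0) w x t (flip x d) t'.
Proof.
move=> i1 i2 xU tK t'K dK /andP[o1 o2].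
have [m [m1 m2]] := dir_link i1 xU tK dK o1.
have [m' [m1' m2']] := tt_link i1 i2 (fibre_flip xU dK) tK t'K o2.
apply/existsP; exists m; rewrite m1 /=.
by rewrite (main_unique m2 m1').
Qed.

Let H z t := homog2 mu eps z (fun i => t (inl i)) (fun k => t (inr k)).

Lemma arm_fail z t d : injective t -> (forall s, t s != d) -> H z t -> H (flip z d) t ->
  prob mu (fun w => ~~ arm_ok z t d w) <= step_bound N eps eta.
Proof.
move=> tinj td h1 h2; apply: dir_fail => //.
- by move=> i j /tinj[].
- by move=> i j /tinj[].
- by move=> i k; apply/eqP => /tinj.
Qed.

(** Markov for the number of bad ports, whose mean is at most [2 N] times the failure bound of one
    step, against the threshold [2 N / 10]. *)
Lemma port_fail y t t' : injective t -> (forall s s', t s != t' s') ->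
  H y t -> (forall s, H (flip y (t' s)) t) ->
  prob mu (fun w => ~~ port_ok y t t' w) <= 10 * step_bound N eps eta.
Proof.
move=> tinj tt' h1 h2.
pose f w : R := #|[set s | ~~ arm_ok y t (t' s) w]|%:R.
apply: le_trans (_ : prob mu (fun w => 2 * N%:R / 10 <= f w) <= _).
  apply: le_prob => w; rewrite /port_ok -ltnNge -(ltr_nat R) !natrM => h.
  by rewrite ler_pdivrMr ?ltr0n // [_ * 10]mulrC; apply: ltW.
apply: le_trans (markov _ _ _) _.
- by move=> w; apply: ler0n.
- by rewrite divr_gt0 ?mulr_gt0 ?ltr0n.
have -> : expect mu f = \sum_s prob mu (fun w => ~~ arm_ok y t (t' s) w).
  under eq_bigr => s _ do rewrite probE.
  rewrite -expect_sum; apply: eq_expect => w; rewrite /f card_sumr.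
  by apply: eq_bigr => s _; rewrite in_set.
rewrite ler_pdivrMr ?divr_gt0 ?mulr_gt0 ?ltr0n //.
apply: (@le_trans _ _ (\sum_(s : I) step_bound N eps eta)).
  by apply: ler_sum => s _; apply: arm_fail.
rewrite sumr_const card_armT -[leLHS]mulr_natr natrM.
by rewrite le_eqVlt; apply/orP; left; apply/eqP; field.
Qed.

Lemma link_fail x t t' d : injective t -> injective t' ->
  (forall s s', t s != t' s') -> (forall s, t s != d) ->
  H x t -> H (flip x d) t -> (forall s, H (flip (flip x d) (t' s)) t) ->
  H (flip x d) t' -> (forall s, H (flip (flip x d) (t s)) t') ->
  prob mu (fun w => ~~ link_ok x t t' d w) <= 21 * step_bound N eps eta.
Proof.
move=> i1 i2 tt' td h1 h2 h3 h4 h5.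
rewrite (_ : 21 * _ = step_bound N eps eta +
  (10 * step_bound N eps eta + 10 * step_bound N eps eta)); last by ring.
apply: prob_nand; first exact: arm_fail.
by apply: prob_nand; apply: port_fail => // s s'; rewrite eq_sym.
Qed.

Lemma joined_fail K x0 x t t' d : injective t -> injective t' ->
  (x : hypercube n) \in fibre K x0 -> (forall s, t s \in K) -> (forall s, t' s \in K) ->
  d \in K ->
  (forall s s', t s != t' s') -> (forall s, t s != d) ->
  H x t -> H (flip x d) t -> (forall s, H (flip (flip x d) (t' s)) t) ->
  H (flip x d) t' -> (forall s, H (flip (flip x d) (t s)) t') ->
  prob mu (fun w => ~~ joined (fibre K x0) w x t (flip x d) t') <= 21 * step_bound N eps eta.
Proof.
move=> i1 i2 xU tK t'K dK tt' td h1 h2 h3 h4 h5.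
apply: le_trans (link_fail i1 i2 tt' td h1 h2 h3 h4 h5).
apply: le_prob => w; apply: contra; exact: link_ok_joined.
Qed.

End DirLink.

(** * Ramsey choice of the ports *)

Local Open Scope nat_scope.

Section Ramsey.
Context (C : finType).

Lemma pigeonhole (T : Type) (f : T -> C) (s : seq T) M : #|C| * M < size s ->
  exists c, M < size [seq x <- s | f x == c].
Proof.
move=> h; apply/existsP; apply: contraLR h; rewrite negb_exists -leqNgt => /forallP h.
have -> : size s = \sum_c size [seq x <- s | f x == c].
  under eq_bigr => c _ do rewrite size_filter -sum1_count big_mkcond.
  rewrite exchange_big /= -sum1_size; apply: eq_bigr => x _.
  by rewrite (bigD1 (f x)) //= eqxx big1 // => c; rewrite eq_sym => /negbTE ->.
rewrite -sum_nat_const; apply: leq_sum => c _.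
by rewrite leqNgt h.
Qed.

(** Every element of [s'] sees all later ones in one colour [g x]: keep the head, restrict the tail
    to a frequent colour, recurse. *)
Lemma ramsey_tail t : exists M, forall (T : eqType) (c : T -> T -> C) (s : seq T),
  uniq s -> M <= size s -> exists (s' : seq T) (g : T -> C), [/\ subseq s' s, size s' = t &
    pairwise (fun x y => c x y == g x) s'].
Proof.
elim: t => [|t [M IH]].
  (* Even for length 0 a function into [C] is needed; an element of [s] provides a colour, whence
     the size 1. *)
  by exists 1%N => T c [|x s] // _ _; exists [::], (c x); rewrite sub0seq.
exists (#|C| * M).+2 => T c [|x s] //= /andP[xs us]; rewrite ltnS => h.
have [c0 hc0] := pigeonhole (c x) h.
have [s' [g [s1 s2 s3]]] := IH T c _ (filter_uniq _ us) (ltnW hc0).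
have s's : {subset s' <= s}.
  by move=> y /(mem_subseq s1); rewrite mem_filter => /andP[].
exists (x :: s'), (fun y => if y \in s' then g y else c0); split.
- by rewrite /= eqxx; apply: subseq_trans s1 (filter_subseq _ _).
- by rewrite /= s2.
- rewrite /=; apply/andP; split; last first.
    move: (s3) => /(pairwiseP x) P; apply/(pairwiseP x) => i j.
    rewrite !inE => hi hj ij; rewrite mem_nth //.
    exact: (P i j hi hj ij).
  apply/allP => y ys.
  have := mem_subseq s1 ys; rewrite mem_filter => /andP[/eqP -> _].
  by case: ifP => // /s's; rewrite (negbTE xs).
Qed.

Lemma ramsey t : exists M, forall (T : eqType) (c : T -> T -> C) (s : seq T),
  uniq s -> M <= size s -> exists (s' : seq T) (c0 : C), [/\ subseq s' s, size s' = t &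
    pairwise (fun x y => c x y == c0) s'].
Proof.
have [M HM] := ramsey_tail (#|C| * t).+1.
exists M => T c s us sM.
have [s1 [g [h1 h2 h3]]] := HM T c s us sM.
have [c0 hc0] : exists c0, t < size [seq x <- s1 | g x == c0].
  by apply: pigeonhole; rewrite h2.
exists (take t [seq x <- s1 | g x == c0]), c0; split.
- apply: subseq_trans (take_subseq _ _) (subseq_trans (filter_subseq _ _) h1).
- by rewrite size_take hc0.
- apply: subseq_pairwise (take_subseq _ _) _.
  move: h3 => /(subseq_pairwise (filter_subseq (fun x => g x == c0) s1)).
  elim: [seq _ <- _ | _] (filter_all (fun x => g x == c0) s1) => //= x s2 IH.
  move=> /andP[/eqP gx /IH{}IH] /andP[h4 /IH ->]; rewrite andbT.
  by rewrite gx in h4.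
Qed.
End Ramsey.

Local Open Scope ring_scope.

(** * Homogeneous ports at boundedly many bases *)

Section Ports.
Context (R : realFieldType) (Q : nat).
Hypothesis Q0 : (0 < Q)%N.
Local Notation eps := (Q%:R^-1 : R).

Lemma round_down (v : R) : 0 <= v <= 1 ->
  exists j : 'I_Q.+1, `|v - j%:R / Q%:R| <= eps.
Proof.
move=> /andP[v0 v1].
have Q0' : 0 < Q%:R :> R by rewrite ltr0n.
pose P (j : nat) := j%:R <= v * Q%:R.
have P0 : exists j, P j by exists 0%N; rewrite /P mulr_ge0 ?ler0n.
have Pm j : P j -> (j <= Q)%N.
  by move=> h; rewrite -(ler_nat R); apply: le_trans h _; rewrite ger_pMl.
case: (ex_maxnP P0 Pm) => j Pj mj.
have jQ : (j < Q.+1)%N by rewrite ltnS Pm.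
exists (Ordinal jQ) => /=.
have h : v * Q%:R <= j%:R + 1.
  rewrite leNgt; apply/negP => h.
  have /mj : P j.+1 by rewrite /P -natr1 ltW.
  by rewrite ltnn.
have -> : v - j%:R / Q%:R = (v * Q%:R - j%:R) / Q%:R by field; rewrite gt_eqF.
rewrite normrM [`|_^-1|]ger0_norm ?invr_ge0 ?(ltW Q0') // ler_piMl ?invr_ge0 ?(ltW Q0') //.
by rewrite ler_norml; move: Pj h; rewrite /P => Pj h; apply/andP; split; lra.
Qed.

Definition star_hom n (mu : bond_model R (hypercube n)) N x (b : 'I_N -> 'I_n) :=
  exists2 c, 0 <= c <= 1 & forall k k', k != k' ->
  `|prob mu (fun w => (flip_edge x (b k) \in w) && (flip_edge x (b k') \in w)) - c| <= eps.

(** The colour of a pair of directions is the vector of its rounded probabilities at all given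
    bases, so one application of Ramsey serves them all. The size [M] is chosen before [n] and
    [mu]. *)
Lemma star_select B N : exists M, forall n (mu : bond_model R (hypercube n))
  (xs : seq {ffun 'I_n -> bool}) (P : seq 'I_n), uniq P -> (size xs <= B)%N -> (M <= size P)%N ->
  exists b : 'I_N -> 'I_n, [/\ injective b, forall k, b k \in P &
    forall x, x \in xs -> star_hom mu x b].
Proof.
have [M HM] := ramsey {ffun 'I_B -> 'I_Q.+1} N.
exists M => n mu xs P uP sxs sP.
have /boolp.choice[rd rdP] : forall v : R, exists j : 'I_Q.+1, 0 <= v <= 1 -> `|v - j%:R / Q%:R| <= eps.
  move=> v; have [h|h] := boolP (0 <= v <= 1).
    by have [j] := round_down h; exists j.
  by exists ord0.
pose pr x d d' := prob mu (fun w => (flip_edge x d \in w) && (flip_edge x d' \in w)).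
(* The default pads [xs] to length [B]; only positions of actual elements are used later. *)
pose c d d' := [ffun j : 'I_B => rd (pr (nth [ffun=> false] xs j) d d')].
have [s [c0 [s1 s2 s3]]] := HM _ c P uP sP.
have us := subseq_uniq s1 uP.
case: N s2 {HM} => [|N] s2.
  exists (fun k : 'I_0 => False_rect _ (Bool.diff_false_true (ltn_ord k))); split; try by case.
  move=> x _; exists 0; [by rewrite lexx ler01 | by case].
have i0 : 'I_n by case: s s2 {s1 s3 us}.
exists (fun k : 'I_N.+1 => nth i0 s k); split.
- move=> k k' /eqP; rewrite nth_uniq ?s2 // => /eqP e; exact: val_inj.
- by move=> k; apply: (mem_subseq s1); rewrite mem_nth ?s2.
move=> x xxs.
have xB : (index x xs < B)%N by apply: leq_trans sxs; rewrite index_mem.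
pose j := Ordinal xB.
have pr01 d d' : 0 <= pr x d d' <= 1 by rewrite prob_ge0 prob_le1.
have main k k' : (k < k')%N -> (k' < N.+1)%N ->
    `|pr x (nth i0 s k) (nth i0 s k') - (c0 j)%:R / Q%:R| <= eps.
  move=> kk' k'N; move: s3 => /(pairwiseP i0) /(_ k k').
  rewrite !inE s2 => /(_ (ltn_trans kk' k'N) k'N kk') /eqP <-.
  rewrite ffunE /= nth_index //; exact: rdP.
exists ((c0 j)%:R / Q%:R).
  rewrite divr_ge0 ?ler0n //= ler_pdivrMr ?ltr0n // mul1r ler_nat.
  by rewrite -ltnS.
move=> k k'; rewrite neq_ltn => /orP[kk'|kk'].
  exact: main kk' (ltn_ord k').
rewrite (eq_prob mu (B := fun w => (flip_edge x (nth i0 s k') \in w) && (flip_edge x (nth i0 s k) \in w))).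
  exact: main kk' (ltn_ord k).
by move=> w; rewrite andbC.
Qed.

Local Notation hom mu z t := (homog2 mu eps z (fun i => t (inl i)) (fun k => t (inr k))).

(** [b] has to be homogeneous at [z + a_i] and [a] at [z + b_k]. So [a] is made homogeneous at all
    [z + d] with [d] in the reserve [P2], whose size is fixed in advance, and [b] is chosen
    afterwards inside [P2]. *)
Lemma port_select B N : exists M1 M2, forall n (mu : bond_model R (hypercube n))
  (zs : seq {ffun 'I_n -> bool}) (P1 P2 : seq 'I_n), uniq (P1 ++ P2) -> (size zs <= B)%N ->
  (M1 <= size P1)%N -> size P2 = M2 ->
  exists t : 'I_N + 'I_N -> 'I_n, [/\ injective t, forall s, t s \in P1 ++ P2 &
    forall z, z \in zs -> hom mu z t].
Proof.
have [M2 H2] := star_select (B * N) N.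
have [M1 H1] := star_select (B * M2) N.
exists M1, M2 => n mu zs P1 P2.
rewrite cat_uniq => /and3P[u1 /hasPn P12 u2] szs sP1 sP2.
have [|a [ainj aP ah]] := H1 n mu [seq flip z d | z <- zs, d <- P2] P1 u1 _ sP1.
  by rewrite size_allpairs sP2 leq_mul2r szs orbT.
have [|b [binj bP bh]] := H2 n mu [seq flip z d | z <- zs, d <- [seq a i | i <- enum 'I_N]] P2 u2 _ (eq_leq (esym sP2)).
  by rewrite size_allpairs size_map size_enum_ord leq_mul2r szs orbT.
exists (fun s => match s with inl i => a i | inr k => b k end); split.
- move=> [i|i] [j|j].
  + by move/ainj ->.
  + by move=> e; have := P12 _ (bP j); rewrite -e aP.
  + by move=> e; have := P12 _ (bP i); rewrite e aP.
  + by move/binj ->.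
- by move=> [i|i]; rewrite mem_cat ?aP ?bP ?orbT.
move=> z zzs; split=> i.
  apply: bh; apply/allpairsP; exists (z, a i); split=> //.
  by apply: map_f; rewrite mem_enum.
apply: ah; apply/allpairsP; exists (z, b i); split=> //=.
Qed.

(** [te] is meant for even cells and [to] for odd ones. [te x] anticipates the whole odd reserve at
    the neighbours of [x]; [to y] is chosen inside that reserve when all even families are known. At
    most 4 neighbours keep the number of constraints bounded. *)
Lemma ports_assign N : exists K, forall n (mu : bond_model R (hypercube n))
  (P : seq 'I_n) (nb : {ffun 'I_n -> bool} -> seq {ffun 'I_n -> bool}),
  uniq P -> size P = K -> (forall x, size (nb x) <= 4)%N ->
  exists te to : {ffun 'I_n -> bool} -> 'I_N + 'I_N -> 'I_n,
  [/\ forall x, injective (te x) /\ injective (to x),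
      forall x s, te x s \in P /\ to x s \in P,
      forall x y s s', te x s != to y s' &
      forall x y, y \in nb x -> x \in nb y ->
      [/\ hom mu x (te x), hom mu y (te x), forall s, hom mu (flip y (to y s)) (te x),
          hom mu y (to y) & forall s, hom mu (flip y (te x s)) (to y)]].
Proof.
(* The constraints on [to y] are at [y] and at [y + te x s] for four neighbours [x] and [2 N] ports;
   those on [te x] are at [x], at its neighbours [y], and at [y + d] for the [O1 + O2] coordinates
   [d] of the odd reserve. *)
have [O1 [O2 HO]] := port_select (1 + 4 * (2 * N)) N.
have [E1 [E2 HE]] := port_select (1 + (4 + 4 * (O1 + O2))) N.
exists (E1 + E2 + (O1 + O2))%N => n mu P nb uP sP nb4.
pose Pe := take (E1 + E2) P; pose Po := drop (E1 + E2) P.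
have sPe : size Pe = (E1 + E2)%N by rewrite size_takel // sP leq_addr.
have sPo : size Po = (O1 + O2)%N by rewrite size_drop sP addKn.
have PE : P = Pe ++ Po by rewrite cat_take_drop.
move: uP; rewrite PE cat_uniq => /and3P[uPe /hasPn Peo uPo].
have eex x : exists t : 'I_N + 'I_N -> 'I_n, [/\ injective t, forall s, t s \in Pe &
    forall z, z \in x :: nb x ++ [seq flip y d | y <- nb x, d <- Po] -> hom mu z t].
  have [||||t [t1 t2 t3]] := HE n mu (x :: nb x ++ [seq flip y d | y <- nb x, d <- Po]) (take E1 Pe) (drop E1 Pe).
  - by rewrite cat_take_drop.
  - by rewrite /= ltnS size_cat size_allpairs sPo leq_add ?leq_mul2r ?nb4 ?orbT.
  - by rewrite size_takel // sPe leq_addr.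
  - by rewrite size_drop sPe addKn.
  - by exists t; split=> // s; have := t2 s; rewrite cat_take_drop.
have [te teP] := boolp.choice eex.
have oex y : exists t : 'I_N + 'I_N -> 'I_n, [/\ injective t, forall s, t s \in Po &
    forall z, z \in y :: [seq flip y d | x <- nb y, d <- [seq te x s | s <- enum {: 'I_N + 'I_N}]] -> hom mu z t].
  have [||||t [t1 t2 t3]] := HO n mu (y :: [seq flip y d | x <- nb y, d <- [seq te x s | s <- enum {: 'I_N + 'I_N}]]) (take O1 Po) (drop O1 Po).
  - by rewrite cat_take_drop.
  - rewrite /= ltnS size_allpairs_dep.
    apply: leq_trans (_ : 2 * N * size (nb y) <= _)%N; last by rewrite mulnC leq_mul2r nb4 orbT.
    elim: (nb y) => //= x s IH.
    by rewrite mulnS leq_add // size_map -cardE card_armT.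
  - by rewrite size_takel // sPo leq_addr.
  - by rewrite size_drop sPo addKn.
  - by exists t; split=> // s; have := t2 s; rewrite cat_take_drop.
have [to toP] := boolp.choice oex.
exists te, to; split.
- by move=> x; have [] := teP x; have [] := toP x.
- move=> x s; rewrite !mem_cat.
  have [_ h _] := teP x; have [_ h' _] := toP x.
  by rewrite h h' orbT.
- move=> x y s s'; have [_ h _] := teP x; have [_ h' _] := toP y.
  by apply/eqP => e; have := Peo _ (h' s'); rewrite -e h.
move=> x y yx xy.
have [_ te2 te3] := teP x; have [_ to2 to3] := toP y; split.
- by apply: te3; rewrite mem_head.
- by apply: te3; rewrite inE mem_cat yx orbT.
- move=> s; apply: te3; rewrite inE mem_cat; apply/orP; right; apply/orP; right.
  by apply/allpairsPdep; exists y, (to y s).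
- by apply: to3; rewrite mem_head.
- move=> s; apply: to3; rewrite inE; apply/orP; right.
  apply/allpairsPdep; exists x, (te x s); split=> //.
  by apply: map_f; rewrite mem_enum.
Qed.

End Ports.

(** * Renormalisation of the grid *)

Local Open Scope nat_scope.

(** A grid edge is coded as [(o, u, v)]: it leaves the cell [(u, v)] along the second coordinate if
    [o] is true, along the first otherwise. *)
Definition src (e : bool * nat * nat) : nat * nat := (e.1.2, e.2).
Definition tgt (e : bool * nat * nat) : nat * nat := (e.1.2 + ~~ e.1.1, e.2 + e.1.1).

Definition in_rect x0 y0 p q (c : nat * nat) :=
  [&& x0 <= c.1, c.1 < x0 + p, y0 <= c.2 & c.2 < y0 + q].

Definition edge_in x0 y0 p q e := in_rect x0 y0 p q (src e) && in_rect x0 y0 p q (tgt e).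

Definition touch (e e' : bool * nat * nat) :=
  [|| src e == src e', src e == tgt e', tgt e == src e' | tgt e == tgt e'].

Definition rect_edges x0 y0 p q : seq (bool * nat * nat) :=
  [seq e <- [seq (ou, v) | ou <- [seq (o, u) | o <- [:: false; true], u <- iota x0 p],
                           v <- iota y0 q] | edge_in x0 y0 p q e].

Lemma mem_rect_edges x0 y0 p q e : (e \in rect_edges x0 y0 p q) = edge_in x0 y0 p q e.
Proof.
rewrite mem_filter; case h : (edge_in _ _ _ _ _) => //=.
case: e h => -[o u] v /andP[/and4P[/= h1 h2 h3 h4] _].
apply/allpairsPdep; exists (o, u), v; split=> //; last by rewrite mem_iota h3.
have ui : u \in iota x0 p by rewrite mem_iota h1.
by case: o; rewrite !mem_cat ?(map_f (pair true) ui) ?(map_f (pair false) ui) ?orbT.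
Qed.

Lemma size_rect_edges x0 y0 p q : size (rect_edges x0 y0 p q) <= 2 * (p * q).
Proof.
rewrite size_filter; apply: leq_trans (count_size _ _) _.
by rewrite !size_allpairs !size_iota /= mulnA.
Qed.

(** [e'] avoids [src e] and [e''] avoids [tgt e], so three pairwise touching edges would form a
    triangle, and the grid is bipartite. *)
Lemma triangle_free e e' e'' : touch e e' -> touch e e'' -> touch e' e'' ->
  src e' != src e -> tgt e' != src e -> src e'' != tgt e -> tgt e'' != tgt e -> False.
Proof.
case: e => -[o u] v; case: e' => -[o' u'] v'; case: e'' => -[o'' u''] v''.
rewrite /touch /src /tgt /= !xpair_eqE.
by case: o; case: o'; case: o''; rewrite /= ?addn0 ?addn1; lia.
Qed.

Section Rect.
Context (L : eqType) (E : bool * nat * nat -> bool) (f : nat * nat -> L).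
Context (x0 y0 p q : nat).

(* Pairwise touching edges of a triangle-free graph share a vertex. *)
Lemma fail_vertex : (forall e e', edge_in x0 y0 p q e -> edge_in x0 y0 p q e' ->
    [|| touch e e', E e | E e']) ->
  exists v, forall e, edge_in x0 y0 p q e -> ~~ E e -> src e = v \/ tgt e = v.
Proof.
move=> good.
pose bad e := edge_in x0 y0 p q e && ~~ E e.
have bb e e' : bad e -> bad e' -> touch e e'.
  move=> /andP[i b] /andP[i' b']; have := good _ _ i i'.
  by rewrite (negbTE b) (negbTE b') !orbF.
case: (boolp.EM (exists e, bad e)) => [[e be]|nb]; last first.
  by exists (0, 0) => e i b; case: nb; exists e; rewrite /bad i.
have wit v : (exists e', bad e' /\ src e' != v /\ tgt e' != v) \/
    forall e', edge_in x0 y0 p q e' -> ~~ E e' -> src e' = v \/ tgt e' = v.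
  case: (boolp.EM (exists e', bad e' /\ src e' != v /\ tgt e' != v)) => [h|h]; first by left.
  right=> e' i b; case: (eqVneq (src e') v) => [|n1]; first by left.
  case: (eqVneq (tgt e') v) => [|n2]; first by right.
  by case: h; exists e'; rewrite /bad i.
case: (wit (src e)) => [[e' [be' [n1 n2]]]|]; last by exists (src e).
case: (wit (tgt e)) => [[e'' [be'' [m1 m2]]]|]; last by exists (tgt e).
by case: (@triangle_free e e' e''); rewrite ?bb.
Qed.

Lemma line_constant (T : eqType) (g : nat -> T) a l : 
  (forall i, a <= i -> i.+1 < a + l -> g i = g i.+1) ->
  forall i, a <= i < a + l -> g i = g a.
Proof.
move=> h i /andP[]; elim: i => [|i IH]; first by rewrite leqn0 => /eqP ->.
rewrite leq_eqVlt => /orP[/eqP -> //|]; rewrite ltnS => ai il.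
by rewrite -h // IH // ltnW.
Qed.

(** By [fail_vertex], rows and columns that miss one vertex [v] are free of failures. Every cell
    other than [v] lies on such a row or column, and as both sides exceed 1 there are a clean row
    and a clean column to tie them together. *)
Lemma rect_connected : 1 < p -> 1 < q ->
  (forall e e', edge_in x0 y0 p q e -> edge_in x0 y0 p q e' ->
    [|| touch e e', E e | E e']) ->
  (forall e, edge_in x0 y0 p q e -> E e -> f (src e) = f (tgt e)) ->
  exists m v, forall c, in_rect x0 y0 p q c -> c != v -> f c = m.
Proof.
move=> p1 q1 /fail_vertex[[a b] hv] inv.
have ok e : edge_in x0 y0 p q e -> src e != (a, b) -> tgt e != (a, b) -> f (src e) = f (tgt e).
  move=> i n1 n2; apply: inv => //; apply: contraT => /(hv e i).
  by case=> h; [rewrite h eqxx in n1 | rewrite h eqxx in n2].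
have row y : y0 <= y < y0 + q -> y != b -> forall x, x0 <= x < x0 + p -> f (x, y) = f (x0, y).
  move=> /andP[h1 h2] yb; apply: (@line_constant _ (fun x => f (x, y))) => i i1 i2.
  have := ok (false, i, y); rewrite /edge_in /in_rect /src /tgt /= !xpair_eqE (negbTE yb) addn0 !andbF addn1 => -> //.
    by rewrite h1 h2 i1 i2 (ltnW i2) (leq_trans i1).
  by rewrite (negbTE yb) andbF.
have col x : x0 <= x < x0 + p -> x != a -> forall y, y0 <= y < y0 + q -> f (x, y) = f (x, y0).
  move=> /andP[h1 h2] xa; apply: (@line_constant _ (fun y => f (x, y))) => i i1 i2.
  have := ok (true, x, i); rewrite /edge_in /in_rect /src /tgt /= !xpair_eqE (negbTE xa) addn0 /= addn1 => -> //; last by rewrite (negbTE xa).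
  by rewrite h1 h2 i1 i2 (ltnW i2) (leq_trans i1).
have pick2 z0 l z : 1 < l -> exists2 t, z0 <= t < z0 + l & t != z.
  move=> l1; case: (eqVneq z0 z) => [<-|h]; last by exists z0; rewrite // leqnn /=; lia.
  by exists z0.+1; lia.
have [c1 c1r c1a] := pick2 x0 p a p1; have [r1 r1r r1b] := pick2 y0 q b q1.
exists (f (c1, r1)), (a, b) => -[x y] /and4P[/= h1 h2 h3 h4].
have hx : x0 <= x < x0 + p by rewrite h1.
have hy : y0 <= y < y0 + q by rewrite h3.
rewrite xpair_eqE negb_and => /orP[xa|yb].
  by rewrite (col x hx xa y hy) -(col x hx xa r1 r1r) (row r1 r1r r1b x hx) (row r1 r1r r1b c1 c1r).
by rewrite (row y hy yb x hx) -(row y hy yb c1 c1r) (col c1 c1r c1a y hy) (col c1 c1r c1a r1 r1r).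
Qed.

End Rect.

Definition in_block k (c : nat * nat) (j : 'I_k * 'I_k) : nat * nat :=
  (k * c.1 + j.1, k * c.2 + j.2).

Lemma in_block_inj k c c' (j j' : 'I_k * 'I_k) : in_block c j = in_block c' j' -> c = c' /\ j = j'.
Proof.
case: c => u v; case: c' => u' v'; case: j => j1 j2; case: j' => j1' j2' [/= e1 e2].
have k0 : 0 < k by apply: leq_ltn_trans (ltn_ord j1).
have ee a b (i i' : 'I_k) : k * a + i = k * b + i' -> a = b /\ i = i'.
  move=> e; have ab : a = b.
    by have := congr1 (fun x => x %/ k) e; rewrite !(mulnC k) !divnMDl // !divn_small // !addn0.
  by split=> //; apply/val_inj; move: e; rewrite ab => /addnI.
by have [-> ->] := ee _ _ _ _ e1; have [-> ->] := ee _ _ _ _ e2.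
Qed.

(** The label of all but at most one cell of the block. A block without such a label gets [inr c],
    which it shares with no other block. *)
Definition block_val (L : eqType) k (f : nat * nat -> L) c : L + nat * nat :=
  if [pick i : 'I_k * 'I_k | k * k <= #|[set j : 'I_k * 'I_k | f (in_block c j) == f (in_block c i)]|.+1] is Some i
  then inl (f (in_block c i)) else inr c.

Section BlockVal.
Context (L : eqType) (k : nat) (f : nat * nat -> L).
Hypothesis k1 : 1 < k.

Lemma block_val_count c m : block_val k f c = inl m ->
  k * k <= #|[set j : 'I_k * 'I_k | f (in_block c j) == m]|.+1.
Proof. by rewrite /block_val; case: pickP => // i h [<-]. Qed.

(** Two different labels of this kind would occupy at least [2 (k^2 - 1) > k^2] cells, as
    [k > 1]. *)
Lemma block_valE c m : k * k <= #|[set j : 'I_k * 'I_k | f (in_block c j) == m]|.+1 ->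
  block_val k f c = inl m.
Proof.
move=> hm; have kk : 3 < k * k by rewrite (@leq_mul 2 2).
have [i im] : exists i, i \in [set j : 'I_k * 'I_k | f (in_block c j) == m].
  by apply/set0Pn; rewrite -card_gt0; move: hm kk; clear; lia.
have {}im : f (in_block c i) = m by apply/eqP; rewrite in_set in im.
rewrite /block_val; case: pickP => [i' hi'|/(_ i)]; last by rewrite im hm.
congr inl; apply/eqP; apply: contraT => mm'.
move: hm hi'; set A := [set _ | _] => hm; set B := [set _ | _] => hi'.
have : [disjoint A & B].
  rewrite -setI_eq0; apply/eqP/setP => s; rewrite !in_set.
  by apply/negbTE/negP => /andP[/eqP -> ]; rewrite eq_sym; apply/negP.
rewrite -leq_card_setU => /eqP h2.
have := max_card (mem (A :|: B)).
rewrite card_prod card_ord h2; move: hm hi' kk.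
by move: #|A| #|B| (k * k) => a b K; clear; lia.
Qed.

Lemma block_val_but_one c m v :
  (forall j : 'I_k * 'I_k, in_block c j != v -> f (in_block c j) = m) ->
  block_val k f c = inl m.
Proof.
move=> h; apply: block_valE.
set A := [set _ | _].
have : #|~: A| <= 1.
  apply/card_le1_eqP => j j'; rewrite !in_set.
  case: (eqVneq (in_block c j) v) => [e|/h ->]; last by rewrite eqxx.
  case: (eqVneq (in_block c j') v) => [e'|/h ->]; last by rewrite eqxx.
  by move=> _ _; have [] := @in_block_inj k c c j' j (etrans e' (esym e)).
by have := cardsC A; rewrite card_prod card_ord => <-; rewrite -[#|A|.+1]addn1 leq_add2l.
Qed.
End BlockVal.

Definition grid_count A B (P : pred (nat * nat)) := \sum_(u < A) \sum_(v < B) P (nat_of_ord u, nat_of_ord v).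

Lemma sum_blocks k A (F : nat -> nat) : \sum_(u < k * A) F u = \sum_(U < A) \sum_(i < k) F (k * U + i).
Proof.
elim: A => [|A IH]; first by rewrite muln0 !big_ord0.
rewrite big_ord_recr /= -IH mulnS addnC big_split_ord /=; congr (_ + _).
Qed.

Lemma grid_count_block k A B P :
  grid_count (k * A) (k * B) P =
  \sum_(U < A) \sum_(V < B) #|[set j : 'I_k * 'I_k | P (in_block (nat_of_ord U, nat_of_ord V) j)]|.
Proof.
rewrite /grid_count (sum_blocks k A (fun u => \sum_(v < k * B) P (u, nat_of_ord v))).
apply: eq_bigr => U _.
under eq_bigr => i _ do rewrite (sum_blocks k B (fun v => nat_of_bool (P (k * U + i, v)))).
rewrite exchange_big /=; apply: eq_bigr => V _.
rewrite pair_bigA /= -sum1_card [RHS]big_mkcond /=; apply: eq_bigr => -[i j] _.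
by rewrite in_set /in_block /=; case: (P _).
Qed.

Local Open Scope ring_scope.

Lemma block_cell k (x a b : nat) : (0 < k)%N -> (b <= 1)%N -> (k * a <= x)%N -> (x < k * a + (k + b * k))%N ->
  exists i : 'I_k, x = (k * a + i)%N \/ b = 1%N /\ x = (k * (a + b) + i)%N.
Proof.
move=> k0 b1 h1 h2; have [h3|h3] := ltnP x (k * a + k).
  have h : (x - k * a < k)%N by lia.
  by exists (Ordinal h); left => /=; lia.
have bE : b = 1%N by move: b1 h2 h3; case: b => [|[|b]] //; rewrite mul0n addn0; lia.
have h : (x - k * (a + b) < k)%N by move: h2 h3; rewrite bE mul1n mulnDr muln1; lia.
by exists (Ordinal h); right; split=> //=; move: h2 h3; rewrite bE mul1n mulnDr muln1; lia.
Qed.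

Lemma grid_countE A B (P : pred (nat * nat)) :
  grid_count A B P = #|[set c : 'I_A * 'I_B | P (nat_of_ord c.1, nat_of_ord c.2)]|.
Proof.
rewrite /grid_count pair_bigA -sum1_card [RHS]big_mkcond; apply: eq_bigr => c _.
by rewrite in_set; case: (P _).
Qed.

(** * Squaring the failure probability level by level *)

Section Hierarchy.
Context (R : realFieldType) (G : sgraph) (mu : bond_model R G).
Hypothesis ind : one_independent mu.
Local Notation W := {set {set G}}.
Implicit Types (rho : nat * nat -> {set G}) (E : bool * nat * nat -> W -> bool).

(** Touching edges may fail together, since nothing makes them independent; two vertex-disjoint
    failures have probability at most [eps^2]. *)
Definition good_rect E x0 y0 p q (w : W) : bool :=
  all (fun e => all (fun e' => [|| touch e e', E e w | E e' w]) (rect_edges x0 y0 p q))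
    (rect_edges x0 y0 p q).

Lemma good_rectP E x0 y0 p q w : reflect (forall e e', edge_in x0 y0 p q e ->
  edge_in x0 y0 p q e' -> [|| touch e e', E e w | E e' w]) (good_rect E x0 y0 p q w).
Proof.
apply: (iffP allP) => [h e e' he he'|h e].
  by have := h e; rewrite mem_rect_edges => /(_ he) /allP; apply; rewrite mem_rect_edges.
by rewrite mem_rect_edges => he; apply/allP => e'; rewrite mem_rect_edges; apply: h.
Qed.

Lemma dep_good_rect U E x0 y0 p q :
  (forall e, edge_in x0 y0 p q e -> dep U (E e)) -> dep U (good_rect E x0 y0 p q).
Proof.
move=> h w; apply: eq_in_all => e; rewrite mem_rect_edges => he.
apply: eq_in_all => e'; rewrite mem_rect_edges => he'.
by rewrite (h e he w) (h e' he' w).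
Qed.

(** Cells own disjoint vertex sets and an edge event lives on those of its two ends, so events of
    vertex-disjoint edges are independent. The same notion serves every level. *)
Definition system A B rho E (eps : R) :=
  (forall c c', in_rect 0 0 A B c -> in_rect 0 0 A B c' -> c != c' -> [disjoint rho c & rho c']) /\
  (forall e, edge_in 0 0 A B e ->
     dep (rho (src e) :|: rho (tgt e)) (E e) /\ prob mu (fun w => ~~ E e w) <= eps).

Lemma in_rect_sub A B x0 y0 p q c : (x0 + p <= A)%N -> (y0 + q <= B)%N ->
  in_rect x0 y0 p q c -> in_rect 0 0 A B c.
Proof.
rewrite /in_rect !add0n /= => hA hB /and4P[_ h1 _ h2].
by rewrite (leq_trans h1 hA) (leq_trans h2 hB).
Qed.

Lemma edge_in_sub A B x0 y0 p q e : (x0 + p <= A)%N -> (y0 + q <= B)%N ->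
  edge_in x0 y0 p q e -> edge_in 0 0 A B e.
Proof. by move=> hA hB /andP[h1 h2]; rewrite /edge_in !(in_rect_sub hA hB). Qed.

Lemma disjointU2 (T : finType) (A B C D : {set T}) :
  [disjoint A & C] -> [disjoint A & D] -> [disjoint B & C] -> [disjoint B & D] ->
  [disjoint A :|: B & C :|: D].
Proof.
rewrite -!setI_eq0 !setIUl !setIUr => /eqP-> /eqP-> /eqP-> /eqP->.
by rewrite !setU0.
Qed.

Lemma good_rect_fail A B rho E eps x0 y0 p q : system A B rho E eps -> 0 <= eps ->
  (x0 + p <= A)%N -> (y0 + q <= B)%N ->
  prob mu (fun w => ~~ good_rect E x0 y0 p q w) <= (2 * (p * q))%:R ^+ 2 * eps ^+ 2.
Proof.
move=> [dis sys] eps0 hA hB.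
set r := rect_edges x0 y0 p q.
have pair e e' : e \in r -> e' \in r ->
    prob mu (fun w => ~~ [|| touch e e', E e w | E e' w]) <= eps ^+ 2.
  rewrite !mem_rect_edges => he he'.
  have {}he := edge_in_sub hA hB he; have {}he' := edge_in_sub hA hB he'.
  have [d1 p1] := sys e he; have [d2 p2] := sys e' he'.
  case t : (touch e e') => /=.
    rewrite (eq_prob mu (B := pred0)) //.
    by rewrite /prob big_pred0 // exprn_ge0.
  rewrite (eq_prob mu (B := fun w => ~~ E e w && ~~ E e' w)); last by move=> w; rewrite negb_or.
  move: t; rewrite /touch => /negbT; rewrite !negb_or => /and4P[t1 t2 t3 t4].
  have [s1 s2] := andP he; have [s1' s2'] := andP he'.
  rewrite (@prob_indep _ _ mu ind _ _ _ _ (disjointU2 (dis _ _ s1 s1' t1) (dis _ _ s1 s2' t2)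
    (dis _ _ s2 s1' t3) (dis _ _ s2 s2' t4)) (dep1 negb d1) (dep1 negb d2)).
  by rewrite expr2 ler_pM // prob_ge0.
rewrite (eq_prob mu (B := fun w => has (fun e => has (fun e' => ~~ [|| touch e e', E e w | E e' w]) r) r)); last first.
  by move=> w; rewrite /good_rect -has_predC; apply: eq_in_has => e _ /=; rewrite -has_predC.
apply: le_trans (prob_has _ _ _) _.
have sr : (size r)%:R <= (2 * (p * q))%:R :> R by rewrite ler_nat size_rect_edges.
apply: (@le_trans _ _ (\sum_(e <- r) (size r)%:R * eps ^+ 2)).
  rewrite big_seq [leRHS]big_seq; apply: ler_sum => e er.
  apply: le_trans (prob_has _ _ _) _.
  apply: (@le_trans _ _ (\sum_(e' <- r) eps ^+ 2)).
    by rewrite big_seq [leRHS]big_seq; apply: ler_sum => e' er'; apply: pair.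
  by rewrite big_const_seq count_predT iter_addr_0 mulr_natl.
rewrite big_const_seq count_predT iter_addr_0 -[leLHS]mulr_natl mulrA.
by rewrite ler_wpM2r ?exprn_ge0 // expr2 ler_pM ?ler0n.
Qed.

Definition coarse_region k rho c : {set G} := \bigcup_(j : 'I_k * 'I_k) rho (in_block c j).

(** The rectangle is the union of the two blocks at the ends of [e]. *)
Definition coarse_event k E e : W -> bool :=
  good_rect E (k * e.1.2) (k * e.2) (k + ~~ e.1.1 * k) (k + e.1.1 * k).

Lemma coarse_cell k e c : (0 < k)%N ->
  in_rect (k * e.1.2) (k * e.2) (k + ~~ e.1.1 * k) (k + e.1.1 * k) c ->
  exists j : 'I_k * 'I_k, c = in_block (src e) j \/ c = in_block (tgt e) j.
Proof.
case: e => -[o u] v; case: c => x y k0 /and4P[/= h1 h2 h3 h4].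
have [i hi] := block_cell k0 (leq_b1 (~~ o)) h1 h2.
have [j hj] := block_cell k0 (leq_b1 o) h3 h4.
exists (i, j); rewrite /in_block /src /tgt /=.
case: o {h1 h2 h3 h4} hi hj => /= -[hi|[// _ hi]] [hj|[// _ hj]].
- by left; rewrite hi hj.
- by right; rewrite hi hj addn0.
- by left; rewrite hi hj.
- by right; rewrite hi hj addn0.
Qed.

Lemma in_block_rect k A B c (j : 'I_k * 'I_k) : in_rect 0 0 A B c ->
  in_rect 0 0 (k * A) (k * B) (in_block c j).
Proof.
case: c => u v; case: j => i j /and4P[_ /= h1 _ h2].
have bnd x y (l : 'I_k) : (x < y)%N -> (k * x + l < k * y)%N.
  move=> xy; apply: leq_trans (_ : k * x.+1 <= _)%N; last by rewrite leq_mul2l xy orbT.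
  by rewrite mulnS addnC ltn_add2r.
by rewrite /in_rect /= !add0n !bnd.
Qed.

Lemma coarse_rect k A B e : edge_in 0 0 A B e ->
  (k * e.1.2 + (k + ~~ e.1.1 * k) <= k * A)%N /\ (k * e.2 + (k + e.1.1 * k) <= k * B)%N.
Proof.
case: e => -[o u] v /andP[/and4P[_ /= h1 _ h2] /and4P[_ /= h3 _ h4]].
have bnd (x y : nat) (b : bool) : (x + b < y)%N -> (k * x + (k + b * k) <= k * y)%N.
  move=> xy; rewrite -mulSn [X in (_ + X)%N]mulnC -mulnDr leq_mul2l.
  by rewrite addnS xy orbT.
by split; apply: bnd.
Qed.

Lemma system_coarse k A B rho E eps : (0 < k)%N -> 0 <= eps ->
  system (k * A) (k * B) rho E eps ->
  system A B (coarse_region k rho) (coarse_event k E) ((2 * (2 * (k * k)))%:R ^+ 2 * eps ^+ 2).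
Proof.
move=> k0 eps0 sys; have [dis sysE] := sys; split.
  move=> c c' hc hc' cc'; rewrite -setI_eq0; apply/eqP/setP => x.
  rewrite in_set0 in_setI; apply/negbTE/negP => /andP[/bigcupP[j _ xj] /bigcupP[j' _ xj']].
  have jj' : in_block c j != in_block c' j'.
    by apply: contra cc' => /eqP /in_block_inj[-> _].
  have := dis _ _ (in_block_rect j hc) (in_block_rect j' hc') jj'.
  by move=> /disjointFr /(_ xj); rewrite xj'.
move=> e he; have [h1 h2] := coarse_rect k he; split.
  apply: dep_good_rect => e' he'.
  apply: dep_mono (sysE _ (edge_in_sub h1 h2 he')).1.
  have sub c : in_rect (k * e.1.2) (k * e.2) (k + ~~ e.1.1 * k) (k + e.1.1 * k) c ->
      rho c \subset coarse_region k rho (src e) :|: coarse_region k rho (tgt e).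
    move=> /(coarse_cell k0)[j [->|->]].
      exact: subset_trans (bigcup_sup j _) (subsetUl _ _).
    exact: subset_trans (bigcup_sup j _) (subsetUr _ _).
  have [s1 s2] := andP he'.
  by rewrite subUset !sub.
apply: le_trans (good_rect_fail sys eps0 h1 h2) _.
rewrite (_ : (_ + _) * _ = 2 * (k * k))%N //.
by case: (e.1.1); rewrite /= ?mul0n ?mul1n ?addn0; lia.
Qed.

(** On a good double block [f] is constant up to one cell, so this constant is the value of both
    blocks. *)
Lemma coarse_invariant (L : eqType) (f : nat * nat -> L) k A B E w : (1 < k)%N ->
  (forall e, edge_in 0 0 (k * A) (k * B) e -> E e w -> f (src e) = f (tgt e)) ->
  forall e, edge_in 0 0 A B e -> coarse_event k E e w ->
    block_val k f (src e) = block_val k f (tgt e).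
Proof.
move=> k1 inv e he /good_rectP good.
have [h1 h2] := coarse_rect k he.
have inv' e' (he' : edge_in (k * e.1.2) (k * e.2) (k + ~~ e.1.1 * k) (k + e.1.1 * k) e') :=
  inv e' (edge_in_sub h1 h2 he').
have [m [v hv]] := @rect_connected L (fun e => E e w) f _ _ _ _
   (leq_trans k1 (leq_addr _ _)) (leq_trans k1 (leq_addr _ _)) good inv'.
have st (j : 'I_k * 'I_k) :
   in_rect (k * e.1.2) (k * e.2) (k + ~~ e.1.1 * k) (k + e.1.1 * k) (in_block (src e) j) /\
   in_rect (k * e.1.2) (k * e.2) (k + ~~ e.1.1 * k) (k + e.1.1 * k) (in_block (tgt e) j).
  case: e {he good h1 h2 inv' hv} => -[o a] b; case: j => i j.
  rewrite /in_rect /in_block /src /tgt /=.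
  have := ltn_ord i; have := ltn_ord j; case: o; rewrite /= ?addn0 ?mul0n ?mul1n ?mulnDr ?muln1 => ? ?;
    by split; apply/and4P; split; lia.
rewrite (@block_val_but_one _ _ f k1 _ m v); last by move=> j; apply: hv; have [] := st j.
by rewrite (@block_val_but_one _ _ f k1 _ m v) // => j; apply: hv; have [] := st j.
Qed.

(* Blocks of level [j] have side [k = 2 ^ (j + 2)].  The failure probability
   [eps] of an edge becomes at most [16 * k ^ 4 * eps ^ 2], which takes
   [2 ^ - (6 * j + 20)] below [2 ^ - (6 * (j + 1) + 20)]. *)
Fixpoint side_len j J : nat := if J is J'.+1 then (2 ^ j.+2 * side_len j.+1 J')%N else 1%N.

(** Cells guaranteed to share the label: each level gives up one subblock of [k^2]. *)
Fixpoint core j J : nat :=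
  if J is J'.+1 then ((2 ^ j.+2 * 2 ^ j.+2).-1 * core j.+1 J')%N else 1%N.

Lemma side_lenS j J : side_len j J.+1 = (2 ^ j.+2 * side_len j.+1 J)%N.
Proof. by []. Qed.

Lemma coreS j J : core j J.+1 = ((2 ^ j.+2 * 2 ^ j.+2).-1 * core j.+1 J)%N.
Proof. by []. Qed.

Lemma core_gt0 j J : (0 < core j J)%N.
Proof.
elim: J j => //= J IH j; rewrite muln_gt0 IH andbT.
by rewrite -expnD -ltnS prednK ?expn_gt0 // -(expn0 2) ltn_exp2l.
Qed.

Local Notation lvl j := ((2^-1 : R) ^+ (6 * j + 20)).

Lemma level_step j : (2 * (2 * (2 ^ j.+2 * 2 ^ j.+2)))%:R ^+ 2 * lvl j ^+ 2 <= lvl j.+1.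
Proof.
have -> : (2 * (2 * (2 ^ j.+2 * 2 ^ j.+2)))%:R = 2 ^+ (j * 2 + 6) :> R.
  rewrite -natrX; congr (_%:R); rewrite -expnD -!expnS; congr (_ ^ _)%N; lia.
rewrite -!exprM.
have -> : ((6 * j + 20) * 2 = (j * 2 + 6) * 2 + (8 * j + 28))%N by lia.
rewrite exprD mulrA -exprMn mulfV ?pnatr_eq0 // expr1n mul1r.
apply: ler_wiXn2l; rewrite ?invr_ge0 ?ler0n // ?invf_le1 ?ler1n //; lia.
Qed.

(** [top] is fixed before [L] and [f], because the induction uses the next level for [block_val],
    whose labels lie in the larger type [L + nat * nat]. *)
Lemma hierarchy J : forall j rho E a b, (1 < a)%N -> (1 < b)%N ->
  system (side_len j J * a) (side_len j J * b) rho E (lvl j) ->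
  exists top : W -> bool,
   prob mu (fun w => ~~ top w) <= (2 * (a * b))%:R ^+ 2 * lvl (j + J) ^+ 2 /\
   forall w, top w -> forall (L : eqType) (f : nat * nat -> L),
     (forall e, edge_in 0 0 (side_len j J * a) (side_len j J * b) e -> E e w -> f (src e) = f (tgt e)) ->
     exists m, (core j J * (a * b).-1 <=
       grid_count (side_len j J * a) (side_len j J * b) (fun c => f c == m))%N.
Proof.
elim: J => [|J IH] j rho E a b a1 b1.
  rewrite /= !mul1n => sys; exists (good_rect E 0 0 a b); split.
    by rewrite addn0; apply: good_rect_fail sys _ _ _; rewrite ?exprn_ge0 ?invr_ge0 ?ler0n.
  move=> w /good_rectP good L f inv.
  have [m [v hv]] := @rect_connected L (fun e => E e w) f _ _ _ _ a1 b1 good inv.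
  exists m; rewrite grid_countE.
  set A := [set _ | _].
  have : (#|~: A| <= 1)%N.
    apply/card_le1_eqP => j1 j2; rewrite !in_set.
    have ok (c : 'I_a * 'I_b) : f (nat_of_ord c.1, nat_of_ord c.2) != m -> (nat_of_ord c.1, nat_of_ord c.2) = v.
      move=> h; apply/eqP; apply: contraNT h => /hv -> //.
      by rewrite /in_rect /= !add0n !ltn_ord.
    case: j1 => x y; case: j2 => x' y' /ok h1 /ok; rewrite -h1 => -[e1 e2].
    by congr (_, _); apply: val_inj.
  have := cardsC A; rewrite card_prod !card_ord => <-.
  by case: #|_| => [|[|//]] _; rewrite ?addn0 ?addn1 //= leq_pred.
rewrite side_lenS coreS; set k := (2 ^ j.+2)%N.
rewrite -(mulnA k _ a) -(mulnA k _ b) -(mulnA (k * k).-1) => sys.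
have k1 : (1 < k)%N by rewrite -(expn0 2) ltn_exp2l.
have l0 : 0 <= lvl j by rewrite exprn_ge0 ?invr_ge0 ?ler0n.
have sys' := system_coarse (ltnW k1) l0 sys.
have {}sys' : system (side_len j.+1 J * a) (side_len j.+1 J * b) (coarse_region k rho)
    (coarse_event k E) (lvl j.+1).
  case: sys' => d h; split=> // e he; have [h1 h2] := h e he; split=> //.
  exact: le_trans h2 (level_step j).
have [top [ptop htop]] := IH _ _ _ _ _ a1 b1 sys'.
exists top; rewrite -(addSnnS j J); split=> // w tw L f inv.
have inv' := coarse_invariant k1 inv.
have [m hm] := htop w tw _ _ inv'.
have big : (1 < core j.+1 J * (a * b).-1)%N.
  apply: leq_trans (_ : (a * b).-1 <= _)%N; last by rewrite leq_pmull // core_gt0.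
  have := leq_mul a1 b1; clear; lia.
(* A value [inr c] belongs to the single block [c], whereas more than one block takes the value
   found. *)
case: m hm => [m|c] hm; last first.
  exfalso; have : (grid_count (side_len j.+1 J * a) (side_len j.+1 J * b)
      (fun c' => block_val k f c' == inr c) <= 1)%N.
    rewrite grid_countE; apply/card_le1_eqP => -[x y] [x' y']; rewrite !in_set /block_val.
    case: pickP => // _ /eqP[h1]; case: pickP => // _ /eqP[]; rewrite -h1 => -[e1 e2].
    by congr (_, _); apply: val_inj.
  by move: hm big; lia.
exists m; rewrite grid_count_block.
apply: leq_trans (_ : (k * k).-1 * grid_count (side_len j.+1 J * a) (side_len j.+1 J * b)
      (fun c' => block_val k f c' == inl m) <= _)%N.
  by rewrite leq_mul2l hm orbT.
rewrite /grid_count big_distrr /=; apply: leq_sum => U _.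
rewrite big_distrr /=; apply: leq_sum => V _.
case: eqP => [|_]; last by rewrite muln0.
by move=> /(block_val_count) h; rewrite muln1 -ltnS prednK // muln_gt0 !(ltnW k1).
Qed.

End Hierarchy.

(** * The grid inside the hypercube *)

Local Open Scope nat_scope.

(** The reflected Gray code, [g u i] being bit [i] of the word of [u]: the second half runs
    backwards through the first with bit [M] set. *)
Lemma gray_code M : exists g : nat -> nat -> bool,
  [/\ forall u i, u < 2 ^ M -> M <= i -> g u i = false,
      forall u u', u < 2 ^ M -> u' < 2 ^ M -> (forall i, i < M -> g u i = g u' i) -> u = u' &
      forall u, u.+1 < 2 ^ M -> exists2 d, d < M & forall i, g u.+1 i = g u i (+) (i == d)].
Proof.
elim: M => [|M [g [g0 ginj gstep]]].
  exists (fun _ _ => false); rewrite expn0; split=> //; by move=> [|u] [|u'].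
have e2 : 2 ^ M.+1 = 2 ^ M + 2 ^ M by rewrite expnS mul2n addnn.
have p2 : 0 < 2 ^ M by rewrite expn_gt0.
move: (2 ^ M.+1) (2 ^ M) e2 p2 g0 ginj gstep => D D' -> {D} p2 g0 ginj gstep.
exists (fun u i => if u < D' then g u i else (i == M) || g (D' + D' - u.+1) i); split.
- move=> u i uD Mi; case: ltnP => h; first by rewrite g0 // ltnW.
  by rewrite gtn_eqF //= g0 ?(ltnW Mi) //; lia.
- move=> u u' uD uD' h.
  have gM v : v < D' -> g v M = false by move=> vD; apply: g0.
  have hM := h M (ltnSn M); move: hM; rewrite eqxx.
  have [uD1|uD1] := ltnP u D'; have [uD2|uD2] := ltnP u' D' => //=; rewrite ?gM //.
    move=> _; apply: ginj => // i iM; have := h i (ltnW iM); by rewrite uD1 uD2.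
  move=> _; suff : D' + D' - u.+1 = D' + D' - u'.+1 by lia.
  apply: ginj; try lia; move=> i iM; have := h i (ltnW iM).
  by rewrite ltnNge uD1 /= ltnNge uD2 /= ltn_eqF.
move=> u uD; have [h1|h1] := ltnP u.+1 D'.
  have [d dM hd] := gstep u h1; exists d; first exact: ltnW.
  by move=> i; rewrite (ltnW h1) hd.
have [h2|h2] := ltnP u D'.
  exists M => // i; have -> : D' + D' - u.+2 = u by lia.
  by case: eqVneq => [->|_]; rewrite ?(g0 u M h2) ?addbF.
have [d dM hd] := gstep (D' + D' - u.+2) ltac:(lia).
exists d; first exact: ltnW.
move=> i; have -> : D' + D' - u.+1 = (D' + D' - u.+2).+1 by lia.
rewrite hd; case: (eqVneq i M) => [->|_] /=; last by rewrite -addbA addbb addbF.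
by rewrite gtn_eqF.
Qed.

Fixpoint side_exp j J := if J is J'.+1 then j.+2 + side_exp j.+1 J' else 0.

Lemma side_lenE j J : side_len j J = 2 ^ side_exp j J.
Proof. by elim: J j => // J IH j; rewrite side_lenS IH -expnD. Qed.

Lemma side_exp_recr j J : side_exp j J.+1 = side_exp j J + (j + J).+2.
Proof.
elim: J j => [|J IH] j; first by rewrite /= !addn0.
have e l K : side_exp l K.+1 = l.+2 + side_exp l.+1 K by [].
by rewrite (e j J.+1) IH (e j J); lia.
Qed.

(** Passing from [J] to [J + 1] levels adds [J + 2] to the exponent, so the remainder [r] need not
    exceed [J + 1]; the top rectangle is then small against the failure probability. Writing [r.+1]
    keeps its side above 1. *)
Lemma split_exponent J0 M : side_exp 0 J0 < M ->
  exists J r, [/\ J0 <= J, r <= J.+1 & M = side_exp 0 J + r.+1].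
Proof.
elim: M => // M IH; rewrite ltnS leq_eqVlt => /orP[/eqP <-|/IH[J [r [h1 h2 ->]]]].
  by exists J0, 0; rewrite addn1.
move: h2; rewrite leq_eqVlt => /orP[/eqP ->|h2].
  exists J.+1, 0; split=> //; [exact: leqW | rewrite side_exp_recr; lia].
by exists J, r.+1; rewrite -addnS.
Qed.

(** The fraction of cells kept is at least [1 - 2 / q] with [q = 4^(j + 2)]; the induction step is
    [(1 - 1 / q) * (1 - 2 / (4 * q)) >= 1 - 2 / q]. *)
Lemma core_lower j J : (2 ^ j.+2 * 2 ^ j.+2 - 2) * (side_len j J * side_len j J) <=
  (2 ^ j.+2 * 2 ^ j.+2) * core j J.
Proof.
elim: J j => [|J IH] j; first by rewrite /= !muln1 leq_subr.
rewrite side_lenS coreS; have := IH j.+1.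
have -> : 2 ^ j.+3 * 2 ^ j.+3 = 4 * (2 ^ j.+2 * 2 ^ j.+2) by rewrite (expnS 2 j.+2) mulnACA.
have : 1 < 2 ^ j.+2 * 2 ^ j.+2 by rewrite -expnD -(expn0 2) ltn_exp2l.
rewrite mulnACA; move: (2 ^ j.+2 * 2 ^ j.+2) (side_len j.+1 J * side_len j.+1 J) (core j.+1 J) => q S C q1 h.
rewrite mulnCA leq_mul2l; apply/orP; right.
rewrite -(@leq_pmul2l (4 * q)); last by rewrite muln_gt0 (ltnW q1).
have h2 : q.-1 * ((4 * q - 2) * S) <= q.-1 * (4 * q * C) by rewrite leq_mul2l h orbT.
rewrite [X in _ <= X]mulnCA; apply: leq_trans h2.
rewrite !mulnA leq_mul2r; apply/orP; right.
case: q q1 {h} => [|[|r]] // _; rewrite /= (_ : r.+2 - 2 = r); last by lia.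
by rewrite (_ : 4 * r.+2 - 2 = 4 * r + 6); last lia; clear; nia.
Qed.

Lemma core_half J : side_len 0 J * side_len 0 J <= 2 * core 0 J.
Proof. by have := core_lower 0 J; rewrite (_ : 2 ^ 2 * 2 ^ 2 = 16) //; lia. Qed.

Local Open Scope ring_scope.

Lemma joinedC n (U : {set hypercube n}) w N (z z' : {ffun 'I_n -> bool}) (t t' : 'I_N + 'I_N -> 'I_n) :
  joined U w z t z' t' = joined U w z' t' z t.
Proof. by apply: eq_existsb => m; rewrite andbC. Qed.

(** Two adjacent cells form again a subcube, to which [joined_fail] applies. *)
Lemma fibreU1 n (K : {set 'I_n}) x d : fibre (d |: K) x = fibre K x :|: fibre K (flip x d).
Proof.
apply/setP => v; rewrite in_setU !in_set; apply/forallP/orP => [h|h c].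
  case: (eqVneq (v d) (x d)) => vd; [left|right]; apply/forallP => c; have := h c.
    by rewrite !inE; case: eqVneq => [->|_] //=; rewrite vd eqxx orbT.
  rewrite !inE flipE; case: eqVneq => [->|_] /=; last by rewrite addbF.
  by move=> _; move: vd; case: (v d); case: (x d); rewrite ?orbT.
rewrite !inE; case: eqVneq => //= cd; case: h => /forallP /(_ c) //.
by rewrite flipE (negbTE cd) addbF.
Qed.

(** At 0 the predecessor returns the cell itself, and cells beyond the grid may occur; a superset of
    the neighbours is enough. *)
Definition grid_nbrs (c : nat * nat) : seq (nat * nat) :=
  [:: (c.1.+1, c.2); (c.1.-1, c.2); (c.1, c.2.+1); (c.1, c.2.-1)].

Lemma edge_nbrs e : tgt e \in grid_nbrs (src e) /\ src e \in grid_nbrs (tgt e).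
Proof.
case: e => -[[] u] v; rewrite /grid_nbrs /src /tgt /= !inE ?addn0 ?addn1 /= !eqxx ?orbT //=.
Qed.

(** * Cells, their links and the giant component *)

Section Assembly.
Context (R : realFieldType) (n : nat) (mu : bond_model R (hypercube n)) (p kap : R).
Hypothesis ind : one_independent mu.
Hypothesis hp : open_with_prob_ge p mu.
Local Notation V := {ffun 'I_n -> bool}.
Local Notation W := {set {set hypercube n}}.
Context (N Q : nat).
Hypothesis N0 : (0 < N)%N.
Hypothesis kap0 : 0 < kap.
Hypothesis kap1 : kap <= 1 / 400.
Hypothesis p0 : 5847 / 10000 <= p.
Context (A B : nat) (P : seq 'I_n) (beta : nat * nat -> V).
Hypothesis beta_res : forall c i, i \in P -> beta c i = false.
Hypothesis beta_inj : forall c c', in_rect 0 0 A B c -> in_rect 0 0 A B c' ->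
  beta c = beta c' -> c = c'.
Hypothesis beta_step : forall e, edge_in 0 0 A B e ->
  exists2 d, d \notin P & beta (tgt e) = flip (beta (src e)) d.

(** Ports are assigned to vertices of the cube, hence [x] is decoded to its cell. *)
Definition nb (x : V) : seq V :=
  if [pick c : 'I_A * 'I_B | beta (nat_of_ord c.1, nat_of_ord c.2) == x] is Some c
  then [seq beta c' | c' <- grid_nbrs (nat_of_ord c.1, nat_of_ord c.2)] else [::].

Lemma size_nb x : (size (nb x) <= 4)%N.
Proof. by rewrite /nb; case: pickP. Qed.

Lemma nb_nbrs c c' : in_rect 0 0 A B c -> c' \in grid_nbrs c -> beta c' \in nb (beta c).
Proof.
case: c => u v hc nc; have /and4P[_ /= uA _ vB] := hc.
rewrite /nb; case: pickP => [[i j] /= /eqP h|/(_ (Ordinal uA, Ordinal vB)) /=]; last by rewrite eqxx.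
have [-> ->] : (nat_of_ord i, nat_of_ord j) = (u, v); last exact: (map_f beta nc).
by apply: beta_inj => //; rewrite /in_rect /= !add0n !ltn_ord.
Qed.

Context (te to : V -> 'I_N + 'I_N -> 'I_n).
Local Notation hom z t := (homog2 mu Q%:R^-1 z (fun i => t (inl i)) (fun k => t (inr k))).
Hypothesis port_inj : forall x, injective (te x) /\ injective (to x).
Hypothesis port_res : forall x s, te x s \in P /\ to x s \in P.
Hypothesis port_disj : forall x y s s', te x s != to y s'.
Hypothesis port_hom : forall x y, y \in nb x -> x \in nb y ->
  [/\ hom x (te x), hom y (te x), forall s, hom (flip y (to y s)) (te x),
      hom y (to y) & forall s, hom (flip y (te x s)) (to y)].

Let K := [set i in P].

Definition cell c : {set hypercube n} := fibre K (beta c).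

(** The chessboard colouring: adjacent cells use families from different reserves. *)
Definition port (c : nat * nat) := if odd (c.1 + c.2) then to (beta c) else te (beta c).

Definition cell_link e (w : W) : bool :=
  joined (cell (src e) :|: cell (tgt e)) w (beta (src e)) (port (src e)) (beta (tgt e)) (port (tgt e)).

Lemma odd_tgt e : odd ((tgt e).1 + (tgt e).2) = ~~ odd ((src e).1 + (src e).2).
Proof.
case: e => -[o u] v; rewrite /src /tgt /= addnACA oddD.
by case: o; rewrite /= ?addbT.
Qed.

Lemma cell_system : system mu A B cell cell_link
  (21 * step_bound N (Q%:R^-1) (kap ^+ 3 / 4)).
Proof.
have Q1 : 0 <= Q%:R^-1 :> R by rewrite invr_ge0 ler0n.
split.
  move=> c c' hc hc' cc'; rewrite -setI_eq0; apply/eqP/setP => x.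
  rewrite in_set0 in_setI !in_set; apply/negbTE/negP => /andP[/forallP h /forallP h'].
  move/eqP: cc'; apply; apply: beta_inj => //; apply/ffunP => i.
  have [iP|iP] := boolP (i \in P); first by rewrite !beta_res.
  have := h i; have := h' i; rewrite !in_set (negbTE iP) /= => /eqP <- /eqP <-.
  by [].
move=> e he; split; first exact: dep_joined.
have [s1 s2] := andP he; have [n1 n2] := edge_nbrs e.
have nb1 := nb_nbrs s1 n1; have nb2 := nb_nbrs s2 n2.
have [d dP bd] := beta_step he.
(* [x] plays the even cell: the step along [d] uses [te x], and at [y] the family changes to [to y].
   An odd source is reduced to this by symmetry. *)
have gen x y : y \in nb x -> x \in nb y -> y = flip x d ->
    prob mu (fun w => ~~ joined (fibre K x :|: fibre K y) w x (te x) y (to y)) <=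
    21 * step_bound N (Q%:R^-1) (kap ^+ 3 / 4).
  move=> yx xy yE; have [h1 h2 h3 h4 h5] := port_hom yx xy.
  rewrite yE in h2 h3 h4 h5 *; rewrite -fibreU1.
  have teK z s : te z s \in d |: K by rewrite !inE (port_res z s).1 orbT.
  have toK z s : to z s \in d |: K by rewrite !inE (port_res z s).2 orbT.
  apply: (joined_fail ind hp N0 kap0 kap1 p0 Q1) => //.
  - exact: (port_inj _).1.
  - exact: (port_inj _).2.
  - exact: fibre_self.
  - by rewrite !inE eqxx.
  - by move=> s; apply: contraNneq dP => <-; exact: (port_res _ _).1.
rewrite /cell_link /port odd_tgt; case: (odd _) => /=; last exact: gen.
rewrite (eq_prob mu (B := fun w => ~~ joined (cell (tgt e) :|: cell (src e)) w
   (beta (tgt e)) (te (beta (tgt e))) (beta (src e)) (to (beta (src e))))).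
  by apply: gen => //; rewrite bd flipK.
by move=> w; rewrite joinedC setUC.
Qed.

(* Cells without a main component get a label of their own. *)
Definition cell_label w c : {set hypercube n} + nat * nat :=
  if [pick m | main [set: hypercube n] w (beta c) (port c) m] is Some m then inl m else inr c.

Lemma cell_labelE w c m : main [set: hypercube n] w (beta c) (port c) m -> cell_label w c = inl m.
Proof.
move=> h; rewrite /cell_label; case: pickP => [m' h'|/(_ m)]; last by rewrite h.
by rewrite (main_unique h h').
Qed.

(** A component inside the two cells extends to one of the whole graph, named by any of its arms; it
    contains the majority of arms at both bases. *)
Lemma cell_label_link e w : cell_link e w -> cell_label w (src e) = cell_label w (tgt e).
Proof.
move=> /existsP[m /andP[m1 m2]].
set U := _ :|: _ in m1 m2.
have [s sm] : exists s, s \in arms U w (beta (src e)) (port (src e)) m.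
  by apply/set0Pn; rewrite -card_gt0; move: m1; rewrite /main; case: #|_|.
rewrite in_set in sm; move/eqP: sm => sm.
have up z t : main U w z t m ->
    main [set: hypercube n] w z t (lab [set: hypercube n] w (flip (beta (src e)) (port (src e) s))).
  rewrite /main => h; apply: leq_trans h _; rewrite leq_mul2l; apply/orP; right.
  apply: subset_leq_card; apply/subsetP => s'; rewrite !in_set => /eqP s'm.
  by apply/eqP; apply: (lab_mono (U := U)); rewrite ?subsetT // s'm sm.
by rewrite (cell_labelE (up _ _ _ m1)) (cell_labelE (up _ _ _ m2)).
Qed.

(** Every cell labelled [inl m] contains a vertex of the component [m], and cells are disjoint. A
    label [inr c] occurs once, which the hypothesis on the count excludes. *)
Lemma component_count w m : (1 < grid_count A B (fun c => cell_label w c == m))%N ->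
  exists x : hypercube n, (grid_count A B (fun c => cell_label w c == m) <= #|component w x|)%N.
Proof.
move=> h; set X := [set c : 'I_A * 'I_B | cell_label w (nat_of_ord c.1, nat_of_ord c.2) == m].
have gE : grid_count A B (fun c => cell_label w c == m) = #|X| by rewrite grid_countE.
rewrite gE in h *.
have inR (c : 'I_A * 'I_B) : in_rect 0 0 A B (nat_of_ord c.1, nat_of_ord c.2).
  by rewrite /in_rect /= !add0n !ltn_ord.
have XP c : (c \in X) = (cell_label w (nat_of_ord c.1, nat_of_ord c.2) == m) by rewrite in_set.
case: m X XP gE h => [m|c0] X XP gE h; last first.
  exfalso; move: h; apply/negP; rewrite -leqNgt.
  apply/card_le1_eqP => -[x y] [x' y']; rewrite !XP /cell_label.
  case: pickP => // _ /eqP[h1]; case: pickP => // _ /eqP[]; rewrite -h1 => -[e1 e2].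
  by congr (_, _); apply: val_inj.
have wit (c : 'I_A * 'I_B) : c \in X -> exists x, x \in m :&: cell (nat_of_ord c.1, nat_of_ord c.2).
  rewrite XP /cell_label; set c' := (_, _); case: pickP => // m' hm' /eqP[<-].
  have [s sm] : exists s, s \in arms [set: hypercube n] w (beta c') (port c') m'.
    by apply/set0Pn; rewrite -card_gt0; move: hm'; rewrite /main; case: #|_|.
  exists (flip (beta c') (port c' s)); rewrite in_setI; apply/andP; split.
    by move: sm; rewrite in_set => /eqP <-; rewrite in_set connect0.
  apply: fibre_flip; first exact: fibre_self.
  by rewrite in_set /port; case: ifP => _; [exact: (port_res _ _).2|exact: (port_res _ _).1].
have [c0 c0X] : exists c, c \in X by apply/set0Pn; rewrite -card_gt0 ltnW.
have [x0 hx0] := wit _ c0X.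
have mE : m = lab [set: hypercube n] w x0.
  have : x0 \in m by move: hx0; rewrite in_setI => /andP[].
  move: c0X; rewrite XP /cell_label; case: pickP => // m' hm' /eqP[<-].
  have [s sm] : exists s, s \in arms [set: hypercube n] w (beta (nat_of_ord c0.1, nat_of_ord c0.2)) (port (nat_of_ord c0.1, nat_of_ord c0.2)) m'.
    by apply/set0Pn; rewrite -card_gt0; move: hm'; rewrite /main; case: #|_|.
  by move: sm; rewrite in_set => /eqP <-; rewrite in_set => /labP.
exists x0; apply: leq_trans (_ : #|m| <= _)%N; last first.
  apply: subset_leq_card; apply/subsetP => y; rewrite mE !in_set.
  apply: connect_sub => u v uv; apply: connect1.
  by move: uv; rewrite /link_rel in_setI => /andP[].
pose g (c : 'I_A * 'I_B) : hypercube n := odflt x0 [pick x in m :&: cell (nat_of_ord c.1, nat_of_ord c.2)].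
have gP c : c \in X -> g c \in m :&: cell (nat_of_ord c.1, nat_of_ord c.2).
  by move=> /wit[x hx]; rewrite /g; case: pickP => [//|/(_ x)]; rewrite hx.
rewrite -(card_in_imset (f := g) (D := X)).
  apply: subset_leq_card; apply/subsetP => _ /imsetP[c /gP + ->].
  by rewrite in_setI => /andP[].
move=> c c' cX c'X gg; apply/eqP; apply: contraT => cc'.
have ne : (nat_of_ord c.1, nat_of_ord c.2) != (nat_of_ord c'.1, nat_of_ord c'.2).
  apply: contra cc'; case: c {cX gg} => x y; case: c' {c'X} => x' y' /= /eqP[e1 e2].
  by apply/eqP; congr (_, _); apply: val_inj.
have := cell_system.1 _ _ (inR c) (inR c') ne.
have := gP _ cX; have := gP _ c'X; rewrite -gg !in_setI => /andP[_ h2] /andP[_ h1].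
by move=> /disjointFr /(_ h1); rewrite h2.
Qed.

Lemma component_prob J a b (s : R) : (1 < a)%N -> (1 < b)%N ->
  A = (side_len 0 J * a)%N -> B = (side_len 0 J * b)%N ->
  21 * step_bound N (Q%:R^-1) (kap ^+ 3 / 4) <= (2^-1 : R) ^+ 20 ->
  s <= (core 0 J * (a * b).-1)%:R ->
  prob mu (fun w => ~~ has_component_ge s w) <=
    (2 * (a * b))%:R ^+ 2 * ((2^-1 : R) ^+ (6 * J + 20)) ^+ 2.
Proof.
move=> a1 b1 AE BE small hs.
have sys : system mu (side_len 0 J * a) (side_len 0 J * b) cell cell_link ((2^-1 : R) ^+ (6 * 0 + 20)).
  rewrite -AE -BE muln0 add0n; case: cell_system => d h; split; first exact: d.
  by move=> e /h[h1 h2]; split; [exact: h1 | apply: le_trans h2 small].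
have [top [ptop htop]] := hierarchy ind a1 b1 sys.
apply: le_trans ptop; apply: le_prob => w; apply: contra => tw.
have [m hm] := htop w tw _ (cell_label w) (fun e _ => @cell_label_link e w).
rewrite -AE -BE in hm.
have big : (1 < core 0 J * (a * b).-1)%N.
  apply: leq_trans (_ : (a * b).-1 <= _)%N; last by rewrite leq_pmull // core_gt0.
  have := leq_mul a1 b1; clear; lia.
have [x hx] := component_count (leq_trans big hm).
apply/existsP; exists x; apply: le_trans hs _.
by rewrite ler_nat; apply: leq_trans hm hx.
Qed.

End Assembly.

(** The first [K] coordinates are the resource and vanish at the bases; the others carry one Gray
    code for each axis of the grid. *)
Lemma grid_embedding K M1 M2 (P := [seq lshift (M1 + M2) i | i <- enum 'I_K]) :
  exists beta : nat * nat -> {ffun 'I_(K + (M1 + M2)) -> bool},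
  [/\ forall c i, i \in P -> beta c i = false,
      forall c c', in_rect 0 0 (2 ^ M1) (2 ^ M2) c -> in_rect 0 0 (2 ^ M1) (2 ^ M2) c' ->
        beta c = beta c' -> c = c' &
      forall e, edge_in 0 0 (2 ^ M1) (2 ^ M2) e ->
        exists2 d, d \notin P & beta (tgt e) = flip (beta (src e)) d].
Proof.
have [g1 [_ inj1 step1]] := gray_code M1; have [g2 [_ inj2 step2]] := gray_code M2.
have inP (i : 'I_(K + (M1 + M2))) : i \in P -> (i < K)%N.
  by move=> /mapP[j _ ->]; rewrite /= ltn_ord.
exists (fun c => [ffun i : 'I_(K + (M1 + M2)) => if (i < K)%N then false else
   if (i < K + M1)%N then g1 c.1 (i - K)%N else g2 c.2 (i - (K + M1))%N]); split.
- by move=> c i /inP iK; rewrite ffunE iK.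
- move=> [u v] [u' v'] /and4P[_ /= h1 _ h2] /and4P[_ /= h3 _ h4] /ffunP e.
  congr (_, _).
    apply: inj1 => // j jM.
    have jl : (K + j < K + (M1 + M2))%N by lia.
    have := e (Ordinal jl); rewrite !ffunE /= ltnNge leq_addr /= ltn_add2l jM.
    by rewrite addKn.
  apply: inj2 => // j jM.
  have jl : (K + M1 + j < K + (M1 + M2))%N by lia.
  have := e (Ordinal jl); rewrite !ffunE /= addKn.
  have f1 : (K + M1 + j < K)%N = false by apply/negbTE; rewrite -leqNgt -addnA leq_addr.
  have f2 : (K + M1 + j < K + M1)%N = false by apply/negbTE; rewrite -leqNgt leq_addr.
  by rewrite f1 f2.
move=> [[o u] v] /andP[/and4P[_ /= h1 _ h2] /and4P[_ /= h3 _ h4]].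
case: o h3 h4 => /= h3 h4.
  have [d dM hd] := step2 v ltac:(lia).
  have dl : (K + M1 + d < K + (M1 + M2))%N by lia.
  exists (Ordinal dl); first by apply/negP => /inP /=; lia.
  apply/ffunP => i; rewrite flipE !ffunE /tgt /src /= addn0 addn1 -val_eqE /=.
  case: ltnP => iK; first by rewrite (_ : (i == _ :> nat) = false) //; lia.
  case: ltnP => iM; first by rewrite (_ : (i == _ :> nat) = false) ?addbF //; lia.
  by rewrite hd; congr (_ (+) _); lia.
have [d dM hd] := step1 u ltac:(lia).
have dl : (K + d < K + (M1 + M2))%N by lia.
exists (Ordinal dl); first by apply/negP => /inP /=; lia.
apply/ffunP => i; rewrite flipE !ffunE /tgt /src /= addn0 addn1 -val_eqE /=.
case: ltnP => iK; first by rewrite (_ : (i == _ :> nat) = false) //; lia.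
case: ltnP => iM; last by rewrite (_ : (i == _ :> nat) = false) ?addbF //; lia.
by rewrite hd; congr (_ (+) _); lia.
Qed.

(** * Choice of the constants *)

Lemma small_step (R : archiRealFieldType) (eta c : R) : 0 < eta -> 0 < c ->
  exists2 N, (0 < N)%N & 21 * step_bound N (N%:R^-1) eta <= c.
Proof.
(* With [eps = 1 / N], [fail_bound] equals [(2 + 4 + 3) / (N * eta^4)], so [21 * step_bound] is
   [X / N]. *)
move=> eta0 c0; pose X := 21 * (63 / eta ^+ 4 + 6 / eta ^+ 2).
have X0 : 0 < X by rewrite mulr_gt0 ?addr_gt0 ?divr_gt0 ?exprn_gt0.
exists (Num.bound (X / c)).
  by rewrite lt0n; apply/negP => /eqP e; have := archi_boundP (ltW (divr_gt0 X0 c0)); rewrite e ltNge (ltW (divr_gt0 X0 c0)).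
have := archi_boundP (ltW (divr_gt0 X0 c0)); move: (Num.bound _) => N hN.
have N0 : 0 < N%:R :> R by apply: lt_trans hN; apply: divr_gt0.
rewrite (_ : 21 * _ = X / N%:R).
  by rewrite ler_pdivrMr // mulrC -ler_pdivrMr // ltW.
by rewrite /step_bound /fail_bound /X; field; rewrite !gt_eqF.
Qed.

Lemma half_power (R : archiRealFieldType) (eps : R) : 0 < eps -> exists J, 2^-1 ^+ J <= eps.
Proof.
move=> e0; exists (Num.bound eps^-1).
have := archi_boundP (ltW (_ : 0 < eps^-1)); rewrite invr_gt0 => /(_ e0).
move: (Num.bound _) => N hN; rewrite exprVn -[leRHS]invrK lef_pV2 ?posrE ?invr_gt0 ?exprn_gt0 //.
by apply: ltW; apply: lt_le_trans hN _; rewrite -natrX ler_nat ltnW // ltn_expl.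
Qed.

Lemma half_bound (R : realFieldType) (J J0 r r2 : nat) : (J0 <= J)%N -> (r <= J.+1)%N -> (r2 <= J.+2)%N ->
  (2 * (2 ^ r.+1 * 2 ^ r2.+1))%:R ^+ 2 * ((2^-1 : R) ^+ (6 * J + 20)) ^+ 2 <= 2^-1 ^+ J0.
Proof.
move=> JJ rJ r2J.
have -> : (2 * (2 ^ r.+1 * 2 ^ r2.+1))%:R = 2 ^+ (r + r2 + 3) :> R.
  by rewrite -natrX; congr (_%:R); rewrite -expnD -!expnS; congr (_ ^ _)%N; lia.
rewrite -!exprM.
have -> : ((6 * J + 20) * 2 = (r + r2 + 3) * 2 + ((6 * J + 20) * 2 - (r + r2 + 3) * 2))%N by lia.
rewrite [2^-1 ^+ (_ + _)]exprD mulrA -exprMn mulfV ?pnatr_eq0 // expr1n mul1r.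
apply: ler_wiXn2l; rewrite ?invr_ge0 ?ler0n // ?invf_le1 ?ler1n //; lia.
Qed.

Lemma giant_whp (R : archiRealFieldType) : exists2 C : R, 0 < C &
  forall eps : R, 0 < eps -> exists n0, forall n, (n0 <= n)%N ->
  forall mu : bond_model R (hypercube n), one_independent mu ->
  open_with_prob_ge (5847 / 10000) mu -> 1 - eps <= prob mu (has_component_ge (C * 2 ^+ n)).
Proof.
pose kap : R := 1 / 400.
have kap0 : 0 < kap by rewrite divr_gt0 ?ltr0n.
have [N N0 small] := @small_step R (kap ^+ 3 / 4) (2^-1 ^+ 20)
   ltac:(by rewrite divr_gt0 ?exprn_gt0) ltac:(by rewrite exprn_gt0 ?invr_gt0).
have [K HK] := ports_assign R N0 N.
(* A cell has [2^K] vertices and contributes one of them. One factor 2 is lost in [core_half],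
   another in [(a * b).-1 >= a * b / 2]. *)
exists ((4 * 2 ^+ K)^-1); first by rewrite invr_gt0 mulr_gt0 ?exprn_gt0.
move=> eps eps0; have [J0 hJ0] := half_power eps0.
exists (K + (2 * (side_exp 0 J0).+1))%N => n hn.
have [M1 [M2 [od [nE hM1 hM2 hod]]]] : exists M1 M2 od,
    [/\ n = (K + (M1 + M2))%N, (side_exp 0 J0 < M1)%N, M2 = (M1 + od)%N & (od <= 1)%N].
  (* The sides of the grid differ at most by a factor 2, so the same number [J] of levels fits
     both. *)
  exists (n - K)./2, ((n - K)./2 + odd (n - K))%N, (odd (n - K)).
  split=> //; last by case: odd.
    have := odd_double_half (n - K); rewrite -addnn; lia.
  by rewrite -(leq_pmul2l (isT : 0 < 2)%N) mul2n; have := odd_double_half (n - K); case: odd; lia.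
have [J [r [JJ rJ M1E]]] := split_exponent hM1.
have M2E : M2 = (side_exp 0 J + (r + od).+1)%N by rewrite hM2 M1E; lia.
subst n => mu ind hp.
have [beta [b1 b2 b3]] := grid_embedding K M1 M2.
set P := [seq _ | _ <- _] in b1 b2 b3.
have uP : uniq P by rewrite map_inj_uniq ?enum_uniq //; apply: lshift_inj.
have sP : size P = K by rewrite size_map size_enum_ord.
have [te [to [t1 t2 t3 t4]]] := HK _ mu P _ uP sP (size_nb (2 ^ M1) (2 ^ M2) beta).
pose a := (2 ^ r.+1)%N; pose b := (2 ^ (r + od).+1)%N.
have a1 : (1 < a)%N by rewrite -(expn0 2) ltn_exp2l.
have bb1 : (1 < b)%N by rewrite -(expn0 2) ltn_exp2l.
have AE : (2 ^ M1 = side_len 0 J * a)%N by rewrite side_lenE -expnD M1E.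
have BE : (2 ^ M2 = side_len 0 J * b)%N by rewrite side_lenE -expnD M2E.
set s := _ * _.
have hs : s <= (core 0 J * (a * b).-1)%:R.
  have -> : s = (2 ^ M1 * 2 ^ M2)%:R / 4.
    rewrite /s natrM !natrX !exprD; field; rewrite !expf_eq0 ?pnatr_eq0 ?andbF //.
  rewrite ler_pdivrMr // -natrM ler_nat AE BE mulnACA.
  have := core_half J; have : (1 < a * b)%N by rewrite (leq_trans a1) // leq_pmulr // ltnW.
  move: (a * b)%N (core 0 J) (side_len 0 J * side_len 0 J)%N => x y z x1 yz.
  apply: leq_trans (_ : (2 * y) * (2 * x.-1) <= _)%N; last by rewrite mulnACA mulnC.
  by apply: leq_mul => //; move: x1; clear; lia.
have kapl : kap <= 1 / 400 by [].
have := component_prob ind hp N0 kap0 kapl (lexx _) b1 b2 b3 t1 t2 t3 t4 a1 bb1 AE BE small hs.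
rewrite prob_setC => h.
have h2 := le_trans h (le_trans (half_bound R JJ rJ (_ : r + od <= J.+2)%N) hJ0).
have rod : (r + od <= J.+2)%N by rewrite -addn1 leq_add.
by have := h2 rod; rewrite lerBlDr addrC -lerBlDr.
Qed.

From mathcomp Require Import all_classical all_reals all_analysis.

Local Open Scope ring_scope.

(** * A member of the class, and the limit of the infima *)

Section AllOpen.
Context (R : realFieldType) (G : sgraph).

Let all_open_mass (w : {set {set G}}) : R := (w == edges G)%:R.

Let all_open_ge0 w : 0 <= all_open_mass w. Proof. exact: ler0n. Qed.

Let all_open_supp (w : {set {set G}}) : ~~ (w \subset edges G) -> all_open_mass w = 0.
Proof. by rewrite /all_open_mass; case: eqVneq => // ->; rewrite subxx. Qed.

Let all_open_sum : \sum_w all_open_mass w = 1.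
Proof.
rewrite (bigD1 (edges G)) //= /all_open_mass eqxx big1 ?addr0 // => w.
by move=> /negbTE ->.
Qed.

Definition all_open : bond_model R G := BondModel all_open_ge0 all_open_supp all_open_sum.

Lemma prob_all_open (A : pred {set {set G}}) : prob all_open A = (A (edges G))%:R.
Proof.
rewrite probE /expect (bigD1 (edges G)) //= /all_open_mass eqxx mul1r big1 ?addr0 // => w.
by move=> /negbTE ->; rewrite mul0r.
Qed.

Lemma all_open_indep : one_independent all_open.
Proof. by move=> S1 S2 *; rewrite !prob_all_open -natrM mulnb. Qed.

Lemma all_open_ge p : p <= 1 -> open_with_prob_ge p all_open.
Proof. by move=> p1 e eG; rewrite prob_all_open eG. Qed.

End AllOpen.

Theorem mainTheorem7 (R : realType) :
  (p_giant R <= (5847 / 10000 : R)%:E)%E.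
Proof.
have [C C0 whp] := giant_whp R.
apply: ereal_inf_lbound; exists (5847 / 10000 : R) => //; exists C => //.
have p1 : 5847 / 10000 <= 1 :> R by lra.
(* The class is not empty, so the infimum is not [+oo]. *)
have ub n : (inf_prob_giant (5847 / 10000 : R) C n <= 1)%E.
  apply: le_trans (_ : (prob (all_open R (hypercube n)) (has_component_ge (C * 2 ^+ n)))%:E <= _)%E.
    apply: ereal_inf_lbound; exists (all_open R (hypercube n)) => //.
    by split; [exact: all_open_indep | exact: all_open_ge].
  by rewrite lee_fin prob_le1.
have lb (eps : R) : 0 < eps -> exists n0, forall n, (n0 <= n)%N ->
    ((1 - eps)%:E <= inf_prob_giant (5847 / 10000 : R) C n)%E.
  move=> e0; have [n0 h] := whp eps e0; exists n0 => n nn0.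
  by apply: le_ereal_inf_tmp => _ [mu [m1 m2] <-]; rewrite lee_fin; apply: h.
have pos n : (0%:E <= inf_prob_giant (5847 / 10000 : R) C n)%E.
  by apply: le_ereal_inf_tmp => _ [mu _ <-]; rewrite lee_fin prob_ge0.
have fn n : inf_prob_giant (5847 / 10000 : R) C n \is a fin_num.
  rewrite fin_numE; apply/andP; split.
    by apply/eqP => e; have := pos n; rewrite e.
  by apply/eqP => e; have := ub n; rewrite e.
apply/fine_cvgP; split; first by near=> n.
apply/cvgrPdist_le => eps e0.
have [n0 h] := lb eps e0.
near=> n => /=.
have nn : (n0 <= n)%N by near: n; exact: nbhs_infty_ge.
have := h n nn; have := ub n.
rewrite -{1 2}(fineK (fn n)) !lee_fin => u l.
by rewrite ger0_norm ?subr_ge0 // lerBlDr addrC -lerBlDr.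
Unshelve. all: by end_near.
Qed.
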